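(* There is a universal constant $c_0>0$ such that the following holds. Consider the model $Y=\mathcal{X}(M')+Z$ with $\mathcal{X}\in\mathbb{R}^{n\times p}$ a Gaussian ensemble design and $Z\sim N(0,\frac{\sigma^2}{n}I_n)$ independent of $\mathcal{X}$. Let $M\in\mathbb{R}^p$ be the true parameter of interest. Let $0<c<1$ be a constant. For any $\delta>0$, if $$n\ge\frac{4[w(B_2^p\cap T_{\mathcal{A}}(M))+\delta]^2}{c^2}\vee\frac1c,$$ then with probability at least $1-2\exp(-\delta^2/2)$ (with respect to the distribution of $\mathcal{X}$), $$\inf_{\hat M}\sup_{M'\in T_{\mathcal{A}}(M)}\mathbb{E}_{\cdot|\mathcal{X}}\|\hat M-M'\|_{\ell_2}^2\ge\frac{c_0\sigma^2}{(1+c)^2}\cdot\left(\frac{e(B_2^p\cap T_{\mathcal{A}}(M))}{\sqrt n}\right)^2,$$ where the infimum is over all measurable estimators $\hat M$ based on $(\mathcal{X},Y)$ and $\mathbb{E}_{\cdot|\mathcal{X}}$ is the conditional expectation given $\mathcal{X}$ when $M'$ is the parameter generating $Y$.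
   Context: $\mathcal{A}\subset\mathbb{R}^p$ is a compact atom set whose elements are extreme points of $\mathrm{conv}(\mathcal{A})$, with $\mathrm{conv}(\mathcal{A})$ a symmetric convex body, scaled so that $\sup_{v\in\mathcal{A}}\|v\|_{\ell_2}=1$. Atomic norm: $\|x\|_{\mathcal{A}}=\inf\{t>0:x\in t\,\mathrm{conv}(\mathcal{A})\}$. $B_2^p$ is the closed Euclidean unit ball of $\mathbb{R}^p$; $a\vee b=\max(a,b)$. Tangent cone: $T_{\mathcal{A}}(x)=\mathrm{cone}\{h:\|x+h\|_{\mathcal{A}}\le\|x\|_{\mathcal{A}}\}$ with $\mathrm{cone}(S)=\{th:t\ge0,h\in S\}$. Gaussian width: $w(K)=\mathbb{E}_{g\sim N(0,I_p)}\sup_{v\in K}\langle g,v\rangle$. Sudakov estimate: $e(K)=\sup_{\epsilon>0}\epsilon\sqrt{\log\mathcal{N}(K,\epsilon)}$, where $\mathcal{N}(K,\epsilon)$ is the smallest cardinality of a set $S\subset K$ such that every $x\in K$ has some $y\in S$ with $\|x-y\|_{\ell_2}<\epsilon$. Gaussian ensemble design: $\mathcal{X}$ has i.i.d. entries $N(0,1/n)$. *)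

(* Defs.v *)
(* MathComp-Analysis; all real quantities live in an arbitrary R : realType. *)
From HB Require Import structures.
From mathcomp Require Import all_boot all_order all_algebra finmap.
From mathcomp Require Import all_classical all_reals all_analysis.
From mathcomp Require Import measurable_realfun.

Set Implicit Arguments.
Unset Strict Implicit.
Unset Printing Implicit Defensive.

Import Order.TTheory GRing.Theory Num.Theory.
Import numFieldNormedType.Exports.

Local Open Scope classical_set_scope.
Local Open Scope ring_scope.

(* The sigma-algebra on matrices is the one generated by the entries, as the
   library does for n.-tuple; in finite dimension it is the Borel one. *)
Definition measure_mx_display : measure_display.
Proof. exact: default_measure_display. Qed.

Section measurable_matrix.
Context {R : realType} (m n : nat).

Definition mx_sigma : set (set 'M[R]_(m, n)) :=
  <<s \bigcup_(ij in [set: 'I_m * 'I_n])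
        preimage_set_system setT (fun A : 'M[R]_(m, n) => A ij.1 ij.2)
          (@measurable _ R) >>.

Let mx_sigma0 : mx_sigma set0.
Proof. exact: sigma_algebra0. Qed.

Let mx_sigmaC A : mx_sigma A -> mx_sigma (~` A).
Proof. exact: sigma_algebraC. Qed.

Let mx_sigma_bigcup (F : (set 'M[R]_(m, n))^nat) :
  (forall i, mx_sigma (F i)) -> mx_sigma (\bigcup_i F i).
Proof. exact: sigma_algebra_bigcup. Qed.

HB.instance Definition _ := @isMeasurable.Build measure_mx_display
  'M[R]_(m, n) mx_sigma mx_sigma0 mx_sigmaC mx_sigma_bigcup.

Lemma measurable_entry (i : 'I_m) (j : 'I_n) :
  measurable_fun [set: 'M[R]_(m, n)] (fun A : 'M[R]_(m, n) => A i j).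
Proof.
move=> _ Y mY; rewrite setTI; apply: sub_sigma_algebra.
by exists (i, j) => //; exists Y => //; rewrite setTI.
Qed.

Lemma measurable_fun_mxP d (T : measurableType d) (f : T -> 'M[R]_(m, n)) :
  (forall i j, measurable_fun [set: T] (fun t => f t i j)) ->
  measurable_fun [set: T] f.
Proof.
move=> mf.
apply: (@measurability _ _ T 'M[R]_(m, n) setT f
  (\bigcup_(ij in [set: 'I_m * 'I_n])
        preimage_set_system setT (fun A : 'M[R]_(m, n) => A ij.1 ij.2)
          (@measurable _ R))) => //.
move=> _ [_ [[i j] _ [Y mY <-]] <-]; rewrite setTI setTI.
by rewrite -[X in measurable X]setTI; exact: mf.
Qed.

End measurable_matrix.

Section iid.
Context d (T : measurableType d) (R : realType).

Definition tuple_cons n (x : T * n.-tuple T) : n.+1.-tuple T :=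
  [tuple of x.1 :: x.2].

Let measurable_tuple_cons n : measurable_fun setT (@tuple_cons n).
Proof. exact: measurable_cons. Qed.

HB.instance Definition _ n :=
  isMeasurableFun.Build _ _ _ _ (@tuple_cons n) (@measurable_tuple_cons n).

(* n-fold product of mu *)
Fixpoint iid (mu : probability T R) (n : nat) : probability (n.-tuple T) R :=
  if n isn't n'.+1 then \d_([tuple])
  else distribution (mu \x iid mu n')%E (@tuple_cons n').

End iid.

Section gaussian.
Context {R : realType}.

(* N(0, s^2), the point mass at 0 when s = 0: the library's normal_prob is by
   convention a uniform law at standard deviation 0. It lives on
   measurableTypeR R, a copy of R with the same measurable sets. *)
Definition gauss1 (s : R) : probability (measurableTypeR R) R :=
  if s == 0 then (\d_(0 : measurableTypeR R) : probability _ R)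
  else (normal_prob (0 : R) s : probability _ R).

Definition mx_of_tuple (m n : nat) (t : (m * n).-tuple (measurableTypeR R)) :
    'M[R]_(m, n) :=
  \matrix_(i, j) tnth t (mxvec_index i j).

Let measurable_mx_of_tuple m n : measurable_fun setT (@mx_of_tuple m n).
Proof.
apply: measurable_fun_mxP => i j.
rewrite (_ : (fun t => _) = (@tnth _ (measurableTypeR R))^~ (mxvec_index i j)).
  exact: measurable_tnth.
by apply/funext => t; rewrite mxE.
Qed.

HB.instance Definition _ m n :=
  isMeasurableFun.Build _ _ _ _ (@mx_of_tuple m n) (@measurable_mx_of_tuple m n).

(* law of an m x n matrix with i.i.d. N(0, s^2) entries *)
Definition gauss_mx (m n : nat) (s : R) : probability 'M[R]_(m, n) R :=
  distribution (iid (gauss1 s) (m * n)) (@mx_of_tuple m n).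

End gaussian.

Section geometry.
Context {R : realType} {p : nat}.
Implicit Types (A K : set 'cV[R]_p) (x u v : 'cV[R]_p).

(* The norm `|x| of the library on matrices is the sup norm. *)
Definition l2norm x : R := Num.sqrt (\sum_i x i ord0 ^+ 2).

Definition inner u v : R := \sum_i u i ord0 * v i ord0.

Definition l2ball : set 'cV[R]_p := [set x | l2norm x <= 1].

Definition conv_hull A : set 'cV[R]_p :=
  smallest (@convex_set R 'cV[R]_p) A.

Definition extreme_points K : set 'cV[R]_p :=
  [set x | K x /\ forall y z (t : R), K y -> K z -> 0 < t < 1 ->
    x = t *: y + (1 - t) *: z -> y = x /\ z = x].

Definition symmetric_convex_body K : Prop :=
  [/\ @convex_set R 'cV[R]_p K, compact K, K° !=set0
    & forall x, K x -> K (- x)].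

Definition atom_set A : Prop :=
  [/\ compact A, A `<=` extreme_points (conv_hull A),
      symmetric_convex_body (conv_hull A) & sup (l2norm @` A) = 1].

Definition atomic_norm A x : R :=
  inf [set t | 0 < t /\ exists2 y, conv_hull A y & x = t *: y].

Definition cone K : set 'cV[R]_p :=
  [set u | exists t : R, exists2 h, K h & 0 <= t /\ u = t *: h].

Definition tangent_cone A x : set 'cV[R]_p :=
  cone [set h | atomic_norm A (x + h) <= atomic_norm A x].

Definition gaussian_width K : \bar R :=
  (\int[gauss_mx p 1 1]_g ereal_sup [set (inner g v)%:E | v in K])%E.

(* S ranges over finite sets; the value is +oo when no finite S works. *)
Definition covering_number K (eps : R) : \bar R :=
  ereal_inf [set (#|` S|%fset%:R)%:E | S in [set S : {fset 'cV[R]_p} |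
    [set` S] `<=` K /\
    forall x, K x -> exists2 y, y \in S & l2norm (x - y) < eps]].

Definition sudakov K : \bar R :=
  ereal_sup [set (eps%:E * sqrte (lne (covering_number K eps)))%E
            | eps in [set eps : R | 0 < eps]].

End geometry.

Section model.
Context {R : realType} (n p : nat).

Definition design_law : probability 'M[R]_(n, p) R :=
  gauss_mx n p (Num.sqrt n%:R)^-1.

Definition noise_law (sigma : R) : probability 'cV[R]_n R :=
  gauss_mx n 1 (sigma / Num.sqrt n%:R).

(* Estimators are measurable functions of the pair (X, Y). *)
Definition estimator : Type :=
  {mfun ('M[R]_(n, p) * 'cV[R]_n)%type >-> 'cV[R]_p}.

(* E[ |Mhat(X, X M' + Z) - M'|^2 | X = x ]: as X and Z are independent, the
   regular conditional law of Y given X = x is that of x M' + Z. That this is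
   the conditional expectation is cond_riskE below. *)
Definition cond_risk (sigma : R) (Mhat : estimator) (M' : 'cV[R]_p)
    (x : 'M[R]_(n, p)) : \bar R :=
  (\int[noise_law sigma]_z
     (l2norm (Mhat (x, x *m M' + z)%R - M') ^+ 2)%:E)%E.

Definition minimax_risk (sigma : R) (T : set 'cV[R]_p) (x : 'M[R]_(n, p)) :
    \bar R :=
  ereal_inf [set ereal_sup [set cond_risk sigma Mhat M' x | M' in T]
            | Mhat in [set: estimator]].

Let loss (Mhat : estimator) (M' : 'cV[R]_p) (xz : 'M[R]_(n, p) * 'cV[R]_n) :
  \bar R := (l2norm (Mhat (xz.1, xz.1 *m M' + xz.2) - M') ^+ 2)%:E.

Let measurable_loss (Mhat : estimator) (M' : 'cV[R]_p) :
  measurable_fun setT (loss Mhat M').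
Proof.
have mpair : measurable_fun setT (fun xz : 'M[R]_(n, p) * 'cV[R]_n =>
    (xz.1, xz.1 *m M' + xz.2)).
  apply: measurable_fun_pair => //; apply: measurable_fun_mxP => i j.
  rewrite (_ : (fun t => _) = fun t : 'M[R]_(n, p) * 'cV[R]_n =>
     \sum_k t.1 i k * M' k j + t.2 i j); last first.
    by apply/funext => t; rewrite !mxE.
  apply: measurable_funD.
    apply: measurable_sum => k; apply: measurable_funM => //.
    exact: (measurableT_comp (measurable_entry i k)).
  exact: (measurableT_comp (measurable_entry i j)).
apply/measurable_EFinP; apply: measurable_funX.
have msqrt : measurable_fun [set: R] (Num.sqrt : R -> R).
  by apply: continuous_measurable_fun; exact: sqrt_continuous.
apply: (measurableT_comp msqrt).
apply: measurable_sum => k; apply: measurable_funX.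
rewrite (_ : (fun t => _) = fun t : 'M[R]_(n, p) * 'cV[R]_n =>
  Mhat (t.1, t.1 *m M' + t.2) k ord0 - M' k ord0); last first.
  by apply/funext => t; rewrite !mxE.
apply: measurable_funB => //.
apply: (measurableT_comp (measurable_entry k ord0)).
by apply: (measurableT_comp _ mpair).
Qed.

Let loss_ge0 (Mhat : estimator) M' xz : (0 <= loss Mhat M' xz)%E.
Proof. by rewrite lee_fin sqr_ge0. Qed.

Lemma measurable_cond_risk sigma (Mhat : estimator) M' :
  measurable_fun setT (cond_risk sigma Mhat M').
Proof.
exact: (@measurable_fun_fubini_tonelli_F _ _ 'M[R]_(n, p) 'cV[R]_n R
  (noise_law sigma) _ (measurable_loss Mhat M') (loss_ge0 Mhat M')).
Qed.

(* For (X, Z) with law design_law \x noise_law and Y = X M' + Z,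
   E[1_B(X) |Mhat(X, Y) - M'|^2] = E[1_B(X) cond_risk(X)]. *)
Lemma cond_riskE sigma (Mhat : estimator) M' (B : set 'M[R]_(n, p)) :
  measurable B ->
  (\int[design_law \x noise_law sigma]_xz
     ((\1_B xz.1)%:E *
      (l2norm (Mhat (xz.1, xz.1 *m M' + xz.2)%R - M') ^+ 2)%:E) =
   \int[design_law]_x ((\1_B x)%:E * cond_risk sigma Mhat M' x))%E.
Proof.
move=> mB.
pose F (xz : 'M[R]_(n, p) * 'cV[R]_n) : \bar R :=
  ((\1_B xz.1)%:E * loss Mhat M' xz)%E.
have mF : measurable_fun setT F.
  apply: emeasurable_funM; last exact: measurable_loss.
  apply/measurable_EFinP.
  exact: (measurableT_comp (measurable_indic mB) measurable_fst).
have F0 xz : (0 <= F xz)%E by rewrite mule_ge0// lee_fin.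
rewrite (@fubini_tonelli1 _ _ _ _ R design_law (noise_law sigma) F mF F0).
apply: eq_integral => x _.
rewrite /fubini_F/= /F /cond_risk /=.
rewrite -[RHS]ge0_integralZl//.
- exact: (measurable_fun_pair2 x (measurable_loss Mhat M')).
- by move=> z _; exact: (loss_ge0 Mhat M' (x, z)).
Qed.

End model.

(* S holds with probability at least q; S need not be measurable. *)
Definition prob_ge d (T : measurableType d) (R : realType)
    (P : probability T R) (S : set T) (q : R) : Prop :=
  exists E, [/\ measurable E, E `<=` S & (q%:E <= P E)%E].

(* Main.v *)
(** On the event that |X v| <= 1 + c for every v in K, the intersection of the unit
    ball with the tangent cone, take k points of K at mutual distance at least eps
    and scale them by r with r^2 = sigma^2 ln k / (2 n (1 + c)^2). Under these k
    hypotheses Y is a shift of the noise by at most half of ln k in squared norm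
    per unit variance; by Cameron-Martin and AM-GM no estimator falls into the k
    disjoint balls of radius r eps / 2 around them with average probability above
    k^(-1/4), so one of the hypotheses has risk of order r^2 eps^2. The covering
    number is at most the size of a maximal eps-separated family.

    For |u| = 1 and v in K, the Gaussian process <u, G v> has smaller increments than
    <g, v> + <h, u>. The Sudakov-Fernique comparison and the concentration of
    the maximum are obtained in one go, as
    E exp (lam max X) <= exp (lam E max Y + lam^2 / 2):
    X is turned into Y in small steps, and softmax averaged over part of Y has a
    second order expansion whose quadratic part is a nonnegative combination of the
    squares (d_i - d_j)^2. Markov's inequality with lam = 2 delta bounds the
    probability of the bad event. *)
Require Import Defs.
From HB Require Import structures.
From mathcomp Require Import all_boot all_order all_algebra finmap.
From mathcomp Require Import all_classical all_reals all_analysis.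
From mathcomp Require Import measurable_realfun.
From mathcomp Require Import ring lra.

Set Implicit Arguments.
Unset Strict Implicit.
Unset Printing Implicit Defensive.

Import Order.TTheory GRing.Theory Num.Theory.
Import numFieldNormedType.Exports.

Local Open Scope classical_set_scope.
Local Open Scope ring_scope.

(** Two obstacles shape the proof. First, no separate concentration inequality is used:
    interpolating in finitely many steps and keeping an exponential moment gives comparison and
    concentration together, since a step needs only a second-order expansion with an error of order
    s^3. The price is log-sum-exp instead of the maximum; it costs ln 2 in the exponent. Second, K
    can be infinite and its supremum is not known to be measurable. All probabilistic work is
    therefore done with finite families: their maxima are bounded by the width through a
    monotonicity of the integral that assumes no measurability, and countable dense families carry
    the tail bound over to all of K.

    Origin of 1/64: separation r eps gives balls of radius rho = r eps / 2, the estimator misses one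
    of them with probability at least 1/8, so the risk is at least r^2 eps^2 / 32, and r^2
    contributes another 1/2. *)

(** * Normal laws on the line: density, shift, scaling, sums *)

Section gauss1_density.
Context {R : realType}.
Local Open Scope ereal_scope.
Local Notation mu := (@lebesgue_measure R).

(** The image of Lebesgue measure under x -> a x + m, multiplied by a, gives half-open intervals
    their length, hence is Lebesgue measure by uniqueness. *)
Lemma ge0_lebesgue_affine (a m : R) (f : measurableTypeR R -> \bar R) : (0 < a)%R ->
  measurable_fun setT f -> (forall x, 0 <= f x) ->
  \int[mu]_x f x = a%:E * \int[mu]_(x in [set: measurableTypeR R]) f (a * x + m)%R.
Proof.
move=> a0 mf f0.
pose phi : measurableTypeR R -> measurableTypeR R := fun x : R => (a * x + m)%R.
have mphi : measurable_fun setT phi.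
  by apply: measurable_funD => //; exact: measurable_funM.
pose nu : {measure set (measurableTypeR R) -> \bar R} :=
  mscale (NngNum (ltW a0)) (measure_function_pushforward__canonical__measure_function_Measure mu mphi).
have nuE A : measurable A -> mu A = nu A.
  apply: lebesgue_measure_unique => //= _ [[c d]] _ <-.
  rewrite /nu /mscale/= /pushforward.
  have -> : phi @^-1` `]c, d] = `]((c - m) / a)%R, ((d - m) / a)%R]%classic.
    apply/seteqP; split => x; rewrite /phi/= !in_itv/=.
      by rewrite ltr_pdivrMr// ler_pdivlMr// ltrBlDr lerBrDr [(x * a)%R]mulrC.
    by rewrite ltr_pdivrMr// ler_pdivlMr// ltrBlDr lerBrDr [(x * a)%R]mulrC.
  rewrite !lebesgue_measure_itv/= !lte_fin ltr_pM2r ?invr_gt0// ltrD2r.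
  case: ifPn => _; last by rewrite mule0.
  rewrite -!EFinB -EFinM; congr EFin.
  by field; rewrite gt_eqF.
rewrite (eq_measure_integral nu); last by move=> A mA _; exact: nuE.
by rewrite ge0_integral_mscale// ge0_integral_pushforward.
Qed.

Lemma ge0_integral_gauss1 (s : R) (f : measurableTypeR R -> \bar R) : s != 0%R ->
  measurable_fun setT f -> (forall x, 0 <= f x) ->
  \int[gauss1 s]_x f x = \int[mu]_x (f x * (normal_pdf 0 s x)%:E).
Proof.
move=> s0 mf f0.
rewrite /gauss1 (negbTE s0).
have dom := @normal_prob_dominates R 0 s.
transitivity (\int[normal_prob 0 s]_x f x); first by [].
rewrite -(Radon_Nikodym_SigmaFinite.change_of_variables dom f0)//.
apply: ae_eq_integral => //.
- apply: emeasurable_funM => //.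
  exact: measurable_int (Radon_Nikodym_SigmaFinite.f_integrable dom).
- apply: emeasurable_funM => //.
  by apply/measurable_EFinP; exact: measurable_normal_pdf.
(* The Radon-Nikodym derivative and the normal density have the same integral over every measurable
   set, so they agree almost everywhere. *)
- apply: ae_eqe_mul2l => /=.
  apply: integral_ae_eq => //.
  + exact: Radon_Nikodym_SigmaFinite.f_integrable.
  + by apply/measurable_EFinP; exact: measurable_normal_pdf.
  + by move=> E _ mE; rewrite -Radon_Nikodym_SigmaFinite.f_integral.
Qed.

End gauss1_density.

Section gauss1_change_of_variables.
Context {R : realType}.
Local Open Scope ereal_scope.
Local Notation mu := (@lebesgue_measure R).
Local Notation TR := [set: measurableTypeR R].
Implicit Types f : measurableTypeR R -> \bar R.

Let mpdf (s : R) : measurable_fun setT (fun x : measurableTypeR R => (normal_pdf 0 s x)%:E).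
Proof. by apply/measurable_EFinP; exact: measurable_normal_pdf. Qed.

Let pdf0 (s x : R) : 0 <= (normal_pdf 0 s x)%:E.
Proof. by rewrite lee_fin normal_pdf_ge0. Qed.

Let maff (a m : R) : measurable_fun setT
  (fun x : measurableTypeR R => (a * x + m)%R : measurableTypeR R).
Proof. by apply: measurable_funD => //; exact: measurable_funM. Qed.

(** Cameron-Martin on the line: translate by m on the right and complete the square in the
    exponent. *)
Lemma ge0_integral_gauss1_shift (s m : R) f : s != 0%R ->
  measurable_fun setT f -> (forall x, 0 <= f x) ->
  \int[gauss1 s]_(x in TR) f (x + m)%R =
  \int[gauss1 s]_(x in TR) (f x * (expR (m * x / s ^+ 2 - m ^+ 2 / (s ^+ 2 *+ 2)))%:E).
Proof.
move=> s0 mf f0.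
have mfm : measurable_fun setT (fun x : measurableTypeR R => f (x + m)%R).
  have := measurableT_comp mf (@maff 1 m).
  by apply: eq_measurable_fun => x _ /=; rewrite mul1r.
have mexp : measurable_fun setT (fun x : measurableTypeR R =>
    (expR (m * x / s ^+ 2 - m ^+ 2 / (s ^+ 2 *+ 2)))%:E).
  apply/measurable_EFinP; apply: measurableT_comp => //.
  have := @maff (m / s ^+ 2)%R (- (m ^+ 2 / (s ^+ 2 *+ 2)))%R.
  by apply: eq_measurable_fun => x _ /=; rewrite mulrAC.
have fe0 x : 0 <= f x * (expR (m * x / s ^+ 2 - m ^+ 2 / (s ^+ 2 *+ 2)))%:E.
  by rewrite mule_ge0// lee_fin expR_ge0.
rewrite !ge0_integral_gauss1//; last exact: emeasurable_funM.
rewrite [RHS](@ge0_lebesgue_affine _ 1 m)//; last 2 first.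
- by apply: emeasurable_funM => //; exact: emeasurable_funM.
- by move=> x; rewrite mule_ge0.
rewrite mul1e; apply: eq_integral => x _; rewrite mul1r -muleA; congr (_ * _).
rewrite -EFinM normal_pdfE// mulrCA; congr (_ * _)%:E.
rewrite /normal_fun -expRD; congr expR.
by field.
Qed.

Lemma ge0_integral_gauss1_scale (s : R) f : (0 <= s)%R ->
  measurable_fun setT f -> (forall x, 0 <= f x) ->
  \int[gauss1 s]_(x in TR) f x = \int[gauss1 1]_(x in TR) f (s * x)%R.
Proof.
rewrite le_eqVlt => /predU1P[<-|s0] mf f0.
  (* For s = 0 the law is the point mass at 0 and both sides are f 0. *)
  rewrite {1}/gauss1 eqxx integral_dirac// diracT mul1e.
  under [RHS]eq_integral do rewrite mul0r.
  by rewrite integral_cst// -[LHS]mule1 -(@probability_setT _ _ _ (gauss1 1)).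
have mfs : measurable_fun setT (fun x : measurableTypeR R => f (s * x)%R).
  have := measurableT_comp mf (@maff s 0).
  by apply: eq_measurable_fun => x _ /=; rewrite addr0.
have s0' : s != 0%R by rewrite gt_eqF.
rewrite [LHS](@ge0_integral_gauss1 R s _ s0' mf f0).
have f0s x : 0 <= f (s * x)%R by exact: f0.
apply/esym/(eq_trans (ge0_integral_gauss1 (oner_neq0 R) mfs f0s))/esym.
rewrite [LHS](@ge0_lebesgue_affine _ s 0)//; last 2 first.
- exact: emeasurable_funM.
- by move=> x; rewrite mule_ge0.
rewrite -ge0_integralZl//; last 3 first.
- apply: emeasurable_funM.
    by apply: eq_measurable_fun mfs => x _; rewrite addr0.
  exact: measurableT_comp (mpdf s) (@maff s 0).
- by move=> x _; rewrite mule_ge0.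
- by rewrite lee_fin ltW.
apply: eq_integral => x _; rewrite addr0 muleCA; congr (_ * _).
rewrite -EFinM !normal_pdfE ?gt_eqF// mulrA; congr (_ * _)%:E.
  rewrite /normal_peak -!mulrnAr sqrtrM ?sqr_ge0// sqrtr_sqr gtr0_norm//.
  by rewrite expr1n mul1r invfM mulrA mulfV ?mul1r// gt_eqF.
rewrite /normal_fun !subr0; congr expR.
by field; rewrite gt_eqF.
Qed.

Let conv_exponent (a b x y : R) : (b != 0 -> a ^+ 2 + b ^+ 2 = 1 ->
  - (y - 0) ^+ 2 / (1 ^+ 2 *+ 2) + - (x - 0) ^+ 2 / (1 ^+ 2 *+ 2) =
  - (a * x + b * y - 0) ^+ 2 / (1 ^+ 2 *+ 2) +
  - (x - a * (a * x + b * y)) ^+ 2 / (b ^+ 2 *+ 2))%R.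
Proof.
move=> b0 ab1; rewrite !subr0 !expr1n.
have -> : (x - a * (a * x + b * y) = b * (b * x - a * y))%R.
  by rewrite -[X in (X - _)%R]mul1r -ab1; ring.
have -> : (- y ^+ 2 / (1 *+ 2) + - x ^+ 2 / (1 *+ 2) =
    - ((a ^+ 2 + b ^+ 2) * (x ^+ 2 + y ^+ 2)) / 2)%R by rewrite ab1; field.
by field.
Qed.

(** For fixed x the new inner variable is a x + b y. The joint density then factors as the standard
    density of that variable times the N(a y, b^2) density of x, which integrates to 1 after
    Fubini. *)
Lemma ge0_integral_gauss1_conv1 (a b : R) f : (0 < b)%R -> (a ^+ 2 + b ^+ 2 = 1)%R ->
  measurable_fun setT f -> (forall x, 0 <= f x) ->
  \int[gauss1 1]_(x in TR) \int[gauss1 1]_(y in TR) f (a * x + b * y)%R =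
  \int[gauss1 1]_(x in TR) f x.
Proof.
move=> b0 ab1 mf f0.
have b0' : b != 0%R by rewrite gt_eqF.
have mf2 : measurable_fun setT (fun xy : measurableTypeR R * measurableTypeR R =>
    f (a * xy.1 + b * xy.2)%R).
  apply: (measurableT_comp mf).
  by apply: measurable_funD => //; apply: measurable_funM.
have m2 : measurable_fun setT (fun xy : measurableTypeR R * measurableTypeR R =>
    f xy.2 * (normal_pdf 0 1 xy.2)%:E * (normal_pdf (a * xy.2) b xy.1)%:E).
  apply: emeasurable_funM; first apply: emeasurable_funM.
  - exact: measurableT_comp mf _.
  - exact: measurableT_comp (@mpdf 1) _.
  apply/measurable_EFinP; rewrite /normal_pdf (negbTE b0').
  apply: measurable_funM => //; apply: measurableT_comp => //.
  apply: measurable_funM => //; apply: measurable_funN.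
  apply: measurable_funX; apply: measurable_funB => //.
  exact: measurable_funM.
have pdfe0 (x y : R) : 0 <= (normal_pdf (a * x) b y)%:E.
  by rewrite lee_fin normal_pdf_ge0.
transitivity (\int[mu]_x \int[mu]_y
    (f y * (normal_pdf 0 1 y)%:E * (normal_pdf (a * y) b x)%:E)).
  rewrite ge0_integral_gauss1 ?oner_neq0//; last 2 first.
  - by apply: (@measurable_fun_fubini_tonelli_F _ _ (measurableTypeR R)
      (measurableTypeR R) R (gauss1 1) _ mf2) => xy.
  - by move=> x; exact: integral_ge0.
  apply: eq_integral => x _.
  have mfx := measurable_fun_pair2 x mf2.
  have mfp := emeasurable_funM mfx (@mpdf 1).
  have m2x := measurable_fun_pair2 x m2.
  rewrite [X in X * _](@ge0_integral_gauss1 R 1%R _ (oner_neq0 R) mfx)//.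
  transitivity (\int[mu]_y ((normal_pdf 0 1 x)%:E *
      (f (a * x + b * y)%R * (normal_pdf 0 1 y)%:E))).
    rewrite muleC (ge0_integralZl _ _ mfp)// => y _.
    exact: mule_ge0.
  rewrite [RHS](@ge0_lebesgue_affine _ b (a * x) _ b0 m2x); last first.
    by move=> y; rewrite !mule_ge0.
  have m3 := measurableT_comp m2x (@maff b (a * x)).
  rewrite -(ge0_integralZl _ _ m3)//; last 2 first.
  - by move=> y _ /=; rewrite !mule_ge0.
  - by rewrite lee_fin ltW.
  apply: eq_integral => y _ /=.
  rewrite [(b * y + _)%R]addrC muleCA [RHS]muleCA -!muleA; congr (_ * _).
  rewrite -!EFinM !normal_pdfE ?oner_neq0//; congr EFin.
  have pk : normal_peak b = (normal_peak 1 / b :> R)%R.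
    rewrite /normal_peak -!mulrnAr sqrtrM ?sqr_ge0// sqrtr_sqr gtr0_norm//.
    by rewrite expr1n mul1r invfM mulrC.
  rewrite pk /normal_fun.
  rewrite [LHS](_ : _ = normal_peak 1 ^+ 2 *
    (expR (- (y - 0) ^+ 2 / (1 ^+ 2 *+ 2)) * expR (- (x - 0) ^+ 2 / (1 ^+ 2 *+ 2))))%R; last first.
    by move: (normal_peak 1) (expR _) (expR _) => p u v; rewrite expr2 mulrACA [X in (_ * X)%R]mulrC.
  rewrite [RHS](_ : _ = normal_peak 1 ^+ 2 *
    (expR (- (a * x + b * y - 0) ^+ 2 / (1 ^+ 2 *+ 2)) *
     expR (- (x - a * (a * x + b * y)) ^+ 2 / (b ^+ 2 *+ 2))))%R; last first.
    by move: (normal_peak 1) (expR _) (expR _) => p u v; field.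
  rewrite -!expRD; congr (_ * expR _)%R.
  exact: conv_exponent.
rewrite (@fubini_tonelli _ _ _ _ _ mu mu _ m2)//; last first.
  by move=> [x y]; rewrite !mule_ge0.
rewrite ge0_integral_gauss1 ?oner_neq0//; apply: eq_integral => y _ /=.
have mp : measurable_fun setT (fun x : measurableTypeR R => (normal_pdf (a * y) b x)%:E).
  by apply/measurable_EFinP; exact: measurable_normal_pdf.
rewrite (ge0_integralZl _ _ mp)//; last exact: mule_ge0.
by rewrite integral_normal_pdf mule1.
Qed.

End gauss1_change_of_variables.

Section gauss1_linear.
Context {R : realType}.
Local Open Scope ereal_scope.
Local Notation mu := (@lebesgue_measure R).
Local Notation TR := [set: measurableTypeR R].
Implicit Types f : measurableTypeR R -> \bar R.

Lemma ge0_integral_gauss1N f : measurable_fun setT f -> (forall x, 0 <= f x) ->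
  \int[gauss1 1]_(x in TR) f (- x)%R = \int[gauss1 1]_x f x.
Proof.
move=> mf f0.
have mN : measurable_fun setT (-%R : measurableTypeR R -> measurableTypeR R) by [].
have mfN := measurableT_comp mf mN.
have mp : measurable_fun setT (fun x : measurableTypeR R => (normal_pdf 0 1 x)%:E).
  by apply/measurable_EFinP; exact: measurable_normal_pdf.
have p0 x : 0 <= (normal_pdf 0 1 x : R)%:E by rewrite lee_fin normal_pdf_ge0.
apply: (eq_trans (ge0_integral_gauss1 (oner_neq0 R) mfN _)) => [x|]; first exact: f0.
apply/esym/(eq_trans (ge0_integral_gauss1 (oner_neq0 R) mf f0)).
pose nu : {measure set (measurableTypeR R) -> \bar R} :=
  measure_function_pushforward__canonical__measure_function_Measure mu mN.
rewrite (eq_measure_integral nu); last first.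
  by move=> A mA _; exact/esym/lebesgue_measureN.
have fp0 : {in TR, forall x, 0 <= f x * (normal_pdf 0 1 x)%:E}.
  by move=> x _; rewrite mule_ge0.
apply: (eq_trans (ge0_integral_pushforward mN mu measurableT
  (emeasurable_funM mf mp) fp0)).
rewrite preimage_setT; apply: eq_integral => x _ /=; congr (_ * _%:E).
by rewrite normal_pdfE ?oner_neq0// /normal_fun !subr0 sqrrN.
Qed.

(** Dividing by r puts the coefficients on the unit circle. If b = 0 there is nothing to mix, and
    the symmetry of the law handles a negative a. *)
Lemma ge0_integral_gauss1_lin (a b : R) f : (0 <= b)%R ->
  measurable_fun setT f -> (forall x, 0 <= f x) ->
  \int[gauss1 1]_(x in TR) \int[gauss1 1]_(y in TR) f (a * x + b * y)%R =
  \int[gauss1 1]_(x in TR) f (Num.sqrt (a ^+ 2 + b ^+ 2) * x)%R.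
Proof.
move=> b0 mf f0.
have mfc (c : R) : measurable_fun setT (fun x : measurableTypeR R => f (c * x)%R).
  by apply: measurableT_comp mf _; exact: measurable_funM.
have [->|b1] := eqVneq b 0%R.
  transitivity (\int[gauss1 1]_(x in TR) f (a * x)%R).
    apply: eq_integral => x _.
    under eq_integral do rewrite mul0r addr0.
    by rewrite integral_cst// -[RHS]mule1 -(@probability_setT _ _ _ (gauss1 1)).
  rewrite expr0n/= addr0 sqrtr_sqr.
  have [a0|a0] := leP 0%R a; first by rewrite ger0_norm.
  rewrite ltr0_norm// -(ge0_integral_gauss1N (mfc (- a)%R))//.
  by apply: eq_integral => x _; rewrite mulNr mulrN opprK.
have bgt0 : (0 < b)%R by rewrite lt_def b1.
set r := Num.sqrt _.
have r0 : (0 < r)%R by rewrite sqrtr_gt0 ltr_wpDl ?sqr_ge0// exprn_gt0.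
have r2 : (r ^+ 2 = a ^+ 2 + b ^+ 2)%R by rewrite sqr_sqrtr// addr_ge0 ?sqr_ge0.
have ab1 : ((a / r) ^+ 2 + (b / r) ^+ 2 = 1)%R.
  by rewrite !expr_div_n -mulrDl -r2 mulfV// expf_neq0// gt_eqF.
have e (u v : R) : (a * u + b * v = r * (a / r * u + b / r * v))%R.
  by field; rewrite gt_eqF.
apply: (eq_trans _ (ge0_integral_gauss1_conv1 (divr_gt0 bgt0 r0) ab1 (mfc r) _)).
  by apply: eq_integral => x _; apply: eq_integral => y _; rewrite e.
by move=> x; exact: f0.
Qed.

End gauss1_linear.

(** * Integration over i.i.d. tuples, one coordinate at a time *)

Section iid_integral.
Context d (T : measurableType d) (R : realType) (P : probability T R).
Local Open Scope ereal_scope.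

Lemma measurable_tuple_consr n (f : n.+1.-tuple T -> \bar R) (x : T) :
  measurable_fun setT f ->
  measurable_fun setT (fun t : n.-tuple T => f (tuple_cons (x, t))).
Proof.
move=> mf; have mc : measurable_fun setT (f \o @tuple_cons _ T n).
  exact: measurableT_comp.
exact: (measurable_fun_pair2 x mc).
Qed.

Lemma measurable_integral_tuple_cons n (f : n.+1.-tuple T -> \bar R) :
  measurable_fun setT f -> (forall t, 0 <= f t) ->
  measurable_fun setT (fun x => \int[iid P n]_t f (tuple_cons (x, t))).
Proof.
move=> mf f0; have mc : measurable_fun setT (f \o @tuple_cons _ T n).
  exact: measurableT_comp.
exact: (@measurable_fun_fubini_tonelli_F _ _ T (n.-tuple T) R (iid P n) _ mc (fun=> f0 _)).
Qed.

Lemma ge0_integral_iidS n (f : n.+1.-tuple T -> \bar R) :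
  measurable_fun setT f -> (forall t, 0 <= f t) ->
  \int[iid P n.+1]_t f t = \int[P]_x \int[iid P n]_t f (tuple_cons (x, t)).
Proof.
move=> mf f0; have mc : measurable_fun setT (f \o @tuple_cons _ T n).
  exact: measurableT_comp.
apply: (eq_trans (ge0_integral_distribution _ mf f0)).
exact: (@fubini_tonelli1 _ _ _ _ R P (iid P n) _ mc (fun=> f0 _)).
Qed.

Lemma ge0_integral_iid0 (f : 0.-tuple T -> \bar R) :
  measurable_fun setT f -> (forall t, 0 <= f t) ->
  \int[iid P 0]_t f t = f [tuple].
Proof. by move=> mf f0; rewrite /= integral_dirac// diracT mul1e. Qed.

Lemma integral_prob_cst (c : \bar R) : \int[P]_x c = c.
Proof. by rewrite integral_cst//= probability_setT mule1. Qed.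

End iid_integral.

Section gauss_tuple_shift.
Context {R : realType}.
Local Open Scope ereal_scope.
Local Notation TR := (measurableTypeR R).

Lemma measurable_mktuple d (S : measurableType d) N (g : 'I_N -> S -> TR) :
  (forall i, measurable_fun setT (g i)) ->
  measurable_fun setT (fun s => [tuple g i s | i < N]).
Proof.
move=> mg; apply/measurable_fun_tnthP => i.
by apply: eq_measurable_fun (mg i) => s _ /=; rewrite tnth_mktuple.
Qed.

Lemma tnth_tuple_cons0 N (x : TR) (t : N.-tuple TR) : tnth (tuple_cons (x, t)) ord0 = x.
Proof. by []. Qed.

Lemma tnth_tuple_consS N (x : TR) (t : N.-tuple TR) i :
  tnth (tuple_cons (x, t)) (lift ord0 i) = tnth t i.
Proof. by rewrite /tuple_cons/= tnthS. Qed.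

Lemma mktuple_cons N (g : 'I_N.+1 -> TR) :
  [tuple g i | i < N.+1] = tuple_cons (g ord0, [tuple g (lift ord0 i) | i < N]).
Proof.
apply/eq_from_tnth => i; rewrite tnth_mktuple.
case: (unliftP ord0 i) => [j ->|->]; last by rewrite tnth_tuple_cons0.
by rewrite tnth_tuple_consS tnth_mktuple.
Qed.

Lemma measurable_coord N (i : 'I_N) :
  measurable_fun setT (fun t : N.-tuple TR => tnth t i : R).
Proof. exact: (@measurable_tnth _ TR). Qed.

Lemma measurable_lin N (a : 'I_N -> R) :
  measurable_fun setT (fun t : N.-tuple TR => (\sum_i a i * tnth t i)%R : TR).
Proof.
apply: measurable_sum => i; apply: measurable_funM => //; exact: measurable_tnth.
Qed.

Lemma lin_tuple_cons N (a : 'I_N.+1 -> R) (x : TR) (t : N.-tuple TR) :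
  (\sum_i a i * tnth (tuple_cons (x, t)) i =
   a ord0 * x + \sum_i a (lift ord0 i) * tnth t i)%R.
Proof.
rewrite big_ord_recl tnth_tuple_cons0; congr +%R.
by apply: eq_bigr => i _; rewrite tnth_tuple_consS.
Qed.

Lemma ge0_integral_gauss_shift N (s : R) (m : 'I_N -> R) (f : N.-tuple TR -> \bar R) :
  s != 0%R -> measurable_fun setT f -> (forall t, 0 <= f t) ->
  \int[iid (gauss1 s) N]_t f [tuple tnth t i + m i | i < N]%R =
  \int[iid (gauss1 s) N]_t (f t *
     (expR (\sum_i (m i * tnth t i / s ^+ 2 - m i ^+ 2 / (s ^+ 2 *+ 2))))%:E).
Proof.
move=> s0.
have mexp n (u : 'I_n -> R) : measurable_fun setT (fun t : n.-tuple TR =>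
    (expR (\sum_i (u i * tnth t i / s ^+ 2 - u i ^+ 2 / (s ^+ 2 *+ 2))))%:E).
  apply/measurable_EFinP; apply: measurableT_comp => //.
  apply: measurable_sum => i; apply: measurable_funB => //.
  apply: measurable_funM => //; apply: measurable_funM => //.
  exact: measurable_coord.
have mshift n (u : 'I_n -> R) :
    measurable_fun setT (fun t : n.-tuple TR => [tuple tnth t i + u i | i < n])%R.
  apply: measurable_mktuple => i; apply: measurable_funD => //.
  exact: measurable_coord.
elim: N => [|N IH] in m f * => mf f0.
  rewrite (ge0_integral_iid0 _ (measurableT_comp mf (mshift _ m)) (fun=> f0 _)).
  rewrite (ge0_integral_iid0 _ (emeasurable_funM mf (mexp _ m))).
    by rewrite big_ord0 expR0 mule1/=; congr f; exact: (tuple0 _).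
  by move=> t; rewrite mule_ge0// lee_fin expR_ge0.
pose m' i := m (lift ord0 i).
have mcons x := measurable_tuple_consr x mf.
(* With the tail integrated against its own density by induction, [F] is a function of the head
   alone, to which the one-dimensional shift applies. *)
pose F x := \int[iid (gauss1 s) N]_t (f (tuple_cons (x, t)) *
     (expR (\sum_i (m' i * tnth t i / s ^+ 2 - m' i ^+ 2 / (s ^+ 2 *+ 2))))%:E).
have F0 x : 0 <= F x.
  by apply: integral_ge0 => t _; rewrite mule_ge0// lee_fin expR_ge0.
have mF : measurable_fun setT F.
  pose G (t : N.+1.-tuple TR) := f t * (expR (\sum_i
     (m' i * tnth t (lift ord0 i) / s ^+ 2 - m' i ^+ 2 / (s ^+ 2 *+ 2))))%:E.
  have mG : measurable_fun setT G.
    apply: emeasurable_funM => //.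
    apply/measurable_EFinP; apply: measurableT_comp => //.
    apply: measurable_sum => i; apply: measurable_funB => //.
    apply: measurable_funM => //; apply: measurable_funM => //.
    exact: measurable_coord.
  have G0 t : 0 <= G t by rewrite mule_ge0// lee_fin expR_ge0.
  have := @measurable_integral_tuple_cons _ TR R (gauss1 s) N G mG G0.
  apply: eq_measurable_fun => x _.
  apply: eq_integral => t _; rewrite /G /F; congr (_ * (expR _)%:E).
  by apply: eq_bigr => i _; rewrite tnth_tuple_consS.
rewrite (ge0_integral_iidS _ (measurableT_comp mf (mshift _ m)) (fun=> f0 _)).
transitivity (\int[gauss1 s]_(x in [set: TR]) F (x + m ord0)%R).
  apply: eq_integral => x _; rewrite /F -IH//.
  apply: eq_integral => t _; congr f; rewrite mktuple_cons.
  rewrite tnth_tuple_cons0; congr tuple_cons; congr pair.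
  by apply/eq_from_tnth => i; rewrite !tnth_mktuple tnth_tuple_consS.
rewrite (ge0_integral_gauss1_shift _ s0 mF F0).
have fe0 t : 0 <= f t *
    (expR (\sum_i (m i * tnth t i / s ^+ 2 - m i ^+ 2 / (s ^+ 2 *+ 2))))%:E.
  by rewrite mule_ge0// lee_fin expR_ge0.
rewrite (ge0_integral_iidS _ (emeasurable_funM mf (mexp _ m)) fe0).
apply: eq_integral => x _; rewrite muleC /F.
have mh := emeasurable_funM (mcons x) (mexp _ m').
rewrite -(ge0_integralZl _ _ mh); last 3 first.
- exact: measurableT.
- by move=> t _; rewrite mule_ge0// lee_fin expR_ge0.
- by rewrite lee_fin expR_ge0.
apply: eq_integral => t _; rewrite muleCA; congr (_ * _).
rewrite -EFinM -expRD big_ord_recl tnth_tuple_cons0; congr (expR (_ + _))%:E.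
by apply: eq_bigr => i _; rewrite tnth_tuple_consS.
Qed.

End gauss_tuple_shift.

(** * Standard normal tuples: scaling, rotation, linear forms, marginals *)

Section gauss_tuple_linear.
Context {R : realType}.
Local Open Scope ereal_scope.
Local Notation TR := (measurableTypeR R).
Local Notation G := (iid (gauss1 (1 : R))).

Lemma ge0_integral_gauss_scale N (s : R) (f : N.-tuple TR -> \bar R) :
  (0 <= s)%R -> measurable_fun setT f -> (forall t, 0 <= f t) ->
  \int[iid (gauss1 s) N]_t f t = \int[G N]_t f [tuple s * tnth t i | i < N]%R.
Proof.
move=> s0.
have mscale n : measurable_fun setT
    (fun t : n.-tuple TR => [tuple s * tnth t i | i < n])%R.
  apply: measurable_mktuple => i; apply: measurable_funM => //.
  exact: measurable_coord.
elim: N => [|N IH] in f * => mf f0.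
  rewrite [LHS](ge0_integral_iid0 _ mf f0).
  rewrite [RHS](ge0_integral_iid0 _ (measurableT_comp mf (mscale _)) (fun=> f0 _)).
  by congr f; rewrite [RHS]tuple0.
rewrite [LHS](ge0_integral_iidS (gauss1 s) mf f0).
have mcons x := measurable_tuple_consr x mf.
have mfs := measurableT_comp mf (mscale N.+1).
rewrite [RHS](ge0_integral_iidS (gauss1 1) mfs (fun=> f0 _)).
have mF := measurable_integral_tuple_cons (gauss1 s) mf f0.
rewrite [LHS](ge0_integral_gauss1_scale s0 mF); last first.
  by move=> x; exact: integral_ge0.
apply: eq_integral => x _; rewrite [LHS](IH _ (mcons _) (fun=> f0 _)).
apply: eq_integral => t _ /=; congr f; rewrite mktuple_cons tnth_tuple_cons0.
congr (tuple_cons (_, _)).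
by apply/eq_from_tnth => i; rewrite !tnth_mktuple tnth_tuple_consS.
Qed.

Lemma measurable_tuple_comb N (a b : R) : measurable_fun setT
  (fun tt : N.-tuple TR * N.-tuple TR =>
     [tuple a * tnth tt.1 i + b * tnth tt.2 i | i < N])%R.
Proof.
apply: measurable_mktuple => i.
apply: measurable_funD; apply: measurable_funM => //.
- exact: (measurableT_comp (measurable_coord i)).
- exact: (measurableT_comp (measurable_coord i)).
Qed.

Lemma measurable_tuple_consf d (S : measurableType d) N (f : S -> TR)
    (g : S -> N.-tuple TR) : measurable_fun setT f -> measurable_fun setT g ->
  measurable_fun setT (fun s => tuple_cons (f s, g s)).
Proof. by move=> mf mg; exact: measurable_cons. Qed.

Lemma ge0_integral_gauss_conv N (a b : R) (f : N.-tuple TR -> \bar R) :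
  (0 <= b)%R -> measurable_fun setT f -> (forall t, 0 <= f t) ->
  \int[G N]_t \int[G N]_u f [tuple a * tnth t i + b * tnth u i | i < N]%R =
  \int[G N]_t f [tuple Num.sqrt (a ^+ 2 + b ^+ 2) * tnth t i | i < N]%R.
Proof.
move=> b0; set r := Num.sqrt _.
have mscale n : measurable_fun setT
    (fun t : n.-tuple TR => [tuple r * tnth t i | i < n])%R.
  apply: measurable_mktuple => i; apply: measurable_funM => //.
  exact: measurable_coord.
elim: N => [|N IH] in f * => mf f0.
  have e (F : 0.-tuple TR -> \bar R) : measurable_fun setT F ->
      (forall t, 0 <= F t) -> \int[G 0]_t F t = F [tuple].
    exact: ge0_integral_iid0.
  have z0 (t : 0.-tuple TR) : t = [tuple] by exact: tuple0.
  transitivity (f [tuple]); last first.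
    rewrite (e _ (measurableT_comp mf (mscale _)) (fun=> f0 _)).
    by congr f; exact/esym/z0.
  under eq_integral do under eq_integral do rewrite [X in f X]z0.
  under eq_integral do rewrite integral_prob_cst.
  by rewrite integral_prob_cst.
have mcons x := measurable_tuple_consr x mf.
(* For a fixed head the two tails merge by induction; [D] is what remains as a function of the
   head. *)
pose D z := \int[G N]_t f (tuple_cons (z, [tuple r * tnth t i | i < N]%R)).
have mD : measurable_fun setT D.
  have mg : measurable_fun setT (fun xt : TR * N.-tuple TR =>
      f (tuple_cons (xt.1, [tuple r * tnth xt.2 i | i < N]%R))).
    apply: (measurableT_comp mf); apply: measurable_tuple_consf => //.
    exact: (measurableT_comp (mscale N) (@measurable_snd _ _ TR (N.-tuple TR))).
  exact: (@measurable_fun_fubini_tonelli_F _ _ TR (N.-tuple TR) R (G N) _ mg (fun=> f0 _)).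
have D0 z : 0 <= D z by exact: integral_ge0.
have step1 x y : \int[G N]_t \int[G N]_u f (tuple_cons (a * x + b * y,
    [tuple a * tnth t i + b * tnth u i | i < N])%R) = D (a * x + b * y)%R.
  exact: (IH _ (mcons _) (fun=> f0 _)).
transitivity (\int[gauss1 1]_(x in [set: TR]) \int[gauss1 1]_(y in [set: TR]) D (a * x + b * y)%R).
  have mc := measurableT_comp mf (@measurable_tuple_comb N.+1 a b).
  have mF := @measurable_fun_fubini_tonelli_F _ _ _ _ R (G N.+1) _ mc (fun=> f0 _).
  rewrite [LHS](ge0_integral_iidS (gauss1 1) mF) => [|t]; last first.
    by rewrite /fubini_F; apply: integral_ge0 => u _; exact: f0.
  apply: eq_integral => x _ /=.
  pose E4 (t : N.-tuple TR) (y : TR) (u : N.-tuple TR) := f (tuple_cons (a * x + b * y,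
    [tuple a * tnth t i + b * tnth u i | i < N])%R).
  have mE4 : measurable_fun setT (fun tyu : (N.-tuple TR * TR) * N.-tuple TR =>
      E4 tyu.1.1 tyu.1.2 tyu.2).
    apply: (measurableT_comp mf); apply: measurable_tuple_consf.
      apply: measurable_funD => //; apply: measurable_funM => //.
      exact: (measurableT_comp (@measurable_snd _ _ (N.-tuple TR) TR) measurable_fst).
    have mp : measurable_fun setT (fun tyu : (N.-tuple TR * TR) * N.-tuple TR =>
        (tyu.1.1, tyu.2)).
      apply: measurable_fun_pair => //.
      exact: (measurableT_comp (@measurable_fst _ _ (N.-tuple TR) TR) measurable_fst).
    exact: (measurableT_comp (@measurable_tuple_comb N a b) mp).
  have mE : measurable_fun setT (fun ty : N.-tuple TR * TR => \int[G N]_u E4 ty.1 ty.2 u).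
    exact: (@measurable_fun_fubini_tonelli_F _ _ _ _ R (G N) _ mE4 (fun=> f0 _)).
  have E0 ty : 0 <= \int[G N]_u E4 ty.1 ty.2 u.
    by apply: integral_ge0 => u _; exact: f0.
  (* The head y of the second tuple is moved outside the tail t of the first, so that the tails t
     and u become the two innermost integrals. *)
  transitivity (\int[G N]_t \int[gauss1 1]_y \int[G N]_u E4 t y u).
    apply: eq_integral => t _.
    have mt := measurable_fun_pair2 (tuple_cons (x, t)) mc.
    apply: (eq_trans (ge0_integral_iidS (gauss1 1) mt (fun=> f0 _))).
    apply: eq_integral => y _; apply: eq_integral => u _ /=; congr f.
    rewrite mktuple_cons !tnth_tuple_cons0; congr (tuple_cons (_, _)).
    by apply/eq_from_tnth => i; rewrite !tnth_mktuple !tnth_tuple_consS.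
  rewrite [LHS](@fubini_tonelli _ _ _ _ R (G N) (gauss1 1) _ mE E0).
  by apply: eq_integral => y _; rewrite -[RHS]step1.
rewrite (ge0_integral_gauss1_lin a b0 mD D0).
rewrite [RHS](ge0_integral_iidS (gauss1 1) (measurableT_comp mf (mscale _)) (fun=> f0 _)).
apply: eq_integral => x _; apply: eq_integral => t _ /=; congr f.
rewrite mktuple_cons tnth_tuple_cons0; congr (tuple_cons (_, _)).
by apply/eq_from_tnth => i; rewrite !tnth_mktuple tnth_tuple_consS.
Qed.

(** By induction the tail of the sum is distributed as one normal variable, and the two-variable
    formula merges it with the first coordinate. *)
Lemma ge0_integral_gauss_lin N (a : 'I_N -> R) (f : TR -> \bar R) :
  measurable_fun setT f -> (forall x, 0 <= f x) ->
  \int[G N]_t f (\sum_i a i * tnth t i)%R =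
  \int[gauss1 1]_(x in [set: TR]) f (Num.sqrt (\sum_i a i ^+ 2) * x)%R.
Proof.
elim: N => [|N IH] in a f * => mf f0.
  under eq_integral do rewrite big_ord0.
  by under [RHS]eq_integral do rewrite big_ord0 sqrtr0 mul0r; rewrite !integral_prob_cst.
have mfl := measurableT_comp mf (measurable_lin a).
rewrite [LHS](ge0_integral_iidS (gauss1 1) mfl (fun=> f0 _)) /=.
have mfa x : measurable_fun setT (fun y : TR => f (a ord0 * x + y)%R).
  by apply: measurableT_comp mf _; exact: measurable_funD.
transitivity (\int[gauss1 1]_(x in [set: TR]) \int[gauss1 1]_(y in [set: TR])
    f (a ord0 * x + Num.sqrt (\sum_(i < N) a (lift ord0 i) ^+ 2) * y)%R).
  apply: eq_integral => x _.
  under eq_integral do rewrite lin_tuple_cons.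
  exact: (IH (fun i => a (lift ord0 i)) _ (mfa x) (fun=> f0 _)).
rewrite (ge0_integral_gauss1_lin _ _ mf f0) ?sqrtr_ge0//.
apply: eq_integral => x _; rewrite big_ord_recl sqr_sqrtr//.
by apply: sumr_ge0 => i _; exact: sqr_ge0.
Qed.

(** Serves to recover the law of g alone from the joint vector (g, h) of the comparison process. *)
Lemma ge0_integral_iid_lshift (P : probability TR R) N M (f : N.-tuple TR -> \bar R) :
  measurable_fun setT f -> (forall t, 0 <= f t) ->
  \int[iid P (N + M)]_t f [tuple tnth t (lshift M i) | i < N] = \int[iid P N]_t f t.
Proof.
have msub n : measurable_fun setT
    (fun t : (n + M).-tuple TR => [tuple tnth t (lshift M i) | i < n]).
  by apply: measurable_mktuple => i; exact: measurable_coord.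
elim: N => [|N IH] in f * => mf f0.
  rewrite [RHS](ge0_integral_iid0 _ mf f0).
  under eq_integral do rewrite [X in f X]tuple0.
  exact: integral_prob_cst.
rewrite [RHS](ge0_integral_iidS P mf f0).
rewrite [LHS](@ge0_integral_iidS _ _ _ P (N + M) _ (measurableT_comp mf (msub _)) (fun=> f0 _)).
apply: eq_integral => x _.
rewrite -(IH _ (measurable_tuple_consr x mf) (fun=> f0 _)).
apply: eq_integral => t _ /=; congr f; rewrite mktuple_cons.
congr (tuple_cons (_, _)).
apply/eq_from_tnth => i; rewrite !tnth_mktuple -[RHS](tnth_tuple_consS x t).
by congr tnth; apply: val_inj.
Qed.

End gauss_tuple_linear.

(** * Elementary bounds for exp and ln *)

Section exp_bounds.
Context {R : realType}.
Implicit Types x y t : R.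

(** In the sum of the two exponential series the odd terms cancel and the even ones are nonnegative,
    so truncation after order 2 bounds it from below. *)
Lemma cosh_ge x : 2 + x ^+ 2 <= expR x + expR (- x).
Proof.
have c : series (exp_coeff x) n + series (exp_coeff (- x)) n @[n --> \oo]
    --> expR x + expR (- x).
  by apply: cvgD; exact: is_cvg_series_exp_coeff.
apply: (cvgr_to_ge c); exists 3%N => // -[//|[//|[//|n]]] _ /=.
rewrite !seriesEnat/= -big_split/= !big_nat_recl// /exp_coeff/=.
rewrite !expr0 !expr1 sqrrN fact0 !factS fact0 !addrA.
rewrite -[X in X <= _]addr0 lerD//; first by lra.
apply: sumr_ge0 => k _; rewrite -mulrDl divr_ge0//.
have e m : 0 <= x ^+ m + (- x) ^+ m.
  rewrite exprNn -signr_odd; case: (boolP (odd m)) => om.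
    by rewrite expr1 mulN1r subrr.
  by rewrite mul1r addr_ge0 ?exprn_even_ge0.
exact: e.
Qed.

(** From order 3 on, the series is compared term by term with |x|^3 times the series of exp |x|,
    using (k+3)! >= k!. *)
Lemma expR_taylor3 x :
  `|expR x - (1 + x + x ^+ 2 / 2)| <= `|x| ^+ 3 * expR `|x|.
Proof.
have c : `|series (exp_coeff x) n - (1 + x + x ^+ 2 / 2)| @[n --> \oo]
    --> `|expR x - (1 + x + x ^+ 2 / 2)|.
  by apply: cvg_norm; apply: cvgB; [exact: is_cvg_series_exp_coeff|exact: cvg_cst].
apply: (cvgr_to_le c); exists 3%N => // -[//|[//|[//|n]]] _ /=.
rewrite seriesEnat/= !big_nat_recl//.
rewrite [X in `|X|](_ : _ = \sum_(0 <= i < n) exp_coeff x i.+3); last first.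
  rewrite /exp_coeff/= expr0 expr1 fact0 !factS fact0 !addrA.
  by set S := \sum_(_ <= _ < _) _; rewrite !muln1 !divr1; ring.
apply: (le_trans (ler_norm_sum _ _ _)).
apply: (@le_trans _ _ (`|x| ^+ 3 * series (exp_coeff `|x|) n)); last first.
  apply: ler_wpM2l; first by rewrite exprn_ge0.
  apply: nondecreasing_cvgn_le; last exact: is_cvg_series_exp_coeff.
  apply/nondecreasing_series => k _ _.
  by rewrite /exp_coeff/= divr_ge0// exprn_ge0.
rewrite seriesEnat/= mulr_sumr; apply: ler_sum => k _.
rewrite /exp_coeff/= normrM normfV normrX normr_nat mulrA -exprD add3n.
apply: ler_wpM2l; first by rewrite exprn_ge0.
by rewrite lef_pV2 ?posrE ?ltr0n ?fact_gt0// ler_nat; apply: leq_fact; rewrite !leqW.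
Qed.

Lemma ln_ge_sub_sqr t : 0 <= t -> t - t ^+ 2 <= ln (1 + t).
Proof.
move=> t0; have t1 : 0 < 1 + t by lra.
have : ln (1 + t)^-1 <= (1 + t)^-1 - 1.
  rewrite -[X in ln X](addrNK 1) [X in ln X]addrC; apply: le_ln1Dx.
  by rewrite ltrBrDl subrr invr_gt0.
rewrite lnV ?posrE// => h.
have : t - t ^+ 2 <= 1 - (1 + t)^-1.
  rewrite -subr_ge0 [X in 0 <= X](_ : _ = t ^+ 3 / (1 + t)).
    by rewrite divr_ge0 ?exprn_ge0// ltW.
  by field; rewrite gt_eqF.
lra.
Qed.

Lemma le_exprn_expR n x : 0 <= x -> x ^+ n <= n`!%:R * expR x.
Proof.
move=> x0; case: n => [|n]; first by rewrite fact0 mul1r expr0 -expR0 ler_expR.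
have := expR_ge1Dxn n x0 => h.
rewrite mulrC -ler_pdivrMr ?ltr0n ?fact_gt0//; lra.
Qed.

Lemma expR2_le16 : expR 2 <= 16 :> R.
Proof.
have half : 2^-1 <= expR (- 2^-1 : R) by apply: le_trans (expR_ge1Dx _); lra.
have le2 : expR (2^-1 : R) <= 2.
  by rewrite -[2^-1]opprK expRN -[leRHS]invrK lef_pV2 ?posrE ?expR_gt0 ?invr_gt0.
rewrite [X in expR X](_ : 2 = 4%:R * 2^-1 :> R); last by field.
rewrite expRM_natl (_ : 16 = 2 ^+ 4 :> R); last by ring.
by rewrite lerXn2r ?nnegrE ?expR_ge0.
Qed.

End exp_bounds.

(** * Log-sum-exp and its second-order expansion *)

Section softmax.
Context {R : realType} {I : finType}.
Implicit Types (x d p : I -> R) (D : R).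

Lemma ler_normP_gt0 D d : (forall i : I, `|d i| <= D) -> I -> 0 <= D.
Proof. by move=> dD i; exact: le_trans (normr_ge0 _) (dD i). Qed.

(* The cumulant generating function of d under p is mean + variance / 2 up to
   third order; centring d first makes the argument of ln at least 1. *)
Lemma ln_mean_expR_taylor p d D : (forall i, 0 <= p i) -> \sum_i p i = 1 ->
  (forall i, `|d i| <= D) ->
  `|ln (\sum_i p i * expR (d i)) - \sum_i p i * d i
    - 4^-1 * \sum_i \sum_j p i * p j * (d i - d j) ^+ 2| <= 20000 * D ^+ 3.
Proof.
move=> p0 p1 dD.
have [i0 _] : exists i : I, true.
  case: (pickP (@predT I)) => [i _|I0]; first by exists i.
  by move: p1; rewrite big_pred0// => /esym/eqP; rewrite oner_eq0.
have D0 : 0 <= D := ler_normP_gt0 dD i0.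
pose mu := \sum_i p i * d i.
pose u i := d i - mu.
have mean_le (f : I -> R) c : (forall i, f i <= c) -> \sum_i p i * f i <= c.
  move=> fc; rewrite -[leRHS]mul1r -p1 mulr_suml; apply: ler_sum => i _.
  by rewrite ler_wpM2l.
have mean_ge (f : I -> R) c : (forall i, c <= f i) -> c <= \sum_i p i * f i.
  move=> fc; rewrite -[leLHS]mul1r -p1 mulr_suml; apply: ler_sum => i _.
  by rewrite ler_wpM2l.
have muD : `|mu| <= D.
  rewrite ler_norml mean_le ?mean_ge// => i; have := dD i; rewrite ler_norml; lra.
have uD i : `|u i| <= 2 * D.
  by have := dD i; have := muD; rewrite /u !ler_norml; lra.
have u0 : \sum_i p i * u i = 0.
  under eq_bigr do rewrite mulrBr.
  by rewrite sumrB -mulr_suml p1 mul1r subrr.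
pose v := \sum_i p i * u i ^+ 2.
have vE : \sum_i \sum_j p i * p j * (d i - d j) ^+ 2 = 2 * v.
  transitivity (\sum_i \sum_j (p i * u i ^+ 2 * p j + p i * (p j * u j ^+ 2)
     - 2 * (p i * u i) * (p j * u j))).
    by apply: eq_bigr => i _; apply: eq_bigr => j _; rewrite /u; ring.
  under eq_bigr do rewrite sumrB big_split/= -!mulr_sumr p1 u0 mulr1 mulr0 subr0.
  by rewrite big_split/= -mulr_suml p1 mul1r -/v; lra.
have v0 : 0 <= v by apply: sumr_ge0 => i _; rewrite mulr_ge0 ?sqr_ge0.
have vD : v <= 4 * D ^+ 2.
  apply: mean_le => i; rewrite -real_normK ?num_real//.
  rewrite (_ : 4 * D ^+ 2 = (2 * D) ^+ 2); last by ring.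
  by rewrite lerXn2r ?nnegrE// mulr_ge0.
pose S := \sum_i p i * expR (u i).
have SE : \sum_i p i * expR (d i) = expR mu * S.
  rewrite mulr_sumr; apply: eq_bigr => i _.
  by rewrite mulrCA -expRD /u addrC subrK.
have S1 : 1 <= S.
  have : \sum_i p i * (1 + u i) <= S.
    by apply: ler_sum => i _; rewrite ler_wpM2l// expR_ge1Dx.
  under eq_bigr do rewrite mulrDr mulr1.
  by rewrite big_split/= p1 u0 addr0.
rewrite SE lnM ?posrE ?expR_gt0//; last exact: lt_le_trans S1.
rewrite expRK -/mu [mu + _]addrC addrK vE.
rewrite (_ : 4^-1 * (2 * v) = v / 2); last by field.
have lnS0 : 0 <= ln S by exact: ln_ge0.
have D2 : 0 <= D ^+ 2 by exact: sqr_ge0.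
have D3 : 0 <= D ^+ 3 by exact: exprn_ge0.
have [D1|D1] := leP D 1; last first.
  have lnSD : ln S <= 2 * D.
    rewrite -ler_expR lnK ?posrE; last exact: lt_le_trans S1.
    by apply: mean_le => i; rewrite ler_expR; have := uD i; rewrite ler_norml; lra.
  have D23 : D ^+ 2 <= D ^+ 3 by rewrite ler_eXn2l// ltW.
  have D13 : D <= D ^+ 3 by rewrite -[leLHS]expr1 ler_eXn2l// ltW.
  by rewrite ler_norml; apply/andP; split; lra.
(* The mean of the Taylor remainders of exp (u i). As |u i| <= 2 D <= 2, each is at most 8 D^3 times
   e^2, and 8 * 16 = 128. *)
pose r := S - 1 - v / 2.
have rD : `|r| <= 128 * D ^+ 3.
  have -> : r = \sum_i p i * (expR (u i) - (1 + u i + u i ^+ 2 / 2)).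
    under [RHS]eq_bigr do rewrite mulrBr (mulrDr _ (1 + _)) (mulrDr _ 1) mulr1 (mulrA (p _)).
    by rewrite sumrB !big_split/= p1 u0 -mulr_suml /r -/S -/v; lra.
  have b i : `|expR (u i) - (1 + u i + u i ^+ 2 / 2)| <= 128 * D ^+ 3.
    apply: (le_trans (expR_taylor3 _)).
    have h1 : `|u i| ^+ 3 <= 8 * D ^+ 3.
      rewrite (_ : 8 * D ^+ 3 = (2 * D) ^+ 3); last by ring.
      by rewrite lerXn2r ?nnegrE// mulr_ge0.
    have h2 : expR `|u i| <= 16.
      by apply: le_trans expR2_le16; rewrite ler_expR; have := uD i; lra.
    rewrite (_ : 128 * D ^+ 3 = 8 * D ^+ 3 * 16); last by ring.
    by rewrite ler_pM ?exprn_ge0// expR_ge0.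
  apply: (le_trans (ler_norm_sum _ _ _)).
  rewrite -[leRHS]mul1r -[X in X * (128 * _)]p1 mulr_suml; apply: ler_sum => i _.
  by rewrite normrM (ger0_norm (p0 i)); apply: ler_wpM2l; [exact: p0|exact: b].
have D32 : D ^+ 3 <= D ^+ 2 by rewrite exprS ler_piMl.
have D43 : D ^+ 4 <= D ^+ 3 by rewrite exprS ler_piMl.
pose t := S - 1.
have St : S = 1 + t by rewrite /t addrC subrK.
have t0 : 0 <= t by rewrite /t subr_ge0.
have tv : t = v / 2 + r by rewrite /r /t; lra.
(* v / 2 <= 2 D^2 and r <= 128 D^3 <= 128 D^2. Squaring gives 16900 D^4, and 16900 + 128 stays below
   the announced 20000. *)
have tD : t <= 130 * D ^+ 2 by move: rD; rewrite ler_norml; lra.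
have t2 : t ^+ 2 <= 16900 * D ^+ 3.
  apply: (@le_trans _ _ ((130 * D ^+ 2) ^+ 2)); first by rewrite lerXn2r ?nnegrE// mulr_ge0.
  rewrite exprMn -exprM; lra.
have l1 : ln S <= t by rewrite St le_ln1Dx//; lra.
have l2 : t - t ^+ 2 <= ln S by rewrite St ln_ge_sub_sqr.
by move: rD; rewrite !ler_norml; lra.
Qed.

(** The log-sum-exp function, an upper approximation of the maximum with error at most ln #|I|;
    [softmax_weight] is its gradient. *)
Definition softmax x : R := ln (\sum_i expR (x i)).
Definition softmax_weight x i : R := expR (x i) / \sum_j expR (x j).

Lemma sum_expR_gt0 x (i : I) : 0 < \sum_j expR (x j).
Proof.
by rewrite (bigD1 i)//= ltr_pwDl ?expR_gt0// sumr_ge0// => j _; exact: expR_ge0.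
Qed.

Lemma softmax_weight_ge0 x i : 0 <= softmax_weight x i.
Proof. by rewrite divr_ge0 ?expR_ge0// ltW// (sum_expR_gt0 _ i). Qed.

Lemma softmax_weight_sum x (i : I) : \sum_j softmax_weight x j = 1.
Proof. by rewrite -mulr_suml mulfV// gt_eqF// (sum_expR_gt0 _ i). Qed.

(** Reduces an increment of log-sum-exp to a cumulant generating function under the probability
    weights [softmax_weight x], so that [ln_mean_expR_taylor] applies. *)
Lemma softmaxD x d (i : I) :
  softmax (fun j => x j + d j) =
  softmax x + ln (\sum_j softmax_weight x j * expR (d j)).
Proof.
rewrite /softmax -lnM ?posrE ?(sum_expR_gt0 _ i)//; last first.
  rewrite (bigD1 i)//= ltr_pwDl ?mulr_gt0 ?expR_gt0 ?invr_gt0 ?(sum_expR_gt0 _ i)//.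
  by rewrite sumr_ge0// => j _; rewrite mulr_ge0 ?expR_ge0// softmax_weight_ge0.
congr ln; rewrite mulr_sumr; apply: eq_bigr => j _.
by rewrite expRD mulrA /softmax_weight mulrCA mulfV ?mulr1// gt_eqF// (sum_expR_gt0 _ i).
Qed.

Lemma softmax_ge x i : x i <= softmax x.
Proof.
rewrite -ler_expR lnK ?posrE ?(sum_expR_gt0 _ i)//.
by rewrite (bigD1 i)//= lerDl sumr_ge0// => j _; exact: expR_ge0.
Qed.

Lemma softmax_le x c (i : I) : (forall j, x j <= c) -> softmax x <= ln #|I|%:R + c.
Proof.
move=> xc; have I0 : (0 < #|I|)%N by apply/card_gt0P; exists i.
rewrite -ler_expR lnK ?posrE ?(sum_expR_gt0 _ i)//.
rewrite expRD lnK ?posrE ?ltr0n//.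
apply: (@le_trans _ _ (\sum_(j : I) expR c)).
  by apply: ler_sum => j _; rewrite ler_expR.
by rewrite sumr_const mulr_natl.
Qed.

Lemma softmax_lipschitz x d D (i : I) : (forall j, `|d j| <= D) ->
  `|softmax (fun j => x j + d j) - softmax x| <= D.
Proof.
move=> dD; rewrite (softmaxD _ _ i) addrAC subrr add0r.
have p0 := softmax_weight_ge0 x; have p1 := softmax_weight_sum x i.
have s c : \sum_j softmax_weight x j * expR c = expR c by rewrite -mulr_suml p1 mul1r.
have S0 : 0 < \sum_j softmax_weight x j * expR (d j).
  apply: (@lt_le_trans _ _ (expR (- D))); first exact: expR_gt0.
  rewrite -s; apply: ler_sum => j _; rewrite ler_wpM2l// ler_expR.
  by have := dD j; rewrite ler_norml => /andP[].
rewrite ler_norml; apply/andP; split; rewrite -ler_expR lnK ?posrE// -s.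
- apply: ler_sum => j _; rewrite ler_wpM2l// ler_expR.
  by have := dD j; rewrite ler_norml => /andP[].
- apply: ler_sum => j _; rewrite ler_wpM2l// ler_expR.
  by have := dD j; rewrite ler_norml => /andP[].
Qed.

End softmax.

(** * Calculus of real-valued expectations *)

Section mean.
Context d (T : measurableType d) (R : realType) (P : probability T R).
Implicit Types f g : T -> R.
Local Notation igr f := (P.-integrable setT (EFin \o f)).
Local Notation E f := (Rintegral P setT f).

Lemma igr_measurable f : igr f -> measurable_fun setT f.
Proof. by move=> /measurable_int/measurable_EFinP. Qed.

Lemma igr_cst (c : R) : igr (fun=> c).
Proof. exact: finite_measure_integrable_cst. Qed.

Lemma igrD f g : igr f -> igr g -> igr (fun t => f t + g t).
Proof.
move=> If Ig; have := integrableD measurableT If Ig.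
by apply: eq_integrable.
Qed.

Lemma igrZ (c : R) f : igr f -> igr (fun t => c * f t).
Proof.
move=> If; have := integrableZl measurableT c If.
by apply: eq_integrable.
Qed.

Lemma igrB f g : igr f -> igr g -> igr (fun t => f t - g t).
Proof.
move=> If Ig; have := integrableB measurableT If Ig.
by apply: eq_integrable.
Qed.

Lemma igr_sum (J : Type) (r : seq J) (h : J -> T -> R) :
  (forall j, igr (h j)) -> igr (fun t => \sum_(j <- r) h j t).
Proof.
move=> Ih; have := @integrable_sum _ _ _ P setT measurableT _ r xpredT
  (fun j => EFin \o h j) (fun j _ => Ih j).
by apply: eq_integrable => // t _ /=; rewrite sumEFin.
Qed.

Lemma igr_le f g : measurable_fun setT f -> (forall t, `|f t| <= g t) -> igr g -> igr f.
Proof.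
move=> mf fg; apply: le_integrable => //; first exact/measurable_EFinP.
move=> t _ /=; rewrite lee_fin (le_trans (fg t))//.
exact: ler_norm.
Qed.

Lemma ED f g : igr f -> igr g -> E (fun t => f t + g t) = E f + E g.
Proof. by move=> *; rewrite RintegralD. Qed.

Lemma EB f g : igr f -> igr g -> E (fun t => f t - g t) = E f - E g.
Proof. by move=> *; rewrite RintegralB. Qed.

Lemma EZ c f : igr f -> E (fun t => c * f t) = c * E f.
Proof. by move=> *; rewrite RintegralZl. Qed.

Lemma Ecst c : E (fun=> c) = c.
Proof. by rewrite /Rintegral (integral_prob_cst P c%:E). Qed.

Lemma E_sum (J : Type) (r : seq J) (h : J -> T -> R) :
  (forall j, igr (h j)) -> E (fun t => \sum_(j <- r) h j t) = \sum_(j <- r) E (h j).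
Proof.
move=> Ih; elim: r => [|j r IH].
  by under eq_Rintegral do rewrite big_nil; rewrite big_nil Ecst.
under eq_Rintegral do rewrite big_cons.
by rewrite big_cons ED ?IH//; exact: igr_sum.
Qed.

Lemma le_E f g : igr f -> igr g -> (forall t, f t <= g t) -> E f <= E g.
Proof. by move=> If Ig fg; apply: le_Rintegral. Qed.

Lemma EFin_E f : igr f -> (E f)%:E = (\int[P]_t (f t)%:E)%E.
Proof. by move=> If; rewrite /Rintegral fineK//; exact: integrable_fin_num. Qed.

Lemma igrZr (c : R) f : igr f -> igr (fun t => f t * c).
Proof. by move=> If; have := igrZ c If; apply: eq_integrable => // t _ /=; rewrite mulrC. Qed.

Lemma EZr c f : igr f -> E (fun t => f t * c) = E f * c.
Proof. by move=> *; rewrite RintegralZr. Qed.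

Lemma normE_le f c : igr f -> (forall t, `|f t| <= c) -> `|E f| <= c.
Proof.
move=> If fc; rewrite ler_norml -{1}(Ecst (- c)) -{2}(Ecst c).
apply/andP; split; apply: le_E => //; try exact: igr_cst.
- by move=> t; have := fc t; rewrite ler_norml => /andP[].
- by move=> t; have := fc t; rewrite ler_norml => /andP[].
Qed.

Lemma igr_norm f : igr f -> igr (fun t => `|f t|).
Proof. exact: integrable_norm. Qed.

End mean.

(** * Expansions that survive averaging *)

Section jets.
Context {R : realType} {I : finType}.

Lemma measurable_softmax_shift d (T : measurableType d) (x : I -> R) (W : I -> T -> R) :
  (forall i, measurable_fun setT (W i)) ->
  measurable_fun setT (fun t => softmax (fun i => x i + W i t)).
Proof.
move=> mW; apply: (measurableT_comp (@measurable_ln R)).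
apply: measurable_sum => i; apply: measurableT_comp => //.
exact: measurable_funD.
Qed.

Lemma measurable_softmax_weight_shift d (T : measurableType d) (x : I -> R)
    (W : I -> T -> R) i : (forall i, measurable_fun setT (W i)) ->
  measurable_fun setT (fun t => softmax_weight (fun i => x i + W i t) i).
Proof.
move=> mW.
(* Written as an exponential, the quotient inherits measurability from [softmax]. *)
have -> : (fun t => softmax_weight (fun i => x i + W i t) i) =
    fun t => expR (x i + W i t - softmax (fun i => x i + W i t)).
  apply/funext => t; rewrite /softmax_weight expRB lnK// posrE.
  exact: (sum_expR_gt0 _ i).
apply: measurableT_comp => //; apply: measurable_funB.
  exact: measurable_funD.
exact: measurable_softmax_shift.
Qed.

Lemma igr_softmax_shift d (T : measurableType d) (P : probability T R)
    (i0 : I) (x : I -> R) (W : I -> T -> R) :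
  (forall i, P.-integrable setT (EFin \o W i)) ->
  P.-integrable setT (EFin \o (fun t => softmax (fun i => x i + W i t))).
Proof.
move=> IW; apply: (@igr_le _ _ _ _ _ (fun t => `|softmax x| + \sum_i `|W i t|)).
- by apply: measurable_softmax_shift => i; exact: igr_measurable (IW i).
- move=> t; rewrite -lerBlDl; apply: (le_trans (lerB_dist _ _)).
  apply: softmax_lipschitz => // j.
  by rewrite (bigD1 j)//= lerDl sumr_ge0.
- apply: igrD; first exact: igr_cst.
  by apply: igr_sum => i; exact: igr_norm.
Qed.

(* The quadratic part is a nonnegative combination of the squares (d_i - d_j)^2,
   so that its mean under a random d is monotone in the mean square increments. *)
Definition has_jet (C : R) (F : (I -> R) -> R) := forall x, exists p : I -> R,
  exists q : I -> I -> R,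
  [/\ forall i, 0 <= p i, \sum_i p i = 1, forall i j, 0 <= q i j,
      \sum_i \sum_j q i j = 1
    & forall (d : I -> R) D, (forall i, `|d i| <= D) ->
      `|F (fun i => x i + d i) - F x| <= D /\
      `|F (fun i => x i + d i) - F x - \sum_i p i * d i
         - 4^-1 * \sum_i \sum_j q i j * (d i - d j) ^+ 2| <= C * D ^+ 3].

(** The remainder bound is uniform in the base point, so averaging keeps the constant. The averaged
    quadratic weights are means of products, in general not products of the averaged p; this is why
    [has_jet] has a separate q. *)
Lemma mean_softmax_has_jet d (T : measurableType d) (P : probability T R)
    (W : I -> T -> R) (i0 : I) :
  (forall i, P.-integrable setT (EFin \o W i)) ->
  has_jet 20000 (fun x => \int[P]_t softmax (fun i => x i + W i t)).
Proof.
move=> IW x; have mW i := igr_measurable (IW i).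
pose z (t : T) i := x i + W i t.
pose w i t := softmax_weight (z t) i.
have mw i : measurable_fun setT (w i) by exact: measurable_softmax_weight_shift.
have w0 i t : 0 <= w i t by exact: softmax_weight_ge0.
have w1 t : \sum_i w i t = 1 by exact: (softmax_weight_sum (z t) i0).
have wle1 i t : w i t <= 1.
  by rewrite -(w1 t) (bigD1 i)//= lerDl sumr_ge0.
have Iw i : P.-integrable setT (EFin \o w i).
  by apply: igr_le (igr_cst P 1) => // t; rewrite ger0_norm.
have Iww i j : P.-integrable setT (EFin \o (fun t => w i t * w j t)).
  apply: igr_le (igr_cst P 1); first exact: measurable_funM.
  by move=> t /=; rewrite ger0_norm; [exact: mulr_ile1|exact: mulr_ge0].
exists (fun i => \int[P]_t w i t).
exists (fun i j => \int[P]_t (w i t * w j t)); split.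
- by move=> i; apply: Rintegral_ge0 => t _.
- by rewrite -E_sum//; under eq_Rintegral do rewrite w1; rewrite Ecst.
- by move=> i j; apply: Rintegral_ge0 => t _; rewrite mulr_ge0.
- under eq_bigr do rewrite -E_sum//.
  rewrite -E_sum => [|i]; last exact: igr_sum.
  under eq_Rintegral => t _.
    under eq_bigr do rewrite -mulr_sumr w1 mulr1.
    rewrite w1; over.
  by rewrite Ecst.
move=> e D eD.
have Ix := igr_softmax_shift i0 x IW.
have Ixd := igr_softmax_shift i0 (fun i => x i + e i) IW.
have zd t : softmax (fun i => x i + e i + W i t) = softmax (fun i => z t i + e i).
  by congr softmax; apply/funext => i; rewrite /z addrAC.
rewrite -EB//; split.
  apply: normE_le; first exact: igrB.
  by move=> t; rewrite zd; exact: softmax_lipschitz.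
under eq_bigr do rewrite -EZr//.
rewrite -E_sum => [|i]; last exact: igrZr.
have I1 : P.-integrable setT (EFin \o (fun t => \sum_i w i t * e i)).
  by apply: igr_sum => i; exact: igrZr.
rewrite -EB//; last exact: igrB.
under eq_bigr do under eq_bigr do rewrite -EZr//.
have I2 i j : P.-integrable setT (EFin \o (fun t => w i t * w j t * (e i - e j) ^+ 2)).
  exact: igrZr.
under eq_bigr do rewrite -E_sum//.
rewrite -E_sum => [|i]; last exact: igr_sum.
have I3 : P.-integrable setT (EFin \o
    (fun t => \sum_i \sum_j w i t * w j t * (e i - e j) ^+ 2)).
  by apply: igr_sum => i; exact: igr_sum.
rewrite -EZ// -EB//; last 2 first.
- by apply: igrB => //; exact: igrB.
- exact: igrZ.
apply: normE_le.
  by apply: igrB; [apply: igrB => //; exact: igrB|exact: igrZ].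
move=> t; rewrite zd (softmaxD _ _ i0) [softmax _ + _]addrC addrK.
exact: (@ln_mean_expR_taylor _ _ (softmax_weight (z t)) _ _ (w0^~ t) (w1 t) eD).
Qed.

(** Here D is the increment of F, s L and s^2 q its first and second order parts, and Q bounds the
    direction. Expand exp (lam D) to third order; the powers Q^3 and Q^4 are absorbed by 4! exp Q,
    so that the whole remainder is s^3 times a function with finite Gaussian mean. *)
Lemma jet_step_pointwise (lam s Q L q D C : R) : 0 <= lam -> 0 <= s <= 1 -> 0 <= Q ->
  0 <= C -> `|L| <= Q -> 0 <= q <= Q ^+ 2 -> `|D| <= s * Q ->
  `|D - s * L - s ^+ 2 * q| <= C * (s ^+ 3 * Q ^+ 3) ->
  expR (lam * D) <= 1 + lam * (s * L + s ^+ 2 * q) + lam ^+ 2 / 2 * (s ^+ 2 * L ^+ 2)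
    + s ^+ 3 * (24 * (lam * C + lam ^+ 2 * (1 + C) + lam ^+ 3) * expR ((lam + 1) * Q)).
Proof.
move=> lam0 /andP[s0 s1] Q0 C0 LQ /andP[q0 qQ] DQ DLq.
set W := expR ((lam + 1) * Q).
have WE : W = expR (lam * Q) * expR Q by rewrite -expRD /W mulrDl mul1r.
have e1 : 1 <= expR (lam * Q) by rewrite -expR0 ler_expR mulr_ge0.
have QW : expR Q <= W by rewrite WE ler_peMl// expR_ge0.
have W0 : 0 <= W by exact: expR_ge0.
have Q3 : Q ^+ 3 <= 6 * expR Q by have := le_exprn_expR 3 Q0.
have Q4 : Q ^+ 4 <= 24 * expR Q by have := le_exprn_expR 4 Q0.
have Q3W : Q ^+ 3 <= 24 * W by lra.
have Q4W : Q ^+ 4 <= 24 * W by lra.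
have Q3e : Q ^+ 3 * expR (lam * Q) <= 24 * W.
  rewrite WE; apply: (@le_trans _ _ (6 * expR Q * expR (lam * Q))).
    by rewrite ler_wpM2r// expR_ge0.
  by rewrite -mulrA [expR Q * _]mulrC ler_wpM2r ?mulr_ge0 ?expR_ge0//; lra.
have s30 : 0 <= s ^+ 3 by rewrite exprn_ge0.
have sQ : s * Q <= Q by rewrite ler_piMl.
have h1 : D <= s * L + s ^+ 2 * q + C * (s ^+ 3 * Q ^+ 3).
  by move: DLq; rewrite ler_norml; lra.
have DL : `|D - s * L| <= s ^+ 2 * Q ^+ 2 + C * (s ^+ 3 * Q ^+ 3).
  have : s ^+ 2 * q <= s ^+ 2 * Q ^+ 2 by rewrite ler_wpM2l ?sqr_ge0.
  have : 0 <= s ^+ 2 * q by rewrite mulr_ge0 ?sqr_ge0.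
  by move: DLq; rewrite !ler_norml; lra.
have h2 : D ^+ 2 <= s ^+ 2 * L ^+ 2 + 2 * s ^+ 3 * (Q ^+ 3 + C * Q ^+ 4).
  have -> : D ^+ 2 = s ^+ 2 * L ^+ 2 + (D - s * L) * (D + s * L) by ring.
  rewrite lerD2l; apply: (le_trans (ler_norm _)); rewrite normrM.
  have DL2 : `|D + s * L| <= 2 * (s * Q).
    apply: (le_trans (ler_normD _ _)); rewrite normrM (ger0_norm s0).
    by have := ler_wpM2l s0 LQ; lra.
  apply: (le_trans (ler_pM _ _ DL DL2)) => //.
  have : s ^+ 4 * Q ^+ 4 * C <= s ^+ 3 * Q ^+ 4 * C.
    by rewrite ler_wpM2r// ler_wpM2r ?exprn_ge0// exprS ler_piMl.
  lra.
have h3 : `|lam * D| ^+ 3 * expR `|lam * D| <= s ^+ 3 * (lam ^+ 3 * (24 * W)).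
  have lD : `|lam * D| <= lam * (s * Q).
    by rewrite normrM (ger0_norm lam0) ler_wpM2l.
  have lQ0 : 0 <= lam * (s * Q) by rewrite !mulr_ge0.
  apply: (@le_trans _ _ ((lam * (s * Q)) ^+ 3 * expR (lam * Q))).
    apply: ler_pM; rewrite ?exprn_ge0 ?expR_ge0//.
      by rewrite lerXn2r ?nnegrE.
    by rewrite ler_expR (le_trans lD)// ler_wpM2l.
  rewrite [leLHS](_ : _ = s ^+ 3 * (lam ^+ 3 * (Q ^+ 3 * expR (lam * Q)))); last by ring.
  by rewrite ler_wpM2l// ler_wpM2l// exprn_ge0.
have h4 := expR_taylor3 (lam * D).
have h5 : expR (lam * D) <= 1 + lam * D + lam ^+ 2 / 2 * D ^+ 2
    + s ^+ 3 * (lam ^+ 3 * (24 * W)).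
  by move: (le_trans h4 h3); rewrite ler_norml exprMn => /andP[_]; clear; lra.
apply: (le_trans h5).
have k1 := ler_wpM2l lam0 h1.
have l20 : 0 <= lam ^+ 2 / 2 by rewrite divr_ge0 ?sqr_ge0.
have k2 := ler_wpM2l l20 h2.
have k3 : lam * (C * (s ^+ 3 * Q ^+ 3)) <= lam * (C * (s ^+ 3 * (24 * W))).
  by rewrite !ler_wpM2l.
have k4 : lam ^+ 2 / 2 * (2 * s ^+ 3 * (Q ^+ 3 + C * Q ^+ 4)) <=
    lam ^+ 2 / 2 * (2 * s ^+ 3 * (24 * W + C * (24 * W))).
  by rewrite !ler_wpM2l ?mulr_ge0// lerD// ler_wpM2l.
lra.
Qed.

End jets.

(** * One interpolation step *)

Section jet_step.
Context {R : realType} {I : finType}.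

Lemma sqr_mean_le (p X : I -> R) : (forall i, 0 <= p i) -> \sum_i p i = 1 ->
  (\sum_i p i * X i) ^+ 2 <= \sum_i p i * X i ^+ 2.
Proof.
move=> p0 p1; set L := \sum_i _.
have : 0 <= \sum_i p i * (X i - L) ^+ 2.
  by apply: sumr_ge0 => i _; rewrite mulr_ge0 ?sqr_ge0.
have -> : \sum_i p i * (X i - L) ^+ 2 =
    \sum_i (p i * X i ^+ 2 - 2 * L * (p i * X i) + L ^+ 2 * p i).
  by apply: eq_bigr => i _; ring.
rewrite big_split sumrB/= -!mulr_sumr p1 -/L; lra.
Qed.

Lemma mean_norm_le (p X : I -> R) Q : (forall i, 0 <= p i) -> \sum_i p i = 1 ->
  (forall i, `|X i| <= Q) -> `|\sum_i p i * X i| <= Q.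
Proof.
move=> p0 p1 XQ; apply: (le_trans (ler_norm_sum _ _ _)).
rewrite -[leRHS]mul1r -p1 mulr_suml; apply: ler_sum => i _.
by rewrite normrM (ger0_norm (p0 i)) ler_wpM2l.
Qed.

Lemma quad_mean_le (q : I -> I -> R) (X : I -> R) Q : (forall i j, 0 <= q i j) ->
  \sum_i \sum_j q i j = 1 -> (forall i, `|X i| <= Q) ->
  0 <= 4^-1 * \sum_i \sum_j q i j * (X i - X j) ^+ 2 <= Q ^+ 2.
Proof.
move=> q0 q1 XQ; apply/andP; split.
  rewrite mulr_ge0// sumr_ge0// => i _; rewrite sumr_ge0// => j _.
  by rewrite mulr_ge0 ?sqr_ge0.
rewrite -ler_pdivlMl ?invr_gt0// invrK -[leRHS]mulr1 -[X in _ <= _ * X]q1 mulr_sumr.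
apply: ler_sum => i _; rewrite mulr_sumr; apply: ler_sum => j _.
rewrite mulrC ler_wpM2r//.
have XX : `|X i - X j| <= 2 * Q.
  by apply: (le_trans (ler_normB _ _)); have := XQ i; have := XQ j; lra.
rewrite -real_normK ?num_real// (_ : 4 * Q ^+ 2 = (2 * Q) ^+ 2); last by ring.
by rewrite lerXn2r ?nnegrE// (le_trans _ XX).
Qed.

Context d (T : measurableType d) (P : probability T R).
Context d' (T' : measurableType d') (P' : probability T' R).
Variables (X : I -> T -> R) (Y : I -> T' -> R) (V lam C : R) (i0 : I).
Local Notation igr P f := (P.-integrable setT (EFin \o f)).
Hypotheses (lam0 : 0 <= lam) (C0 : 0 <= C)
  (mX : forall i, measurable_fun setT (X i))
  (mY : forall i, measurable_fun setT (Y i))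
  (IX : forall k, igr P (fun t => expR (k * \sum_i `|X i t|)))
  (IY : igr P' (fun t => expR (\sum_i `|Y i t|)))
  (X0 : forall i, \int[P]_t X i t = 0)
  (Y0 : forall i, \int[P']_t Y i t = 0)
  (XV : forall i, \int[P]_t (X i t ^+ 2) <= V)
  (XY : forall i j, \int[P]_t (X i t - X j t) ^+ 2 <= \int[P']_t (Y i t - Y j t) ^+ 2).

Section moments.
Context dd (TT : measurableType dd) (PP : probability TT R) (Z : I -> TT -> R).
Hypotheses (mZ : forall i, measurable_fun setT (Z i))
  (IZ : igr PP (fun t => expR (\sum_i `|Z i t|))).
Let Q t := \sum_i `|Z i t|.

Lemma abs_le_sum i t : `|Z i t| <= Q t.
Proof. by rewrite /Q (bigD1 i)//= lerDl sumr_ge0. Qed.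

Let Q0 t : 0 <= Q t. Proof. exact: sumr_ge0. Qed.

(** Every polynomial in Q is dominated by exp Q, so one exponential moment gives all the
    integrability used below. *)
Lemma igr_exp_bound n (f : TT -> R) c : measurable_fun setT f -> 0 <= c ->
  (forall t, `|f t| <= c * Q t ^+ n) -> igr PP f.
Proof.
move=> mf c0 fQ; have I1 := igrZ (c * n`!%:R) IZ.
apply: igr_le mf _ I1 => t; apply: (le_trans (fQ t)).
by rewrite -mulrA ler_wpM2l// le_exprn_expR.
Qed.

Lemma igr_coord i : igr PP (Z i).
Proof.
apply: (@igr_exp_bound 1 _ 1) => // t; rewrite expr1 mul1r; exact: abs_le_sum.
Qed.

Lemma igr_sqr i : igr PP (fun t => Z i t ^+ 2).
Proof.
apply: (@igr_exp_bound 2 _ 1) => //; first exact: measurable_funX.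
move=> t; rewrite mul1r normrX lerXn2r ?nnegrE//; exact: abs_le_sum.
Qed.

Lemma igr_sqrB i j : igr PP (fun t => (Z i t - Z j t) ^+ 2).
Proof.
apply: (@igr_exp_bound 2 _ 4) => //.
  by apply: measurable_funX; exact: measurable_funB.
move=> t; rewrite normrX (_ : 4 * Q t ^+ 2 = (2 * Q t) ^+ 2); last by ring.
rewrite lerXn2r ?nnegrE ?mulr_ge0//; apply: (le_trans (ler_normB _ _)).
by have := abs_le_sum i t; have := abs_le_sum j t; lra.
Qed.

End moments.

Let QX t := \sum_i `|X i t|.
Let QY t := \sum_i `|Y i t|.
Let K1 := 24 * (lam * C + lam ^+ 2 * (1 + C) + lam ^+ 3).

(* The linear part of the expansion costs the variance s^2 V, and its quadratic
   part is larger for Y than for X. *)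
Lemma jet_step : exists2 K, 0 <= K & forall F, has_jet C F ->
  (forall x s, measurable_fun setT (fun t => F (fun i => x i + s * X i t))) ->
  (forall x s, measurable_fun setT (fun t => F (fun i => x i + s * Y i t))) ->
  forall x s, 0 <= s <= 1 ->
  [/\ igr P (fun t => expR (lam * F (fun i => x i + s * X i t))),
      igr P' (fun t => F (fun i => x i + s * Y i t))
    & \int[P]_t expR (lam * F (fun i => x i + s * X i t)) <=
      expR (lam * \int[P']_t F (fun i => x i + s * Y i t) +
            lam ^+ 2 / 2 * s ^+ 2 * V + K * s ^+ 3)].
Proof.
have K10 : 0 <= K1.
  by rewrite /K1 mulr_ge0// addr_ge0 ?exprn_ge0// addr_ge0 ?mulr_ge0 ?sqr_ge0 ?addr_ge0.
have IX1 : igr P (fun t => expR (\sum_i `|X i t|)).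
  by have := IX 1; apply: eq_integrable => // t _ /=; rewrite mul1r.
pose EW := \int[P]_t expR ((lam + 1) * QX t).
pose EQ := \int[P']_t QY t ^+ 3.
have mQY : measurable_fun setT QY.
  by apply: measurable_sum => i; exact: measurableT_comp.
have QY0 t : 0 <= QY t by exact: sumr_ge0.
have QX0 t : 0 <= QX t by exact: sumr_ge0.
have IQY : igr P' (fun t => QY t ^+ 3).
  apply: (@igr_exp_bound _ _ _ _ IY 3 _ 1) => //; first exact: measurable_funX.
  by move=> t; rewrite mul1r ger0_norm ?exprn_ge0//; exact: QY0.
have EW0 : 0 <= EW by apply: Rintegral_ge0 => t _; exact: expR_ge0.
have EQ0 : 0 <= EQ by apply: Rintegral_ge0 => t _; rewrite exprn_ge0.
(* Chosen before F, x and s: the same constant has to serve in each of the m steps of the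
   interpolation. *)
exists (K1 * EW + lam * (C * EQ)).
  by rewrite addr_ge0 // mulr_ge0 // mulr_ge0.
move=> F jF mFX mFY x s /[dup] s01 /andP[s0 s1].
have [p [q [p0 p1 q0 q1 jet]]] := jF x.
pose qf (z : I -> R) := 4^-1 * \sum_i \sum_j q i j * (z i - z j) ^+ 2.
have jetE (z : I -> R) Q : (forall i, `|z i| <= Q) ->
    `|F (fun i => x i + s * z i) - F x| <= s * Q /\
    `|F (fun i => x i + s * z i) - F x - s * \sum_i p i * z i - s ^+ 2 * qf z|
      <= C * (s ^+ 3 * Q ^+ 3).
  move=> zQ; have szQ i : `|s * z i| <= s * Q.
    by rewrite normrM (ger0_norm s0) ler_wpM2l.
  have [j1 j2] := jet _ _ szQ; split=> //; move: j2; rewrite exprMn.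
  have -> : \sum_i p i * (s * z i) = s * \sum_i p i * z i.
    by rewrite mulr_sumr; apply: eq_bigr => i _; rewrite mulrCA.
  suff -> : 4^-1 * \sum_i \sum_j q i j * (s * z i - s * z j) ^+ 2 = s ^+ 2 * qf z by [].
  rewrite /qf mulrCA; congr (_ * _); rewrite mulr_sumr; apply: eq_bigr => i _.
  by rewrite mulr_sumr; apply: eq_bigr => j _; ring.
have igr_qf dd (TT : measurableType dd) (PP : probability TT R) (Z : I -> TT -> R) :
    (forall i, measurable_fun setT (Z i)) ->
    igr PP (fun t => expR (\sum_i `|Z i t|)) -> igr PP (fun t => qf (Z^~ t)).
  move=> mZ IZ; apply: igrZ; apply: igr_sum => i; apply: igr_sum => j.
  by apply: igrZ; exact: igr_sqrB.
have E_qf dd (TT : measurableType dd) (PP : probability TT R) (Z : I -> TT -> R) :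
    (forall i, measurable_fun setT (Z i)) ->
    igr PP (fun t => expR (\sum_i `|Z i t|)) -> \int[PP]_t qf (Z^~ t) =
      4^-1 * \sum_i \sum_j q i j * \int[PP]_t (Z i t - Z j t) ^+ 2.
  move=> mZ IZ; rewrite EZ; last first.
    by apply: igr_sum => i; apply: igr_sum => j; apply: igrZ; exact: igr_sqrB.
  congr (_ * _); rewrite E_sum => [|i]; last first.
    by apply: igr_sum => j; apply: igrZ; exact: igr_sqrB.
  apply: eq_bigr => i _; rewrite E_sum => [|j]; last by apply: igrZ; exact: igr_sqrB.
  by apply: eq_bigr => j _; rewrite EZ//; exact: igr_sqrB.
have igr_L dd (TT : measurableType dd) (PP : probability TT R) (Z : I -> TT -> R) :
    (forall i, measurable_fun setT (Z i)) ->
    igr PP (fun t => expR (\sum_i `|Z i t|)) -> igr PP (fun t => \sum_i p i * Z i t).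
  by move=> mZ IZ; apply: igr_sum => i; apply: igrZ; exact: igr_coord.
have E_L dd (TT : measurableType dd) (PP : probability TT R) (Z : I -> TT -> R) :
    (forall i, measurable_fun setT (Z i)) ->
    igr PP (fun t => expR (\sum_i `|Z i t|)) -> (forall i, \int[PP]_t Z i t = 0) ->
    \int[PP]_t (\sum_i p i * Z i t) = 0.
  move=> mZ IZ Z0; rewrite E_sum => [|i]; last by apply: igrZ; exact: igr_coord.
  by rewrite big1// => i _; rewrite EZ ?Z0 ?mulr0//; exact: igr_coord.
have XQ t i : `|X i t| <= QX t := abs_le_sum X i t.
have YQ t i : `|Y i t| <= QY t := abs_le_sum Y i t.
have IFY : igr P' (fun t => F (fun i => x i + s * Y i t)).
  apply: (@igr_le _ _ _ _ _ (fun t => `|F x| + QY t)) => //.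
    move=> t; rewrite -lerBlDl; apply: (le_trans (lerB_dist _ _)).
    apply: (le_trans (jetE _ _ (YQ t)).1).
    by rewrite ler_piMl ?QY0.
  apply: igrD; first exact: igr_cst.
  by apply: igr_sum => i; apply: igr_norm; exact: igr_coord.
pose D t := F (fun i => x i + s * X i t) - F x.
pose L t := \sum_i p i * X i t.
pose qq t := qf (X^~ t).
have mL : measurable_fun setT L.
  by apply: measurable_sum => i; apply: measurable_funM.
have IL := igr_L _ _ _ _ mX IX1.
have EL0 : \int[P]_t L t = 0 := E_L _ _ _ _ mX IX1 X0.
have Iqq := igr_qf _ _ _ _ mX IX1.
have IL2 : igr P (fun t => L t ^+ 2).
  apply: (@igr_exp_bound _ _ _ _ IX1 2 _ 1) => //; first exact: measurable_funX.
  move=> t; rewrite mul1r normrX lerXn2r ?nnegrE//; first exact: QX0.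
  exact: mean_norm_le (XQ t).
have IW := IX (lam + 1).
(* The integrated pointwise bound: its term linear in [L] vanishes because X is centred, which
   leaves only terms of order s^2 and s^3. *)
pose G t := 1 + ((lam * s) * L t + (lam * s ^+ 2) * qq t +
  (lam ^+ 2 / 2 * s ^+ 2) * L t ^+ 2 + (s ^+ 3 * K1) * expR ((lam + 1) * QX t)).
have IG1 := igrZ (lam * s) IL.
have IG2 := igrZ (lam * s ^+ 2) Iqq.
have IG3 := igrZ (lam ^+ 2 / 2 * s ^+ 2) IL2.
have IG4 := igrZ (s ^+ 3 * K1) IW.
have IG12 := igrD IG1 IG2.
have IG123 := igrD IG12 IG3.
have IG1234 := igrD IG123 IG4.
have IG : igr P G := igrD (igr_cst P 1) IG1234.
have EG : \int[P]_t G t = 1 + (lam * s ^+ 2 * \int[P]_t qq t +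
    lam ^+ 2 / 2 * s ^+ 2 * \int[P]_t (L t ^+ 2) + s ^+ 3 * K1 * EW).
  rewrite (ED (igr_cst P 1) IG1234) Ecst (ED IG123 IG4) (ED IG12 IG3) (ED IG1 IG2).
  by rewrite (EZ (lam * s) IL) (EZ (lam * s ^+ 2) Iqq) (EZ (lam ^+ 2 / 2 * s ^+ 2) IL2)
    (EZ (s ^+ 3 * K1) IW) EL0 mulr0 add0r.
have DG t : expR (lam * D t) <= G t.
  have [j1 j2] := jetE _ _ (XQ t).
  apply: (le_trans (jet_step_pointwise lam0 s01 (QX0 t) C0 _ _ j1 j2)).
  - exact: mean_norm_le (XQ t).
  - exact: quad_mean_le (XQ t).
  - by rewrite /G -/K1 /qq /L; lra.
have ID : igr P (fun t => expR (lam * D t)).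
  apply: igr_le IG => [|t]; last by rewrite ger0_norm ?expR_ge0.
  apply: measurableT_comp => //; apply: measurable_funM => //.
  exact: measurable_funB.
have DE : (fun t => expR (lam * F (fun i => x i + s * X i t))) =
    fun t => expR (lam * F x) * expR (lam * D t).
  by apply/funext => t; rewrite -expRD /D; congr expR; ring.
split=> //.
  by rewrite DE; exact: igrZ.
rewrite DE EZ//.
have EL2 : \int[P]_t (L t ^+ 2) <= V.
  apply: (@le_trans _ _ (\int[P]_t (\sum_i p i * X i t ^+ 2))).
    apply: le_E => //; last by move=> t; exact: sqr_mean_le.
    by apply: igr_sum => i; apply: igrZ; exact: igr_sqr.
  rewrite E_sum => [|i]; last by apply: igrZ; exact: igr_sqr.
  rewrite -[leRHS]mul1r -p1 mulr_suml; apply: ler_sum => i _.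
  by rewrite EZ ?ler_wpM2l//; exact: igr_sqr.
pose EqY := \int[P']_t qf (Y^~ t).
have EqXY : \int[P]_t qq t <= EqY.
  rewrite /EqY !E_qf// ler_wpM2l ?invr_ge0//.
  by apply: ler_sum => i _; apply: ler_sum => j _; rewrite ler_wpM2l.
(* The same expansion, read as a lower bound and averaged over the centred Y, turns the quadratic
   term back into a mean of F. *)
have EFY : F x + s ^+ 2 * EqY - C * s ^+ 3 * EQ <=
    \int[P']_t F (fun i => x i + s * Y i t).
  have I0 := igr_cst P' (F x).
  have ILY := igr_L _ _ _ _ mY IY.
  have IqY := igr_qf _ _ _ _ mY IY.
  have ELY := E_L _ _ _ _ mY IY Y0.
  have I1 := igrZ s ILY.
  have I2 := igrZ (s ^+ 2) IqY.
  have I3 := igrZ (C * s ^+ 3) IQY.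
  have I01 := igrD I0 I1.
  have I012 := igrD I01 I2.
  have I0123 := igrB I012 I3.
  apply: (@le_trans _ _ (\int[P']_t (F x + s * (\sum_i p i * Y i t) +
      s ^+ 2 * qf (Y^~ t) - C * s ^+ 3 * QY t ^+ 3))).
    rewrite (EB I012 I3) (ED I01 I2) (ED I0 I1) Ecst (EZ s ILY) (EZ (s ^+ 2) IqY).
    by rewrite (EZ (C * s ^+ 3) IQY) ELY mulr0 addr0.
  apply: le_E => // t.
  by have [_] := jetE _ _ (YQ t); rewrite ler_norml => /andP[+ _]; lra.
apply: (@le_trans _ _ (expR (lam * F x) * expR (lam * s ^+ 2 * EqY +
    lam ^+ 2 / 2 * s ^+ 2 * V + s ^+ 3 * K1 * EW))).
  rewrite ler_wpM2l ?expR_ge0//; apply: (le_trans (le_E ID IG DG)).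
  (* Passing from 1 + z to exp z makes the costs of successive steps add up in the exponent. *)
  rewrite EG; apply: le_trans (expR_ge1Dx _).
  rewrite lerD2l lerD2r lerD// ler_wpM2l// ?mulr_ge0 ?divr_ge0 ?sqr_ge0//.
rewrite -expRD ler_expR.
have := ler_wpM2l lam0 EFY; lra.
Qed.

End jet_step.

(** * Moments of Gaussian linear forms *)

Section gaussian_moments.
Context {R : realType}.
Local Notation TR := (measurableTypeR R).
Local Notation G := (iid (gauss1 (1 : R))).
Local Notation igr P f := (P.-integrable setT (EFin \o f)).

(** The shift formula applied to the constant function 1, solved for the exponential moment. *)
Lemma integral_gauss1_expR (k : R) :
  (\int[gauss1 1]_(x in [set: TR]) (expR (k * x))%:E = (expR (k ^+ 2 / 2))%:E)%E.
Proof.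
have mk : measurable_fun setT (fun x : TR => (expR (k * x))%:E).
  by apply/measurable_EFinP; apply: measurableT_comp => //; exact: measurable_funM.
have mw : measurable_fun setT
    (fun x : TR => (expR (k * x / 1 ^+ 2 - k ^+ 2 / (1 ^+ 2 *+ 2)))%:E).
  apply/measurable_EFinP; apply: measurableT_comp => //.
  by apply: measurable_funB => //; apply: measurable_funM => //; exact: measurable_funM.
have := @ge0_integral_gauss1_shift R 1 k (cst 1%E) (oner_neq0 R) (measurable_cst _).
move=> /(_ (fun=> lee01)); rewrite integral_prob_cst.
under [X in _ = X -> _]eq_integral do rewrite mul1e.
move=> e; rewrite -[RHS]mule1 e -(ge0_integralZl _ _ mw); last 3 first.
- exact: measurableT.
- by move=> x _; rewrite lee_fin expR_ge0.
- by rewrite lee_fin expR_ge0.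
apply: eq_integral => x _; rewrite -EFinM -expRD; congr (expR _)%:E.
by rewrite expr1n divr1 addrC subrK.
Qed.

Let second_moment_arith (y w e E : R) : 2 * y * w + 2 <= 2 * E ->
  E - (1 + y + y ^+ 2 / 2) <= y ^+ 3 * E -> y ^+ 3 * E <= y ^+ 2 * 16 ->
  y ^+ 2 * 17 <= y * e -> y * w <= y * (1 + e).
Proof. have := sqr_ge0 y; lra. Qed.

(* Integrate 2 + k^2 x^2 <= e^(kx) + e^(-kx) and let k tend to 0. *)
Lemma integral_gauss1_sqr_le1 :
  (\int[gauss1 1]_(x in [set: TR]) (x ^+ 2)%:E <= 1%:E)%E.
Proof.
have msq : measurable_fun setT (fun x : TR => (x ^+ 2)%:E).
  by apply/measurable_EFinP; exact: measurable_funX.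
have mk (k : R) : measurable_fun setT (fun x : TR => (expR (k * x))%:E).
  by apply/measurable_EFinP; apply: measurableT_comp => //; exact: measurable_funM.
have key (k : R) : ((k ^+ 2)%:E * \int[gauss1 1]_(x in [set: TR]) (x ^+ 2)%:E + 2%:E <=
    (2 * expR (k ^+ 2 / 2))%:E)%E.
  rewrite -ge0_integralZl ?lee_fin ?sqr_ge0//; last by move=> x _; rewrite lee_fin sqr_ge0.
  rewrite -[X in (_ + X)%E](integral_prob_cst (gauss1 1)) -ge0_integralD//; last 2 first.
  - by move=> x _; rewrite -EFinM lee_fin mulr_ge0 ?sqr_ge0.
  - exact: measurable_funeM.
  have e1 := integral_gauss1_expR k; have e2 := integral_gauss1_expR (- k).
  rewrite sqrrN in e2.
  have -> : ((2 * expR (k ^+ 2 / 2))%:E =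
      \int[gauss1 1]_(x in [set: TR]) (expR (k * x))%:E +
      \int[gauss1 1]_(x in [set: TR]) (expR (- k * x))%:E)%E.
    by rewrite e1 e2 -EFinD; congr EFin; ring.
  rewrite -ge0_integralD//; try by move=> x _; rewrite lee_fin expR_ge0.
  apply: ge0_le_integral => //.
  - by move=> x _; apply: adde_ge0; [apply: mule_ge0; rewrite lee_fin sqr_ge0|rewrite lee_fin].
  - by apply: emeasurable_funD => //; exact: measurable_funeM.
  - exact: emeasurable_funD.
  - move=> x _; rewrite -EFinM -!EFinD lee_fin -exprMn addrC mulNr.
    exact: cosh_ge.
move: key; set v := (\int[gauss1 1]_(x in _) _)%E => key.
have v0 : (0 <= v)%E by apply: integral_ge0 => x _; rewrite lee_fin sqr_ge0.
have vfin : v \is a fin_num.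
  rewrite ge0_fin_numE//; have := key 1; rewrite expr1n mul1e => h.
  apply: le_lt_trans (ltry (2 * expR (1 / 2))).
  by apply: le_trans h; rewrite leeDl// lee_fin.
rewrite -(fineK vfin) lee_fin; move: key; rewrite -(fineK vfin).
have : 0 <= fine v by exact: fine_ge0.
move: (fine v) => w w0 key {v v0 vfin}.
apply/ler_addgt0Pr => e e0.
(* Take k^2 = 2 y. Then the key inequality reads y w <= exp y - 1 <= y + y^2 / 2 + 16 y^2, and 17
   y^2 <= y e. *)
pose y := Num.min 1 (e / 17).
have y0 : 0 < y by rewrite lt_min ltr01/= divr_gt0.
have y1 : y <= 1 by rewrite ge_min lexx.
have ye : y * 17 <= e by rewrite -ler_pdivlMr// ge_min lexx orbT.
have := key (Num.sqrt (2 * y)).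
rewrite sqr_sqrtr; last by rewrite mulr_ge0// ltW.
rewrite (_ : 2 * y / 2 = y); last by field.
rewrite -EFinM -EFinD lee_fin => h.
have e16 : expR 1 <= (16 : R) by apply: le_trans expR2_le16; rewrite ler_expR; lra.
have := expR_taylor3 y; rewrite (ger0_norm (ltW y0)) ler_norml => /andP[_ t].
have y3 : y ^+ 3 * expR y <= y ^+ 2 * 16.
  rewrite exprSr -mulrA ler_wpM2l ?sqr_ge0//.
  rewrite -[leRHS]mul1r ler_pM ?expR_ge0 ?(ltW y0)//.
  by apply: le_trans e16; rewrite ler_expR.
have : y * w <= y * (1 + e); last by rewrite ler_pM2l.
have : y ^+ 2 * 17 <= y * e by rewrite expr2 -mulrA ler_pM2l.
exact: second_moment_arith h t y3.
Qed.

Lemma E_gauss_lin_law N (a : 'I_N -> R) (f : R -> R) : measurable_fun setT (f : TR -> R) ->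
  (forall x, 0 <= f x) ->
  \int[G N]_t f (\sum_i a i * tnth t i) =
  \int[gauss1 1]_(x in [set: TR]) f (Num.sqrt (\sum_i a i ^+ 2) * x).
Proof.
move=> mf f0; rewrite /Rintegral; congr fine.
apply: (@ge0_integral_gauss_lin _ _ a (fun x => (f x)%:E)) => //.
by apply/measurable_EFinP.
Qed.

Lemma igr_gauss_exp N (a : 'I_N -> R) :
  igr (G N) (fun t => expR (\sum_i a i * tnth t i)).
Proof.
apply/integrableP; split.
  apply/measurable_EFinP; apply: measurableT_comp => //; exact: measurable_lin.
under eq_integral do rewrite /= ger0_norm ?expR_ge0//.
rewrite (@ge0_integral_gauss_lin _ _ a (fun x => (expR x)%:E)).
- by rewrite integral_gauss1_expR ltry.
- by apply/measurable_EFinP.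
- by move=> x; rewrite lee_fin expR_ge0.
Qed.

(** The sum is at most #|I| times its largest term, and exp (c |X i|) <= exp (c X i) + exp (- c X
    i); adding this over all i avoids naming the maximizer. *)
Lemma igr_gauss_exp_sum N {I : finType} (a : I -> 'I_N -> R) (k : R) :
  igr (G N) (fun t => expR (k * \sum_i `|\sum_j a i j * tnth t j|)).
Proof.
have mlin i : measurable_fun setT (fun t : N.-tuple TR => \sum_j a i j * tnth t j : R).
  exact: measurable_lin.
case: (pickP (@predT I)) => [i0 _|I0]; last first.
  apply: eq_integrable (igr_cst (G N) 1) => // t _ /=.
  by rewrite big_pred0// mulr0 expR0.
pose c := `|k| * #|I|%:R.
have c0 : 0 <= c by rewrite mulr_ge0.
apply: (@igr_le _ _ _ (G N) _ (fun t => \sum_i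
   (expR (\sum_j (c * a i j) * tnth t j) + expR (\sum_j (- c * a i j) * tnth t j)))).
- apply: measurableT_comp => //; apply: measurable_funM => //.
  by apply: measurable_sum => i; exact: measurableT_comp.
- move=> t; rewrite ger0_norm ?expR_ge0//.
  pose X i := \sum_j a i j * tnth t j.
  have [i XM] : exists i, forall j, `|X j| <= `|X i|.
    have [i _ h] := @arg_maxP _ _ _ i0 xpredT (fun i => `|X i|) isT.
    by exists i => j; exact: h.
  apply: (@le_trans _ _ (expR (c * `|X i|))).
    rewrite ler_expR /c -mulrA; apply: (@le_trans _ _ (`|k| * \sum_i0 `|X i0|)).
      by rewrite ler_wpM2r ?ler_norm// sumr_ge0.
    rewrite ler_wpM2l// -sum1_card natr_sum mulr_suml.
    by apply: ler_sum => j _; rewrite mul1r.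
  have XE b : \sum_j (b * a i j) * tnth t j = b * X i.
    by rewrite mulr_sumr; apply: eq_bigr => j _; rewrite mulrA.
  rewrite (bigD1 i)//= !XE.
  apply: (@le_trans _ _ (expR (c * X i) + expR (- c * X i))).
    have [X0|X0] := leP 0 (X i).
      by rewrite ger0_norm// lerDl expR_ge0.
    by rewrite ltr0_norm// mulrN mulNr lerDr expR_ge0.
  by rewrite lerDl sumr_ge0// => j _; rewrite addr_ge0 ?expR_ge0.
- apply: igr_sum => i; apply: igrD; exact: igr_gauss_exp.
Qed.

Lemma igr_gauss_lin N (a : 'I_N -> R) : igr (G N) (fun t => \sum_i a i * tnth t i).
Proof.
have I1 : igr (G N) (fun t => expR (\sum_(i < 1) `|\sum_j a j * tnth t j|)).
  have := @igr_gauss_exp_sum N 'I_1 (fun=> a) 1; apply: eq_integrable => // t _ /=.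
  by rewrite mul1r.
by have := @igr_coord R _ _ _ (G N) (fun=> fun t => \sum_j a j * tnth t j)
  (fun=> measurable_lin a) I1 ord0.
Qed.

(** The law formula covers nonnegative functions only, so it is applied to x + |x|. The forms with
    coefficients a and -a have the same law, hence X + |X| and -X + |X| have the same mean. *)
Lemma E_gauss_lin N (a : 'I_N -> R) : \int[G N]_t (\sum_i a i * tnth t i) = 0.
Proof.
pose h (x : R) := x + `|x|.
have mh : measurable_fun setT (h : TR -> R).
  by apply: measurable_funD => //; exact: measurableT_comp.
have h0 x : 0 <= h x by rewrite /h; have := ler_norm (- x); rewrite normrN; lra.
have e1 := E_gauss_lin_law a mh h0.
have e2 := E_gauss_lin_law (fun i => - a i) mh h0.
have Il := igr_gauss_lin a.
have In := igr_norm Il.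
have IN := igrZ (-1) Il.
move: e1 e2; under [in X in _ -> X -> _]eq_bigr do rewrite sqrrN.
move=> <-; rewrite /h (ED Il In).
under eq_Rintegral do under eq_bigr do rewrite mulNr.
under eq_Rintegral do rewrite sumrN normrN -mulN1r.
rewrite (ED IN In) (EZ _ Il); lra.
Qed.

(** The second moment of one normal variable is left as a factor: increments are compared with it on
    both sides, and for variances the bound by 1 suffices. *)
Lemma E_gauss_lin_sqr N (a : 'I_N -> R) : \int[G N]_t (\sum_i a i * tnth t i) ^+ 2 =
  (\sum_i a i ^+ 2) * \int[gauss1 1]_(x in [set: TR]) (x ^+ 2).
Proof.
have msq : measurable_fun setT (fun x : TR => x ^+ 2 : R) by exact: measurable_funX.
rewrite (E_gauss_lin_law a msq (fun=> sqr_ge0 _)).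
have S0 : 0 <= \sum_i a i ^+ 2 by apply: sumr_ge0 => i _; exact: sqr_ge0.
rewrite -EZ.
  by apply: eq_Rintegral => x _; rewrite exprMn sqr_sqrtr.
apply/integrableP; split; first exact/measurable_EFinP.
under eq_integral do rewrite /= ger0_norm ?sqr_ge0//.
exact: le_lt_trans integral_gauss1_sqr_le1 (ltry _).
Qed.

Lemma E_gauss1_sqr_ge0_le1 :
  0 <= \int[gauss1 (1 : R)]_(x in [set: TR]) (x ^+ 2) <= 1.
Proof.
apply/andP; split; first by apply: Rintegral_ge0 => x _; exact: sqr_ge0.
rewrite /Rintegral -[leRHS]/(fine 1%:E) fine_le// ?integral_gauss1_sqr_le1//.
rewrite ge0_fin_numE; last by apply: integral_ge0 => x _; rewrite lee_fin sqr_ge0.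
exact: le_lt_trans integral_gauss1_sqr_le1 (ltry _).
Qed.

End gaussian_moments.

Lemma measurable_Rintegral_param d1 d2 (T1 : measurableType d1) (T2 : measurableType d2)
    (R : realType) (P : probability T2 R) (g : T1 * T2 -> R) :
  measurable_fun setT g -> measurable_fun setT (fun x => \int[P]_y g (x, y)).
Proof.
move=> mg; have mgE : measurable_fun setT (EFin \o g) by exact/measurable_EFinP.
apply: (measurableT_comp (fine_measurable measurableT)).
under eq_fun do rewrite integralE.
apply: emeasurable_funB.
- have mp := measurable_funepos mgE.
  have := @measurable_fun_fubini_tonelli_F _ _ _ _ R P _ mp (fun=> funepos_ge0 _ _).
  by apply: eq_measurable_fun => x _; apply: eq_integral => y _; rewrite !funeposE.
- have mn := measurable_funeneg mgE.
  have := @measurable_fun_fubini_tonelli_F _ _ _ _ R P _ mn (fun=> funeneg_ge0 _ _).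
  by apply: eq_measurable_fun => x _; apply: eq_integral => y _; rewrite !funenegE.
Qed.

(** * Comparison of exponential moments by interpolation *)

Section gaussian_comparison.
Context {R : realType} {I : finType} (i0 : I) {N N' : nat}.
Local Notation TR := (measurableTypeR R).
Local Notation G := (iid (gauss1 (1 : R))).
Local Notation igr P f := (P.-integrable setT (EFin \o f)).
Variables (a : I -> 'I_N -> R) (b : I -> 'I_N' -> R) (V lam : R).
Hypotheses (lam0 : 0 <= lam) (aV : forall i, \sum_k a i k ^+ 2 <= V)
  (ab : forall i j, \sum_k (a i k - a j k) ^+ 2 <= \sum_k (b i k - b j k) ^+ 2).

Definition lin M (c : I -> 'I_M -> R) i (t : M.-tuple TR) : R := \sum_k c i k * tnth t k.

Local Notation X := (lin a).
Local Notation Y := (lin b).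

Lemma lin_comb M (c : I -> 'I_M -> R) i s r (t u : M.-tuple TR) :
  lin c i [tuple s * tnth t k + r * tnth u k | k < M] = s * lin c i t + r * lin c i u.
Proof.
rewrite /lin !mulr_sumr -big_split/=; apply: eq_bigr => k _.
by rewrite tnth_mktuple mulrDr !mulrA ![c i k * _]mulrC.
Qed.

Lemma measurable_lin_coord M (c : I -> 'I_M -> R) i : measurable_fun setT (lin c i).
Proof. exact: measurable_lin. Qed.

Let V0 : 0 <= V.
Proof. by apply: le_trans (aV i0); apply: sumr_ge0 => k _; exact: sqr_ge0. Qed.

(** The function in use once a share r^2 of the variance has been moved from X to Y. *)
Definition avg_softmax r (x : I -> R) : R := \int[G N']_u softmax (fun i => x i + r * Y i u).

Lemma igr_rY r i : igr (G N') (fun u => r * Y i u).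
Proof. by apply: igrZ; exact: igr_gauss_lin. Qed.

Lemma avg_softmax_has_jet r : has_jet 20000 (avg_softmax r).
Proof. exact: (mean_softmax_has_jet i0 (igr_rY r)). Qed.

Lemma measurable_avg_softmax_shift d (T : measurableType d) r (x : I -> R) s (Z : I -> T -> R) :
  (forall i, measurable_fun setT (Z i)) ->
  measurable_fun setT (fun t => avg_softmax r (fun i => x i + s * Z i t)).
Proof.
move=> mZ; apply: (@measurable_Rintegral_param _ _ _ _ _ _
  (fun tu => softmax (fun i => x i + s * Z i tu.1 + r * Y i tu.2))).
have -> : (fun tu : T * N'.-tuple TR =>
      softmax (fun i => x i + s * Z i tu.1 + r * Y i tu.2)) =
    fun tu => softmax (fun i => x i + (s * Z i tu.1 + r * Y i tu.2)).
  by apply/funext => tu; congr softmax; apply/funext => i; rewrite addrA.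
apply: measurable_softmax_shift => i.
apply: measurable_funD; apply: measurable_funM => //.
- exact: (measurableT_comp (mZ i) measurable_fst).
- exact: (measurableT_comp (measurable_lin_coord b i) measurable_snd).
Qed.

(** Semigroup property of Gaussian averaging. The rotation formula is stated for nonnegative
    functions, so the coordinate i0 is subtracted from [softmax]; its random part has mean 0 and
    drops out on both sides. *)
Lemma avg_softmax_conv r s x : 0 <= r ->
  igr (G N') (fun u => avg_softmax r (fun i => x i + s * Y i u)) ->
  \int[G N']_u avg_softmax r (fun i => x i + s * Y i u) = avg_softmax (Num.sqrt (s ^+ 2 + r ^+ 2)) x.
Proof.
move=> r0 If; set q := Num.sqrt _.
pose H (t : N'.-tuple TR) := softmax (fun i => x i + Y i t) - (x i0 + Y i0 t).
have H0 t : 0 <= H t by rewrite subr_ge0; exact: (softmax_ge (fun i => x i + Y i t)).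
have mH : measurable_fun setT H.
  apply: measurable_funB; last by apply: measurable_funD => //; exact: measurable_lin_coord.
  by apply: measurable_softmax_shift => i; exact: measurable_lin_coord.
have EY c : \int[G N']_u (c * Y i0 u) = 0.
  by rewrite EZ ?E_gauss_lin ?mulr0//; exact: igr_gauss_lin.
have ISm y c : igr (G N') (fun u => softmax (fun i => y i + c * Y i u)).
  exact: (igr_softmax_shift i0 y (igr_rY c)).
have inner y c : (\int[G N']_u (softmax (fun i => y i + c * Y i u) - (y i0 + c * Y i0 u))%:E)%E =
    (avg_softmax c y - y i0)%:E.
  have I2 : igr (G N') (fun u => y i0 + c * Y i0 u).
    by apply: igrD; [exact: igr_cst|exact: igr_rY].
  rewrite -EFin_E; last by apply: igrB => //; exact: ISm.
  rewrite (EB (ISm y c) I2) (ED (igr_cst (G N') (y i0)) (igr_rY c i0)) Ecst EY.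
  by rewrite addr0.
have := @ge0_integral_gauss_conv R N' s r (EFin \o H) r0.
have mHE : measurable_fun setT (EFin \o H) by exact/measurable_EFinP.
move=> /(_ mHE) /(_ (fun=> H0 _)) /=.
rewrite -/q.
under eq_integral => t _.
  under eq_integral => u _.
    rewrite (_ : H _ = softmax (fun i => (x i + s * Y i t) + r * Y i u) -
      ((x i0 + s * Y i0 t) + r * Y i0 u)); last first.
      rewrite /H lin_comb addrA; congr (softmax _ - _).
      by apply/funext => i; rewrite lin_comb addrA.
    over.
  rewrite (inner (fun i => x i + s * Y i t) r); over.
under [in X in _ = X -> _]eq_integral => t _.
  rewrite (_ : H _ = softmax (fun i => x i + q * Y i t) - (x i0 + q * Y i0 t)); last first.
    have e i : Y i [tuple q * tnth t k | k < N'] = q * Y i t.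
      rewrite /lin mulr_sumr; apply: eq_bigr => k _.
      by rewrite tnth_mktuple mulrCA.
    by rewrite /H e; congr (softmax _ - _); apply/funext => i; rewrite e.
  over.
rewrite inner.
have I2 : igr (G N') (fun u => x i0 + s * Y i0 u).
  by apply: igrD; [exact: igr_cst|exact: igr_rY].
rewrite -EFin_E; last exact: igrB.
rewrite (EB If I2) (ED (igr_cst (G N') (x i0)) (igr_rY s i0)) Ecst EY addr0.
by move=> [] /addIr.
Qed.

Lemma lin_scale M (c : I -> 'I_M -> R) i s (t : M.-tuple TR) :
  lin c i [tuple s * tnth t k | k < M] = s * lin c i t.
Proof.
rewrite /lin mulr_sumr; apply: eq_bigr => k _.
by rewrite tnth_mktuple mulrCA.
Qed.

Lemma E_linB_sqr M (c : I -> 'I_M -> R) i j :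
  \int[G M]_t (lin c i t - lin c j t) ^+ 2 =
  (\sum_k (c i k - c j k) ^+ 2) * \int[gauss1 (1 : R)]_(x in [set: TR]) (x ^+ 2).
Proof.
rewrite -(E_gauss_lin_sqr (fun k => c i k - c j k)); apply: eq_Rintegral => t _.
by congr (_ ^+ 2); rewrite /lin -sumrB; apply: eq_bigr => k _; rewrite mulrBl.
Qed.

Let expR_add3_le (u v w : R) : expR (u + v + w) <= expR (v + w) * expR u.
Proof. by rewrite -expRD -addrA addrC. Qed.

Let eqle (x y : \bar R) : x = y -> (y <= x)%E.
Proof. by move=> ->. Qed.

(* X is replaced by Y in m steps of variance s^2 = 1/m: after k steps the averaged
   function is avg_softmax (r k), and the m errors K s^3 add up to K / sqrt m. *)
Lemma gaussian_softmax_comparison (eta : R) : 0 < eta ->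
  (\int[G N]_t (expR (lam * softmax (fun i => X i t)))%:E <=
   (expR (lam * \int[G N']_u softmax (fun i => Y i u) + lam ^+ 2 / 2 * V + eta))%:E)%E.
Proof.
move=> eta0.
have IX k : igr (G N) (fun t => expR (k * \sum_i `|X i t|)) by exact: igr_gauss_exp_sum.
have IY : igr (G N') (fun t => expR (\sum_i `|Y i t|)).
  have := igr_gauss_exp_sum b 1; apply: eq_integrable => // t _ /=.
  by rewrite mul1r.
have /andP[v0 v1] := @E_gauss1_sqr_ge0_le1 R.
have XV i : \int[G N]_t (X i t ^+ 2) <= V.
  rewrite /lin E_gauss_lin_sqr -[leRHS]mulr1; apply: ler_pM => //.
  by apply: sumr_ge0 => k _; exact: sqr_ge0.
have XY i j : \int[G N]_t (X i t - X j t) ^+ 2 <= \int[G N']_t (Y i t - Y j t) ^+ 2.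
  by rewrite !E_linB_sqr; apply: ler_wpM2r.
have X0 i : \int[G N]_t X i t = 0 by exact: E_gauss_lin.
have Y0 i : \int[G N']_t Y i t = 0 by exact: E_gauss_lin.
have [K K0 step] := @jet_step R I _ _ (G N) _ _ (G N') X Y V lam 20000 lam0
  (ler0n _ _) (measurable_lin_coord a) (measurable_lin_coord b) IX IY X0 Y0 XV XY.
(* Large enough for the accumulated error K / sqrt m to be at most eta; the successor also makes m
   positive. *)
pose m := (Num.truncn ((K / eta) ^+ 2)).+1.
pose s : R := (Num.sqrt m%:R)^-1.
have m0 : 0 < m%:R :> R by rewrite ltr0n.
have s0 : 0 < s by rewrite invr_gt0 sqrtr_gt0.
have s2 : s ^+ 2 = m%:R^-1 by rewrite exprVn sqr_sqrtr// ltW.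
have Ks : K * s <= eta.
  rewrite ler_pdivrMr ?sqrtr_gt0// mulrC -ler_pdivrMr//.
  rewrite -[leLHS]ger0_norm ?divr_ge0 ?(ltW eta0)// -sqrtr_sqr ler_sqrt ?ltW//.
  by rewrite /m truncnS_gt.
have s1 : s <= 1.
  rewrite invf_le1 ?sqrtr_gt0// -[leLHS]sqrtr1 ler_sqrt ?ler0n//.
  by rewrite ler1n.
have s01 : 0 <= s <= 1 by rewrite ltW.
(* r j = sqrt (j / m), so that (r j)^2 + s^2 = (r j.+1)^2. *)
pose r j : R := Num.sqrt j%:R * s.
have r0 j : 0 <= r j by rewrite mulr_ge0 ?sqrtr_ge0// ltW.
have rm : r m = 1 by rewrite /r mulfV// gt_eqF// sqrtr_gt0.
have rz : r 0%N = 0 by rewrite /r sqrtr0 mul0r.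
have rS j : Num.sqrt (r j ^+ 2 + s ^+ 2) = r j.+1.
  rewrite /r exprMn sqr_sqrtr ?ler0n// -[X in _ + X]mul1r -mulrDl -natr1.
  by rewrite sqrtrM ?addr_ge0// sqrtr_sqr ger0_norm// ltW.
have rS' j : Num.sqrt (s ^+ 2 + r j ^+ 2) = r j.+1 by rewrite addrC rS.
pose F k := avg_softmax (r k).
have stepF k x : igr (G N) (fun t => expR (lam * F k (fun i => x i + s * X i t))) /\
    \int[G N]_t expR (lam * F k (fun i => x i + s * X i t)) <=
    expR (lam * F k.+1 x + lam ^+ 2 / 2 * s ^+ 2 * V + K * s ^+ 3).
  have mFX y c := measurable_avg_softmax_shift (r k) y c (measurable_lin_coord a).
  have mFY y c := measurable_avg_softmax_shift (r k) y c (measurable_lin_coord b).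
  have [h1 h2 h3] := step (F k) (avg_softmax_has_jet (r k)) mFX mFY x s s01.
  split=> //; move: h3; rewrite avg_softmax_conv ?rS'//.
pose eps := lam ^+ 2 / 2 * s ^+ 2 * V + K * s ^+ 3.
pose phi k (t : N.-tuple TR) := (expR (lam * F k (fun i => X i t)))%:E.
have mphi k : measurable_fun setT (phi k).
  apply/measurable_EFinP; apply: measurableT_comp => //; apply: measurable_funM => //.
  have := measurable_avg_softmax_shift (r k) (fun=> 0) 1 (measurable_lin_coord a).
  apply: eq_measurable_fun => t _; congr avg_softmax; apply/funext => i.
  by rewrite add0r mul1r.
have phi0 k t : (0 <= phi k t)%E by rewrite lee_fin expR_ge0.
have mphis k c : measurable_fun setT (fun t : N.-tuple TR => phi k [tuple c * tnth t j | j < N]).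
  apply: (measurableT_comp (mphi k)); apply: measurable_mktuple => j.
  by apply: measurable_funM => //; exact: measurable_coord.
(* After k steps X keeps the variance (r (m - k))^2 while (r k)^2 has passed to Y; the two shares
   always add up to 1. *)
have claim k : (k <= m)%N ->
    (\int[G N]_t phi 0%N t <= (expR (k%:R * eps))%:E *
      \int[G N]_t phi k [tuple r (m - k)%N * tnth t j | j < N]%R)%E.
  elim: k => [_|k IH km].
    rewrite mul0r expR0 mul1e subn0 rm le_eqVlt; apply/orP; left; apply/eqP.
    apply: eq_integral => t _; congr (phi _ _).
    by apply/eq_from_tnth => j; rewrite tnth_mktuple mul1r.
  apply: (le_trans (IH (ltnW km))).
  rewrite -natr1 mulrDl mul1r expRD EFinM -muleA; apply: lee_wpmul2l.
    by rewrite lee_fin expR_ge0.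
  (* The remaining X is split into independent parts of sizes r (m - k.+1) and s; the small part is
     the one exchanged for Y. *)
  rewrite -(subnSK km) -rS.
  have conv := ge0_integral_gauss_conv (r (m - k.+1)%N) (ltW s0) (mphi k) (phi0 k).
  apply: (le_trans (eqle conv)).
  rewrite -(ge0_integralZl _ measurableT (mphis k.+1 (r (m - k.+1)%N))); last 2 first.
  - by move=> t _; exact: phi0.
  - by rewrite lee_fin expR_ge0.
  apply: ge0_le_integral; rewrite ?measurableT//.
  - by move=> t _; exact: integral_ge0.
  - have mc := measurableT_comp (mphi k) (@measurable_tuple_comb R N (r (m - k.+1)%N) s).
    exact: (@measurable_fun_fubini_tonelli_F _ _ _ _ R (G N) _ mc (fun=> phi0 _ _)).
  - exact: measurable_funeM.
  move=> t _.
  have [h1 h2] := stepF k (fun i => r (m - k.+1)%N * X i t).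
  under eq_integral => u _.
    rewrite /phi (_ : (fun i => X i [tuple r (m - k.+1)%N * tnth t j + s * tnth u j | j < N]) =
      fun i => r (m - k.+1)%N * X i t + s * X i u); last first.
      by apply/funext => i; rewrite lin_comb.
    over.
  rewrite -EFin_E// -EFinM lee_fin; apply: (le_trans h2).
  have xE : (fun i => X i [tuple r (m - k.+1)%N * tnth t j | j < N]) =
      fun i => r (m - k.+1)%N * X i t.
    by apply/funext => i; rewrite lin_scale.
  by rewrite xE; exact: expR_add3_le.
have e0 : (\int[G N]_t phi 0%N t = \int[G N]_t (expR (lam * softmax (fun i => X i t)))%:E)%E.
  apply: eq_integral => t _; rewrite /phi /F rz /avg_softmax; congr (expR (_ * _))%:E.
  under eq_Rintegral do under eq_fun do rewrite mul0r addr0.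
  by rewrite Ecst.
have em : (\int[G N]_t phi m [tuple r (m - m)%N * tnth t j | j < N]%R)%E =
    (expR (lam * \int[G N']_u softmax (fun i => Y i u)))%:E.
  rewrite -[RHS](integral_prob_cst (G N)); apply: eq_integral => t _.
  rewrite /phi /F rm /avg_softmax subnn rz; congr (expR (_ * _))%:E; apply: eq_Rintegral => u _.
  congr softmax; apply/funext => i.
  by rewrite lin_scale mul0r add0r mul1r.
apply: (le_trans (eqle e0)); apply: (le_trans (claim m (leqnn m))).
have c0 : (0 <= (expR (m%:R * eps))%:E)%E by rewrite lee_fin expR_ge0.
apply: (le_trans (lee_wpmul2l c0 (eqle (esym em)))).
rewrite -EFinM -expRD lee_fin ler_expR.
rewrite addrC -!addrA lerD2l /eps mulrDr.
rewrite (_ : m%:R * (lam ^+ 2 / 2 * s ^+ 2 * V) = lam ^+ 2 / 2 * V); last first.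
  by rewrite s2; field; rewrite gt_eqF.
rewrite lerD2l (_ : m%:R * (K * s ^+ 3) = K * s)//.
by rewrite exprSr s2; field; rewrite gt_eqF.
Qed.

End gaussian_comparison.

(** Read off from the integral as a supremum over simple functions, hence valid for functions not
    known to be measurable, such as the supremum in the Gaussian width. *)
Lemma ge0_le_integralT d (T : measurableType d) (R : realType)
    (mu : {measure set T -> \bar R}) (f g : T -> \bar R) :
  (forall x, 0 <= f x)%E -> (forall x, f x <= g x)%E ->
  (\int[mu]_x f x <= \int[mu]_x g x)%E.
Proof.
move=> f0 fg; rewrite !ge0_integralTE//; last by move=> x; exact: le_trans (fg x).
apply: ereal_sup_le => _ [h /= hf <-]; exists h => //= x.
exact: le_trans (hf x) (fg x).
Qed.

(** * Tail bound for the maximum of a finite Gaussian family *)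

Section gaussian_tail.
Context {R : realType} {I : finType} (i0 : I) {N N' : nat}.
Local Notation TR := (measurableTypeR R).
Local Notation G := (iid (gauss1 (1 : R))).
Local Notation igr P f := (P.-integrable setT (EFin \o f)).

Lemma lin_mul M (c : I -> 'I_M -> R) k i (t : M.-tuple TR) :
  lin (fun i j => k * c i j) i t = k * lin c i t.
Proof. by rewrite /lin mulr_sumr; apply: eq_bigr => j _; rewrite mulrA. Qed.

(* Scaling by beta turns softmax into a maximum up to ln #|I|; with beta large the
   total error is ln 2, which is the factor 2 of the bound. *)
Lemma gaussian_sup_tail (a : I -> 'I_N -> R) (b : I -> 'I_N' -> R)
    (S : N'.-tuple TR -> R) (w tau lam : R) :
  0 < lam -> (forall i, \sum_k a i k ^+ 2 <= 1) ->
  (forall i j, \sum_k (a i k - a j k) ^+ 2 <= \sum_k (b i k - b j k) ^+ 2) ->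
  igr (G N') S -> (forall i u, lin b i u <= S u) -> \int[G N']_u S u <= w ->
  measurable [set t | exists i, (tau < lin a i t)%R] /\
  (G N [set t | exists i, (tau < lin a i t)%R] <=
    (2 * expR (lam * (w - tau) + lam ^+ 2 / 2))%:E)%E.
Proof.
move=> lam0 aV ab IS bS Sw.
have mA : measurable [set t | exists i, (tau < lin a i t)%R].
  rewrite (_ : [set t | _] = \bigcup_(i in [set: I]) (lin a i @^-1` `]tau, +oo[)).
    apply: fin_bigcup_measurable; first exact: finite_finset.
    move=> i _; rewrite -[X in measurable X]setTI.
    exact: (measurable_lin_coord a i).
  apply/seteqP; split => t /=.
    by move=> [i ti]; exists i => //=; rewrite in_itv/= andbT.
  by move=> [i _]; rewrite /= in_itv/= andbT; exists i.
split=> //.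
pose c : R := ln #|I|%:R.
have c0 : 0 <= c.
  by apply: ln_ge0; rewrite ler1n; apply/card_gt0P; exists i0.
have ln20 : 0 < ln 2 :> R by rewrite ln_gt0// ltr1n.
(* Makes lam / beta times ln #|I| at most ln 2 / 2; the other half of ln 2 is eta. The summand 1
   keeps beta positive when I has one element. *)
pose beta := 2 * lam * (c + 1) / ln 2.
have beta0 : 0 < beta by rewrite divr_gt0// !mulr_gt0// ltr_wpDl.
have lbc : lam / beta * c <= ln 2 / 2.
  rewrite mulrAC ler_pdivrMr// /beta.
  have -> : ln 2 / 2 * (2 * lam * (c + 1) / ln 2) = lam * (c + 1) :> R.
    by field; rewrite gt_eqF.
  by rewrite ler_pM2l//; lra.
have lb0 : 0 <= lam / beta by rewrite divr_ge0// ltW.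
pose a' i k := beta * a i k; pose b' i k := beta * b i k.
have aV' i : \sum_k a' i k ^+ 2 <= beta ^+ 2.
  rewrite -[leRHS]mulr1 /a'; under eq_bigr do rewrite exprMn.
  by rewrite -mulr_sumr ler_wpM2l ?sqr_ge0.
have ab' i j : \sum_k (a' i k - a' j k) ^+ 2 <= \sum_k (b' i k - b' j k) ^+ 2.
  under eq_bigr do rewrite -mulrBr exprMn.
  under [leRHS]eq_bigr do rewrite -mulrBr exprMn.
  by rewrite -!mulr_sumr ler_wpM2l ?sqr_ge0.
have eta0 : 0 < ln 2 / 2 :> R by rewrite divr_gt0.
have := gaussian_softmax_comparison i0 lb0 aV' ab' eta0.
set sX := (\int[G N]_t _)%E; set sY := \int[G N']_u _ => h.
have sYle : sY <= c + beta * w.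
  apply: (@le_trans _ _ (\int[G N']_u (c + beta * S u))); last first.
    rewrite (ED (igr_cst (G N') c) (igrZ beta IS)) Ecst (EZ _ IS) lerD2l.
    by rewrite ler_wpM2l// ltW.
  apply: le_E.
  - have := @igr_softmax_shift R I _ _ (G N') i0 (fun=> 0) (lin b') (fun i => igr_gauss_lin (b' i)).
    by apply: eq_integrable => // t _ /=; congr (softmax _)%:E; apply/funext => i; rewrite add0r.
  - by apply: igrD; [exact: igr_cst|exact: igrZ].
  - move=> u; apply: softmax_le => // i.
    by rewrite lin_mul ler_wpM2l// ltW.
have markov : ((expR (lam * tau))%:E * G N [set t | exists i, (tau < lin a i t)%R] <= sX)%E.
  rewrite -integral_cst//.
  have f0 t : (0 <= (expR (lam / beta * softmax (fun i => lin a' i t)))%:E)%E.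
    by rewrite lee_fin expR_ge0.
  have mf : measurable_fun setT
      (fun t => (expR (lam / beta * softmax (fun i => lin a' i t)))%:E).
    apply/measurable_EFinP; apply: measurableT_comp => //; apply: measurable_funM => //.
    have := @measurable_softmax_shift R I _ _ (fun=> 0) (lin a') (measurable_lin_coord a').
    by apply: eq_measurable_fun => t _; congr softmax; apply/funext => i; rewrite add0r.
  apply: (@le_trans _ _ (\int[G N]_(t in [set t | exists i, (tau < lin a i t)%R])
      (expR (lam / beta * softmax (fun i => lin a' i t)))%:E)%E).
    apply: ge0_le_integral => //.
    - by move=> t _; rewrite lee_fin expR_ge0.
    - exact: measurable_funTS.
    - move=> t [i ti]; rewrite lee_fin ler_expR.
      apply: (@le_trans _ _ (lam / beta * lin a' i t)).
        rewrite lin_mul mulrA divfK ?gt_eqF// ler_pM2l// ltW//.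
      by rewrite ler_wpM2l// (softmax_ge (fun i => lin a' i t)).
  by apply: ge0_subset_integral.
have := le_trans markov h.
rewrite -lee_pdivlMl ?expR_gt0// => /le_trans; apply.
rewrite -EFinM lee_fin -expRN -expRD.
rewrite [X in _ <= X * _](_ : 2 = expR (ln 2)); last by rewrite lnK// posrE.
rewrite -expRD ler_expR.
have h1 := ler_wpM2l lb0 sYle.
have h2 : lam / beta * (c + beta * w) = lam / beta * c + lam * w.
  by field; rewrite gt_eqF.
have h3 : (lam / beta) ^+ 2 / 2 * beta ^+ 2 = lam ^+ 2 / 2 by field; rewrite gt_eqF.
rewrite h3; rewrite h2 in h1; move: h1 lbc; clear; lra.
Qed.

End gaussian_tail.

Lemma sum_mxvec (R : nmodType) m n (F : 'I_(m * n) -> R) :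
  \sum_k F k = \sum_i \sum_j F (mxvec_index i j).
Proof.
rewrite pair_big/= (reindex (uncurry (@mxvec_index m n))) /=.
  by apply: eq_bigr => -[i j] _.
exact: curry_mxvec_bij.
Qed.

Section l2.
Context {R : realType} {p : nat}.
Implicit Types u v x y : 'cV[R]_p.

Lemma sumsq_ge0 x : 0 <= \sum_i x i ord0 ^+ 2.
Proof. by apply: sumr_ge0 => i _; exact: sqr_ge0. Qed.

Lemma l2norm_ge0 x : 0 <= l2norm x.
Proof. exact: sqrtr_ge0. Qed.

Lemma l2norm_sqr x : l2norm x ^+ 2 = \sum_i x i ord0 ^+ 2.
Proof. by rewrite sqr_sqrtr// sumsq_ge0. Qed.

Lemma l2norm_eq0P x i : l2norm x = 0 -> x i ord0 = 0.
Proof.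
move=> x0; apply/eqP; rewrite -sqrf_eq0; apply/eqP/le_anti; rewrite sqr_ge0 andbT.
have <- : \sum_i x i ord0 ^+ 2 = 0 by rewrite -l2norm_sqr x0 expr0n.
by rewrite (bigD1 i)//= lerDl sumr_ge0// => j _; exact: sqr_ge0.
Qed.

Lemma inner_le x y : inner x y <= l2norm x * l2norm y.
Proof.
have [x0|x0] := eqVneq (l2norm x) 0.
  by rewrite x0 mul0r /inner big1// => i _; rewrite (l2norm_eq0P i x0) mul0r.
have [y0|y0] := eqVneq (l2norm y) 0.
  by rewrite y0 mulr0 /inner big1// => i _; rewrite (l2norm_eq0P i y0) mulr0.
have xp : 0 < l2norm x by rewrite lt_def x0 l2norm_ge0.
have yp : 0 < l2norm y by rewrite lt_def y0 l2norm_ge0.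
set a := l2norm x; set b := l2norm y.
have : 0 <= \sum_i (b * x i ord0 - a * y i ord0) ^+ 2.
  by apply: sumr_ge0 => i _; exact: sqr_ge0.
have -> : \sum_i (b * x i ord0 - a * y i ord0) ^+ 2 =
    \sum_i (b ^+ 2 * x i ord0 ^+ 2 - 2 * a * b * (x i ord0 * y i ord0) + a ^+ 2 * y i ord0 ^+ 2).
  by apply: eq_bigr => i _; ring.
rewrite big_split sumrB/= -!mulr_sumr -!l2norm_sqr -/a -/b -/(inner x y) => h.
have ab : 0 < 2 * (a * b) by rewrite mulr_gt0// mulr_gt0.
rewrite -(ler_pM2l ab); lra.
Qed.

Lemma measurable_l2norm : measurable_fun setT (@l2norm R p).
Proof.
have msqrt : measurable_fun [set: R] (Num.sqrt : R -> R).
  by apply: continuous_measurable_fun; exact: sqrt_continuous.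
apply: (measurableT_comp msqrt); apply: measurable_sum => i; apply: measurable_funX.
exact: measurable_entry.
Qed.

End l2.

(** * The design matrix on finitely many pairs (u, v) *)

Section design_tail.
Context {R : realType} {n p : nat} {L : finType} (l0 : L).
Local Notation TR := (measurableTypeR R).
Local Notation G := (iid (gauss1 (1 : R))).
Local Notation igr P f := (P.-integrable setT (EFin \o f)).
Variables (K : set 'cV[R]_p) (u : L -> 'cV[R]_n) (v : L -> 'cV[R]_p) (w : R).
Hypotheses (K0 : K 0) (KB : K `<=` l2ball) (vK : forall l, K (v l))
  (u1 : forall l, l2norm (u l) = 1) (Kw : gaussian_width K = w%:E) (n0 : (0 < n)%N).

(** Coefficients of <u, G v> as a linear form in the entries of G. Those of <g, v> + <h, u>, in the
    joint vector (g, h), are [b] below. *)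
Let a l (k : 'I_(n * p)) : R := mxvec (\matrix_(i, j) (u l i ord0 * v l j ord0)) 0 k.
Let b l (k : 'I_(p * 1 + n)) : R := row_mx (mxvec (v l)) (u l)^T 0 k.

Let sq_u l : \sum_i u l i ord0 ^+ 2 = 1.
Proof. by rewrite -l2norm_sqr u1 expr1n. Qed.

Let sq_v l : \sum_i v l i ord0 ^+ 2 <= 1.
Proof.
rewrite -l2norm_sqr expr_le1 ?l2norm_ge0//; exact: KB.
Qed.

Let a_sum l l' : \sum_k a l k * a l' k = inner (u l) (u l') * inner (v l) (v l').
Proof.
rewrite sum_mxvec /inner mulr_suml; apply: eq_bigr => i _.
rewrite mulr_sumr; apply: eq_bigr => j _; rewrite /a !mxvecE !mxE.
by rewrite mulrACA.
Qed.

Let b_sum l l' : \sum_k b l k * b l' k = inner (v l) (v l') + inner (u l) (u l').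
Proof.
rewrite big_split_ord/=; congr (_ + _).
  rewrite sum_mxvec; apply: eq_bigr => i _; rewrite big_ord1.
  by rewrite /b !row_mxEl !mxvecE.
by apply: eq_bigr => i _; rewrite /b !row_mxEr !mxE.
Qed.

Let a_norm l : \sum_k a l k ^+ 2 <= 1.
Proof.
rewrite (eq_bigr _ (fun k _ => expr2 _)) a_sum /inner.
rewrite (eq_bigr _ (fun k _ => esym (expr2 _))) sq_u mul1r.
by rewrite (eq_bigr _ (fun k _ => esym (expr2 _))).
Qed.

(* |u v^T - u' v'^T|^2 <= |u - u'|^2 + |v - v'|^2 reduces to
   0 <= (1 - <u, u'>) (1 - <v, v'>). *)
Let a_le_b l l' : \sum_k (a l k - a l' k) ^+ 2 <= \sum_k (b l k - b l' k) ^+ 2.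
Proof.
have e M (c c' : 'I_M -> R) : \sum_k (c k - c' k) ^+ 2 =
    \sum_k c k * c k - 2 * \sum_k c k * c' k + \sum_k c' k * c' k.
  rewrite mulr_sumr -sumrB -big_split/=; apply: eq_bigr => k _; ring.
have uu k : inner (u k) (u k) = 1.
  by rewrite -(sq_u k); apply: eq_bigr => i _; rewrite expr2.
(* As |u l| = 1, the squared norms of v l and v l' occur on both sides and cancel; they may be
   smaller than 1. *)
rewrite !e !a_sum !b_sum !uu !mul1r.
have hu : inner (u l) (u l') <= 1 by apply: (le_trans (inner_le _ _)); rewrite !u1 mulr1.
have hv : inner (v l) (v l') <= 1.
  apply: (le_trans (inner_le _ _)); rewrite -[leRHS]mulr1.
  by apply: ler_pM; rewrite ?l2norm_ge0//; exact: KB.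
have : 0 <= (1 - inner (u l) (u l')) * (1 - inner (v l) (v l')).
  by rewrite mulr_ge0// subr_ge0.
lra.
Qed.

(** The start value 0 of the maximum is the inner product with 0, a point of K, so [Sv] stays below
    the supremum over K. *)
Let Sv (g : 'cV[R]_p) := \big[Num.max/0]_(l : L) inner g (v l).
Let gpart (t : (p * 1 + n).-tuple TR) : 'cV[R]_p :=
  mx_of_tuple [tuple tnth t (lshift n k) | k < p * 1].
Let hpart (t : (p * 1 + n).-tuple TR) : 'cV[R]_n :=
  \col_i tnth t (rshift (p * 1) i).
Let S t := Sv (gpart t) + l2norm (hpart t).

Let measurable_inner d (T : measurableType d) m (f : T -> 'cV[R]_m) (z : 'cV[R]_m) :
  (forall i, measurable_fun setT (fun t => f t i ord0)) ->
  measurable_fun setT (fun t => inner (f t) z).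
Proof. by move=> mf; apply: measurable_sum => i; apply: measurable_funM. Qed.

Let measurable_Sv d (T : measurableType d) (f : T -> 'cV[R]_p) :
  (forall i, measurable_fun setT (fun t => f t i ord0)) ->
  measurable_fun setT (fun t => Sv (f t)).
Proof.
move=> mf; rewrite /Sv unlock.
elim: (index_enum L) => [|l s IH] /=; first exact: measurable_cst.
by apply: measurable_maxr => //; exact: measurable_inner.
Qed.

Let Sv_ge0 g : 0 <= Sv g.
Proof.
by rewrite /Sv; elim/big_rec: _ => // l x _ x0; rewrite le_max x0 orbT.
Qed.

Let Sv_ge g l : inner g (v l) <= Sv g.
Proof. by rewrite /Sv (bigD1 l)//= le_max lexx. Qed.

Let Sv_le g c : 0 <= c -> (forall l, inner g (v l) <= c) -> Sv g <= c.
Proof.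
by move=> c0 gc; rewrite /Sv; elim/big_rec: _ => // l x _ xc; rewrite ge_max gc.
Qed.

Let Sv_le_sup g : ((Sv g)%:E <= ereal_sup [set (inner g z)%:E | z in K])%E.
Proof.
apply: ereal_sup_ubound; have : exists2 z, K z & inner g z = Sv g.
  rewrite /Sv; elim/big_rec: _ => [|l x _ [z Kz <-]].
    by exists 0 => //; rewrite /inner big1// => i _; rewrite mxE mulr0.
  by rewrite /Num.max; case: ifP => _; [exists z|exists (v l)].
by move=> [z Kz <-]; exists z.
Qed.

Let lin_b l t : lin b l t = inner (gpart t) (v l) + inner (hpart t) (u l).
Proof.
rewrite /lin big_split_ord/=; congr (_ + _).
  rewrite sum_mxvec; apply: eq_bigr => i _; rewrite big_ord1.
  by rewrite /b row_mxEl mxvecE /gpart mxE tnth_mktuple mulrC.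
by apply: eq_bigr => i _; rewrite /b row_mxEr !mxE mulrC.
Qed.

Let lin_b_le l t : lin b l t <= S t.
Proof.
rewrite lin_b /S; apply: lerD; first exact: Sv_ge.
by apply: (le_trans (inner_le _ _)); rewrite u1 mulr1.
Qed.

Let mg i : measurable_fun setT (fun t => gpart t i ord0).
Proof.
rewrite (_ : (fun t => _) = fun t => tnth t (lshift n (mxvec_index i ord0))).
  exact: measurable_coord.
by apply/funext => t; rewrite mxE tnth_mktuple.
Qed.

Let mh i : measurable_fun setT (fun t => hpart t i ord0).
Proof.
rewrite (_ : (fun t => _) = fun t => tnth t (rshift (p * 1) i)).
  exact: measurable_coord.
by apply/funext => t; rewrite mxE.
Qed.

Let coord_lin M (k : 'I_M) (t : M.-tuple TR) : tnth t k = \sum_j (k == j)%:R * tnth t j.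
Proof.
rewrite (bigD1 k)//= eqxx mul1r big1 ?addr0// => j jk.
by rewrite eq_sym (negbTE jk) mul0r.
Qed.

Let igr_tnth M (k : 'I_M) : igr (G M) (fun t => tnth t k : R).
Proof.
have := igr_gauss_lin (fun j => (k == j)%:R : R).
by apply: eq_integrable => // t _ /=; rewrite -coord_lin.
Qed.

Let E_tnth_sqr M (k : 'I_M) : \int[G M]_t (tnth t k ^+ 2) <= 1.
Proof.
have := E_gauss_lin_sqr (fun j => (k == j)%:R : R).
under eq_Rintegral do rewrite -coord_lin.
move=> ->; rewrite (bigD1 k)//= eqxx expr1n big1 => [|j jk]; last first.
  by rewrite eq_sym (negbTE jk) expr0n.
by rewrite addr0 mul1r; have /andP[] := @E_gauss1_sqr_ge0_le1 R.
Qed.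

Let igr_tnth_sqr M (k : 'I_M) : igr (G M) (fun t => tnth t k ^+ 2).
Proof.
have I1 : igr (G M) (fun t => expR (\sum_(i < 1) `|\sum_j (k == j)%:R * tnth t j|)).
  have := @igr_gauss_exp_sum R M 'I_1 (fun=> fun j => (k == j)%:R) 1.
  by apply: eq_integrable => // t _ /=; rewrite mul1r.
have := @igr_sqr R _ _ _ (G M) (fun=> fun t => \sum_j (k == j)%:R * tnth t j)
  (fun=> measurable_lin _) I1 ord0.
by apply: eq_integrable => // t _ /=; rewrite -coord_lin.
Qed.

Let igr_Sv : igr (G (p * 1 + n)) (fun t => Sv (gpart t)).
Proof.
apply: (@igr_le _ _ _ (G (p * 1 + n)) _ (fun t => \sum_l `|inner (gpart t) (v l)|)).
- exact: measurable_Sv.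
- move=> t; rewrite ger0_norm ?Sv_ge0//.
  apply: Sv_le => [|l]; first exact: sumr_ge0.
  by rewrite (bigD1 l)//= -[leLHS]addr0; apply: lerD; [exact: ler_norm|exact: sumr_ge0].
- apply: igr_sum => l; apply: igr_norm; apply: igr_sum => i.
  have := igrZ (v l i ord0) (igr_tnth (lshift n (mxvec_index i (ord0 : 'I_1)))).
  by apply: eq_integrable => // t _ /=; rewrite mxE tnth_mktuple mulrC.
Qed.

Let igr_h2 : igr (G (p * 1 + n)) (fun t => l2norm (hpart t) ^+ 2).
Proof.
have := igr_sum (index_enum 'I_n) (fun i => igr_tnth_sqr (rshift (p * 1) i)).
apply: eq_integrable => // t _ /=; rewrite l2norm_sqr; congr EFin.
by apply: eq_bigr => i _; rewrite mxE.
Qed.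

Let sn : R := Num.sqrt n%:R.
Let sn0 : 0 < sn. Proof. by rewrite sqrtr_gt0 ltr0n. Qed.
Let sn2 : sn ^+ 2 = n%:R. Proof. by rewrite sqr_sqrtr. Qed.

(** AM-GM in place of Jensen: its mean turns E |h|^2 <= n into E |h| <= sqrt n, and it gives
    integrability as well. *)
Let h_le t : l2norm (hpart t) <= (2 * sn)^-1 * l2norm (hpart t) ^+ 2 + sn / 2.
Proof.
rewrite -(ler_pM2l (mulr_gt0 (ltr0n R 2) sn0)).
have -> : 2 * sn * ((2 * sn)^-1 * l2norm (hpart t) ^+ 2 + sn / 2) =
    l2norm (hpart t) ^+ 2 + sn ^+ 2 by field; rewrite gt_eqF.
by have := sqr_ge0 (l2norm (hpart t) - sn); lra.
Qed.

Let measurable_h : measurable_fun setT (fun t => l2norm (hpart t)).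
Proof.
apply: (measurableT_comp measurable_l2norm); apply: measurable_fun_mxP => i j.
by rewrite (ord1 j); exact: mh.
Qed.

Let igr_bound : igr (G (p * 1 + n))
  (fun t => (2 * sn)^-1 * l2norm (hpart t) ^+ 2 + sn / 2).
Proof. by apply: igrD; [exact: igrZ|exact: igr_cst]. Qed.

Let igr_h : igr (G (p * 1 + n)) (fun t => l2norm (hpart t)).
Proof.
by apply: igr_le measurable_h _ igr_bound => t; rewrite ger0_norm ?l2norm_ge0.
Qed.

Let E_h : \int[G (p * 1 + n)]_t l2norm (hpart t) <= sn.
Proof.
apply: (le_trans (le_E igr_h igr_bound h_le)).
rewrite (ED (igrZ _ igr_h2) (igr_cst _ (sn / 2))) Ecst (EZ _ igr_h2).
have : \int[G (p * 1 + n)]_t l2norm (hpart t) ^+ 2 <= n%:R.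
  under eq_Rintegral do rewrite l2norm_sqr.
  under eq_Rintegral do under eq_bigr do rewrite mxE.
  rewrite E_sum => [|i]; last exact: igr_tnth_sqr.
  apply: (@le_trans _ _ (\sum_(i < n) 1)); last by rewrite sumr_const card_ord.
  by apply: ler_sum => i _; exact: E_tnth_sqr.
have c0 : 0 <= (2 * sn)^-1 by rewrite invr_ge0 mulr_ge0// ltW.
move=> /(ler_wpM2l c0) h; rewrite -sn2 in h.
have e : (2 * sn)^-1 * sn ^+ 2 = sn / 2 by field; rewrite gt_eqF.
rewrite e in h; lra.
Qed.

Let E_Sv : \int[G (p * 1 + n)]_t Sv (gpart t) <= w.
Proof.
rewrite -lee_fin -Kw (EFin_E igr_Sv).
have mS : measurable_fun setT (fun t : (p * 1).-tuple TR => (Sv (mx_of_tuple t))%:E).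
  apply/measurable_EFinP; apply: measurable_Sv => i.
  rewrite (_ : (fun t => _) = fun t => tnth t (mxvec_index i ord0)).
    exact: measurable_coord.
  by apply/funext => t; rewrite mxE.
have S0 (t : (p * 1).-tuple TR) : (0 <= (Sv (mx_of_tuple t))%:E)%E by rewrite lee_fin.
have := ge0_integral_iid_lshift (gauss1 1) n mS S0.
move=> e; apply: (@le_trans _ _ (\int[gauss_mx p 1 1]_g (Sv g)%:E)%E).
  apply: (@le_trans _ _ (\int[G (p * 1)%N]_t (Sv (mx_of_tuple t))%:E)%E).
    by rewrite -e.
  rewrite ge0_integral_distribution//.
  by apply/measurable_EFinP; apply: measurable_Sv => i; exact: measurable_entry.
by apply: ge0_le_integralT => g; [rewrite lee_fin|exact: Sv_le_sup].
Qed.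

Let mx_lin l (t : (n * p).-tuple TR) (s : R) :
  inner (u l) (mx_of_tuple [tuple s * tnth t k | k < (n * p)%N] *m v l) = s * lin a l t.
Proof.
rewrite /lin sum_mxvec /inner mulr_sumr; apply: eq_bigr => i _.
rewrite mxE !mulr_sumr; apply: eq_bigr => j _.
by rewrite mxE tnth_mktuple /a mxvecE mxE; ring.
Qed.

(** The design is a standard Gaussian matrix divided by sqrt n, so tau becomes tau sqrt n; the
    comparison process is at most [S], of mean at most w + sqrt n. *)
Lemma design_sup_tail (tau lam : R) : 0 < lam ->
  measurable [set x : 'M[R]_(n, p) | exists l, (tau < inner (u l) (x *m v l))%R] /\
  (design_law n p [set x : 'M[R]_(n, p) | exists l, (tau < inner (u l) (x *m v l))%R] <=
   (2 * expR (lam * (w + Num.sqrt n%:R - tau * Num.sqrt n%:R) + lam ^+ 2 / 2))%:E)%E.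
Proof.
move=> lam0; set A := [set x | _].
have mA : measurable A.
  rewrite (_ : A = \bigcup_(l in [set: L])
      ((fun x : 'M[R]_(n, p) => inner (u l) (x *m v l)) @^-1` `]tau, +oo[)).
    apply: fin_bigcup_measurable; first exact: finite_finset.
    move=> l _; rewrite -[X in measurable X]setTI.
    have mi : measurable_fun setT (fun x : 'M[R]_(n, p) => inner (u l) (x *m v l)).
      apply: measurable_sum => i; apply: measurable_funM => //.
      rewrite (_ : (fun x => _) = fun x : 'M[R]_(n, p) => \sum_k x i k * v l k ord0).
        apply: measurable_sum => k; apply: measurable_funM => //.
        exact: measurable_entry.
      by apply/funext => x; rewrite mxE.
    exact: mi.
  apply/seteqP; split => x /=.
    by move=> [l xl]; exists l => //=; rewrite in_itv/= andbT.
  by move=> [l _]; rewrite /= in_itv/= andbT; exists l.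
split=> //.
have IS : igr (G (p * 1 + n)) S by exact: igrD.
have ES : \int[G (p * 1 + n)]_t S t <= w + sn.
  by rewrite /S (ED igr_Sv igr_h); apply: lerD.
have [mB] := @gaussian_sup_tail R L l0 _ _ a b S (w + sn) (tau * sn) lam lam0
  a_norm a_le_b IS lin_b_le ES.
set B := [set t | _] in mB *.
apply: le_trans.
have mM : measurable_fun setT (@mx_of_tuple R n p) := measurable_funPT _.
have s0 : 0 <= sn^-1 by rewrite invr_ge0 ltW.
have mscale : measurable_fun setT
    (fun t : (n * p).-tuple TR => [tuple (sn^-1 * tnth t i)%R | i < (n * p)%N]).
  apply: measurable_mktuple => i; apply: measurable_funM => //; exact: measurable_coord.
pose C := @mx_of_tuple R n p @^-1` A.
have mC : measurable C by rewrite -[C]setTI; exact: mM.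
have mI : measurable_fun setT (fun t : (n * p).-tuple TR => (\1_C t : R)%:E).
  by apply/measurable_EFinP; exact: measurable_indic.
have I0 (t : (n * p).-tuple TR) : (0 <= (\1_C t : R)%:E)%E by rewrite lee_fin.
have e1 := ge0_integral_gauss_scale s0 mI I0.
have -> : design_law n p A = iid (gauss1 sn^-1) (n * p) C by [].
have e2 : (\int[iid (gauss1 sn^-1) (n * p)]_t (\1_C t)%:E = iid (gauss1 sn^-1) (n * p) C)%E.
  apply: (eq_trans (integral_indic _ measurableT mC)); congr (iid _ _ _); exact: setIT.
have e3 : (\int[G (n * p)%N]_t (\1_C [tuple (sn^-1 * tnth t i)%R | i < (n * p)%N])%:E =
    \int[G (n * p)%N]_t (\1_B t)%:E)%E.
  apply: eq_integral => t _; congr (_%:E); rewrite /indic; congr ((_ : bool)%:R).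
  apply/idP/idP; rewrite !inE /C /A /B /=; move=> [l hl]; exists l; move: hl;
    by rewrite mx_lin [sn^-1 * _]mulrC ltr_pdivlMr.
have e4 : (\int[G (n * p)%N]_t (\1_B t)%:E = G (n * p)%N B)%E.
  apply: (eq_trans (integral_indic _ measurableT mB)); congr (iid _ _ _); exact: setIT.
rewrite -e2 (eq_trans e1 (eq_trans e3 e4)); exact: lexx.
Qed.

End design_tail.

(** * From finite families to all of K *)

Section dense.
Context {R : realType} {m : nat}.

(** For each rational point q and precision 1 / (j + 1), choose a point of A that near to q if one
    exists and a0 otherwise; the pairs (q, j) are enumerated by [pickle]. *)
Lemma countable_dense_subset (A : set 'cV[R]_m) : A !=set0 ->
  exists d : nat -> 'cV[R]_m, (forall k, A (d k)) /\
    forall x, A x -> forall e : R, 0 < e ->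
      exists k, forall i, `|d k i ord0 - x i ord0| < e.
Proof.
move=> [a0 Aa0].
pose near_ (q : 'cV[rat]_m) (j : nat) (y : 'cV[R]_m) :=
  A y /\ forall i, `|y i ord0 - ratr (q i ord0)| < j.+1%:R^-1.
pose pt (qj : 'cV[rat]_m * nat) : 'cV[R]_m :=
  match pselect (exists y, near_ qj.1 qj.2 y) with
  | left h => sval (cid h) | right _ => a0 end.
have ptA qj : A (pt qj).
  by rewrite /pt; case: pselect => // h; case: cid => y [].
exists (fun k => if @choice.unpickle ('cV[rat]_m * nat)%type k is Some qj then pt qj else a0).
split=> [k|x Ax e e0]; first by case: choice.unpickle.
(* Both x and the chosen point are within 1 / (j + 1) of q, so 2 / (j + 1) < e is wanted. *)
pose j := Num.truncn (2 / e).
have j2 : 2 / e < j.+1%:R by exact: truncnS_gt.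
have j0 : 0 < j.+1%:R^-1 :> R by rewrite invr_gt0 ltr0n.
have je : 2 * j.+1%:R^-1 < e.
  by rewrite ltr_pdivrMr ?ltr0n// mulrC -ltr_pdivrMr.
have qx i : exists q : rat, `|x i ord0 - ratr q| < j.+1%:R^-1.
  move: j0; set r : R := j.+1%:R^-1 => r0.
  have lt_r : x i ord0 - r < x i ord0 + r by lra.
  have [q] := rat_in_itvoo lt_r.
  by rewrite in_itv/= => /andP[q1 q2]; exists q; rewrite ltr_norml; lra.
pose q : 'cV[rat]_m := \col_i sval (cid (qx i)).
have qxn i : `|x i ord0 - ratr (q i ord0)| < j.+1%:R^-1.
  by rewrite mxE; case: cid.
have near_x : exists y, near_ q j y by exists x.
exists (choice.pickle (q, j)) => i; rewrite choice.pickleK /pt.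
case: pselect => // h; case: cid => y [Ay yq] /=.
have := yq i; have := qxn i; move: je; set r : R := j.+1%:R^-1.
by rewrite !ltr_norml; lra.
Qed.

End dense.

Section good_event.
Context {R : realType} {n p : nat}.
Variables (K : set 'cV[R]_p) (w c delta : R).
Hypotheses (K0 : K 0) (KB : K `<=` l2ball) (Kw : gaussian_width K = w%:E)
  (n0 : (0 < n)%N) (w0 : 0 <= w) (c0 : 0 < c) (delta0 : 0 < delta)
  (hn : 2 * (w + delta) <= c * Num.sqrt n%:R).

Let inner_approx (x : 'M[R]_(n, p)) (u u' : 'cV[R]_n) (v v' : 'cV[R]_p) (e : R) :
  0 <= e -> (forall i, `|u' i ord0 - u i ord0| <= e) -> (forall i, `|v' i ord0 - v i ord0| <= e) ->
  (forall i, `|u' i ord0| <= 1) ->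
  inner u (x *m v) <= inner u' (x *m v') +
    e * (\sum_i `|(x *m v) i ord0| + \sum_i \sum_j `|x i j|).
Proof.
move=> e0 ue ve u1.
have -> : inner u (x *m v) = inner u' (x *m v') - \sum_i (u' i ord0 - u i ord0) * (x *m v) i ord0
    - \sum_i u' i ord0 * \sum_j x i j * (v' j ord0 - v j ord0).
  rewrite /inner -!sumrB; apply: eq_bigr => i _.
  have -> : \sum_j x i j * (v' j ord0 - v j ord0) = (x *m v') i ord0 - (x *m v) i ord0.
    by rewrite !mxE -sumrB; apply: eq_bigr => j _; rewrite mulrBr.
  ring.
have A1 : `|\sum_i (u' i ord0 - u i ord0) * (x *m v) i ord0| <=
    e * \sum_i `|(x *m v) i ord0|.
  apply: (le_trans (ler_norm_sum _ _ _)); rewrite mulr_sumr; apply: ler_sum => i _.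
  by rewrite normrM ler_wpM2r.
have A2 : `|\sum_i u' i ord0 * \sum_j x i j * (v' j ord0 - v j ord0)| <=
    e * \sum_i \sum_j `|x i j|.
  apply: (le_trans (ler_norm_sum _ _ _)); rewrite mulr_sumr; apply: ler_sum => i _.
  rewrite normrM -[leRHS]mul1r; apply: ler_pM => //.
  apply: (le_trans (ler_norm_sum _ _ _)); rewrite mulr_sumr; apply: ler_sum => j _.
  by rewrite normrM mulrC ler_wpM2r.
move: A1 A2; rewrite mulrDr !ler_norml; lra.
Qed.

(** |X v| > 1 + c means <u, X v> > 1 + c for some unit vector u, and the strict inequality persists
    for nearby members of the dense sequences. The bad events of the first N + 1 members increase
    with N and share one bound, which their union inherits. *)
Lemma good_event : prob_ge (design_law n p)
  [set x : 'M[R]_(n, p) | forall v, K v -> l2norm (x *m v) <= 1 + c]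
  (1 - 2 * expR (- (delta ^+ 2 / 2))).
Proof.
have [dv [dvK dvd]] := countable_dense_subset (ex_intro _ 0 K0 : K !=set0).
pose sph : set 'cV[R]_n := [set u | l2norm u = 1].
have sph0 : sph !=set0.
  exists (\col_i (i == Ordinal n0)%:R); rewrite /sph/= /l2norm.
  rewrite (bigD1 (Ordinal n0))//= big1 => [|i /negbTE i0]; last by rewrite mxE i0 expr0n.
  by rewrite mxE eqxx expr1n addr0 sqrtr1.
have [du [duS dud]] := countable_dense_subset sph0.
pose bad N : set 'M[R]_(n, p) := [set x | exists kl : 'I_N.+1 * 'I_N.+1,
  1 + c < inner (du kl.1) (x *m dv kl.2)].
have badP N : measurable (bad N) /\
    (design_law n p (bad N) <= (2 * expR (- (delta ^+ 2 / 2)))%:E)%E.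
  have d2 : 0 < 2 * delta by rewrite mulr_gt0.
  have [mb Pb] := @design_sup_tail R n p ('I_N.+1 * 'I_N.+1)%type (ord0, ord0) K
    (fun kl => du kl.1) (fun kl => dv kl.2) w K0 KB (fun kl => dvK kl.2) (fun kl => duS kl.1)
    Kw n0 (1 + c) (2 * delta) d2.
  split=> //; apply: (le_trans Pb); rewrite lee_fin ler_pM2l// ler_expR.
  (* The exponent 2 delta (w - c sqrt n) + 2 delta^2 is at most - 2 delta w - 2 delta^2, since c
     sqrt n >= 2 (w + delta). *)
  have h1 : 2 * delta * (2 * (w + delta)) <= 2 * delta * (c * Num.sqrt n%:R).
    by rewrite ler_pM2l.
  have h2 : 0 <= delta * w by rewrite mulr_ge0// ltW.
  have h3 := sqr_ge0 delta.
  by move: h1 h2 h3; lra.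
pose B := \bigcup_N bad N.
have mB : measurable B by apply: bigcup_measurable => N _; exact: (badP N).1.
have ndb : nondecreasing_seq bad.
  move=> N M NM; rewrite /bad; apply/subsetPset => x /= [[k l] kl].
  by exists (widen_ord (NM : N.+1 <= M.+1)%N k, widen_ord (NM : N.+1 <= M.+1)%N l).
have PB : (design_law n p B <= (2 * expR (- (delta ^+ 2 / 2)))%:E)%E.
  have := nondecreasing_cvg_mu (mu := design_law n p) (fun N => (badP N).1) mB ndb.
  move=> cv; rewrite -(cvg_lim _ cv)//; apply: lime_le; first by apply/cvg_ex; eexists; exact: cv.
  by apply: nearW => N; exact: (badP N).2.
exists (~` B); split.
- exact: measurableC.
- move=> x nB v Kv /=; rewrite leNgt; apply/negP => xv; apply: nB.
  set y := x *m v in xv.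
  pose r := l2norm y.
  have r0 : 0 < r by apply: lt_trans xv; rewrite addr_gt0.
  pose u : 'cV[R]_n := r^-1 *: y.
  have uS : sph u.
    rewrite /sph/= /l2norm; under eq_bigr do rewrite mxE exprMn.
    rewrite -mulr_sumr -l2norm_sqr -/r sqrtrM ?sqr_ge0// !sqrtr_sqr.
    by rewrite !gtr0_norm ?invr_gt0// mulVf// gt_eqF.
  have uy : inner u y = r.
    rewrite /inner; under eq_bigr do rewrite mxE -mulrA -expr2.
    by rewrite -mulr_sumr -l2norm_sqr -/r expr2 mulKf// gt_eqF.
  pose Q := \sum_i `|y i ord0| + \sum_i \sum_j `|x i j|.
  have Q0 : 0 <= Q.
    by rewrite addr_ge0 ?sumr_ge0// => i _; rewrite sumr_ge0.
  (* The approximation error e Q must be strictly below the excess r - (1 + c). *)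
  pose e := (r - (1 + c)) / (Q + 1).
  have Q1 : 0 < Q + 1 by rewrite ltr_wpDl.
  have e0 : 0 < e by rewrite divr_gt0// subr_gt0.
  have [k kv] := dvd v Kv e e0.
  have [l lu] := dud u uS e e0.
  pose N := maxn k l.
  have kN : (k < N.+1)%N by rewrite ltnS leq_maxl.
  have lN : (l < N.+1)%N by rewrite ltnS leq_maxr.
  exists N => //; exists (Ordinal lN, Ordinal kN) => /=.
  have dl1 i : `|du l i ord0| <= 1.
    have : du l i ord0 ^+ 2 <= 1.
      have := l2norm_sqr (du l); rewrite (duS l) expr1n => ->.
      by rewrite (bigD1 i)//= lerDl sumr_ge0// => j _; exact: sqr_ge0.
    by rewrite -real_normK ?num_real// expr_le1.
  have := @inner_approx x u (du l) v (dv k) e (ltW e0) (fun i => ltW (lu i)) (fun i => ltW (kv i)) dl1.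
  rewrite -/y -/Q uy => h.
  have eQ : e * Q < r - (1 + c).
    have e1 : e * (Q + 1) = r - (1 + c) by rewrite /e divfK// gt_eqF.
    by move: e1 e0; lra.
  by move: h eQ; lra.
- rewrite probability_setC//.
  have fin : design_law n p B \is a fin_num by exact: fin_num_measure.
  move: PB; rewrite -(fineK fin) lee_fin => h.
  by rewrite -EFinB lee_fin; move: h; lra.
Qed.

End good_event.

Section l2_triangle.
Context {R : realType} {p : nat}.
Implicit Types x y : 'cV[R]_p.

Lemma l2normN x : l2norm (- x) = l2norm x.
Proof. by congr Num.sqrt; apply: eq_bigr => i _; rewrite mxE sqrrN. Qed.

Lemma l2normZ (a : R) x : l2norm (a *: x) = `|a| * l2norm x.
Proof.
rewrite /l2norm; under eq_bigr do rewrite mxE exprMn.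
by rewrite -mulr_sumr sqrtrM ?sqr_ge0// sqrtr_sqr.
Qed.

Lemma l2normD x y : l2norm (x + y) <= l2norm x + l2norm y.
Proof.
rewrite -(@ler_pXn2r _ 2)// ?nnegrE ?addr_ge0 ?l2norm_ge0//.
have -> : l2norm (x + y) ^+ 2 = l2norm x ^+ 2 + 2 * inner x y + l2norm y ^+ 2.
  rewrite !l2norm_sqr /inner mulr_sumr -!big_split/=; apply: eq_bigr => i _.
  by rewrite mxE; ring.
have := inner_le x y; lra.
Qed.

Lemma l2normB_lt_neq x y z (e : R) : l2norm (z - x) < e -> l2norm (z - y) < e ->
  l2norm (x - y) < 2 * e.
Proof.
move=> zx zy; have -> : x - y = (- (z - x)) + (z - y) by rewrite opprB addrA subrK.
by apply: (le_lt_trans (l2normD _ _)); rewrite l2normN; lra.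
Qed.

End l2_triangle.

(** * Testing between shifted Gaussian noises *)

Section cameron_martin.
Context {R : realType} {n : nat}.
Local Notation TR := (measurableTypeR R).

Lemma measurable_addl_mx (mu : 'cV[R]_n) : measurable_fun setT (fun z : 'cV[R]_n => mu + z).
Proof.
apply: measurable_fun_mxP => i j.
rewrite (_ : (fun z => _) = fun z : 'cV[R]_n => mu i j + z i j); last first.
  by apply/funext => z; rewrite mxE.
by apply: measurable_funD => //; exact: measurable_entry.
Qed.

(* Cameron-Martin and AM-GM: 1_B L <= (tau L^2 + 1_B / tau) / 2, with
   E L^2 = exp (|mu|^2 / s^2). *)
Lemma gauss_mx_shift_le (s tau : R) (mu : 'cV[R]_n) (B : set 'cV[R]_n) :
  s != 0 -> 0 < tau -> measurable B ->
  (gauss_mx n 1 s [set z | B (mu + z)%R] <=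
   (2^-1 * (tau * expR (l2norm mu ^+ 2 / s ^+ 2)))%:E +
   ((2 * tau)^-1)%:E * gauss_mx n 1 s B)%E.
Proof.
move=> s0 tau0 mB.
pose N := (n * 1)%N.
pose P := iid (gauss1 s) N.
pose m k : R := mxvec mu 0 k.
pose C : set (N.-tuple TR) := @mx_of_tuple R n 1 @^-1` B.
have mC : measurable C by rewrite -[C]setTI; exact: (measurable_funPT (@mx_of_tuple R n 1)).
pose e (c : 'I_N -> R) (t : N.-tuple TR) : R :=
  expR (\sum_i (c i * tnth t i / s ^+ 2 - c i ^+ 2 / (s ^+ 2 *+ 2))).
have me c : measurable_fun setT (e c).
  apply: measurableT_comp => //; apply: measurable_sum => i; apply: measurable_funB => //.
  by apply: measurable_funM => //; apply: measurable_funM => //; exact: measurable_coord.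
have e0 c t : 0 <= e c t by exact: expR_ge0.
have mI : measurable_fun setT (fun t : N.-tuple TR => (\1_C t : R)%:E).
  by apply/measurable_EFinP; exact: measurable_indic.
have I0 (t : N.-tuple TR) : (0 <= (\1_C t : R)%:E)%E by rewrite lee_fin.
have shiftC := ge0_integral_gauss_shift m s0 mI I0.
pose D : set (N.-tuple TR) := [set t | C [tuple tnth t i + m i | i < N]].
have mshift : measurable_fun setT (fun t : N.-tuple TR => [tuple tnth t i + m i | i < N]).
  by apply: measurable_mktuple => i; apply: measurable_funD => //; exact: measurable_coord.
have mD : measurable D by rewrite -[D]setTI; exact: mshift.
have DE : gauss_mx n 1 s [set z | B (mu + z)] = P D.
  rewrite /gauss_mx /distribution /pushforward; congr (P _).
  apply/seteqP; split => t /=; rewrite /D /C /=.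
    suff -> : mx_of_tuple [tuple tnth t i + m i | i < N] = mu + mx_of_tuple t by [].
    apply/matrixP => i j; rewrite !mxE tnth_mktuple /m mxvecE addrC.
    by [].
  suff -> : mx_of_tuple [tuple tnth t i + m i | i < N] = mu + mx_of_tuple t by [].
  apply/matrixP => i j; rewrite !mxE tnth_mktuple /m mxvecE addrC.
  by [].
have intI (A : set (N.-tuple TR)) : measurable A -> (\int[P]_t (\1_A t)%:E = P A)%E.
  move=> mA; apply: (eq_trans (integral_indic _ measurableT mA)); congr (P _).
  exact: setIT.
have CE : gauss_mx n 1 s B = P C by [].
(* e (2 m) is the density of the shift by 2 m, so it has mass 1; by [eL] below, the squared
   likelihood ratio is exp (|mu|^2 / s^2) times it. *)
have e1 : (\int[P]_t (e (fun i => 2 * m i)%R t)%:E = 1)%E.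
  have := ge0_integral_gauss_shift (fun i => 2 * m i) s0 (measurable_cst 1%E) (fun=> lee01).
  rewrite integral_prob_cst => ->.
  by apply: eq_integral => t _; rewrite mul1e.
have eL t : e m t ^+ 2 = expR (l2norm mu ^+ 2 / s ^+ 2) * e (fun i => 2 * m i) t.
  rewrite /e expr2 -!expRD; congr expR.
  have -> : l2norm mu ^+ 2 = \sum_k m k ^+ 2.
    rewrite l2norm_sqr sum_mxvec; apply: eq_bigr => i _; rewrite big_ord1.
    by rewrite /m mxvecE.
  rewrite mulr_suml -!big_split/=; apply: eq_bigr => i _.
  by field.
have pw t : \1_C t * e m t <= 2^-1 * (tau * expR (l2norm mu ^+ 2 / s ^+ 2)) *
    e (fun i => 2 * m i) t + (2 * tau)^-1 * \1_C t.
  have -> : 2^-1 * (tau * expR (l2norm mu ^+ 2 / s ^+ 2)) * e (fun i => 2 * m i) t =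
      2^-1 * (tau * e m t ^+ 2) by rewrite eL; ring.
  have key : e m t <= 2^-1 * (tau * e m t ^+ 2) + (2 * tau)^-1.
    have h := sqr_ge0 (tau * e m t - 1).
    rewrite -(ler_pM2l (mulr_gt0 (ltr0n R 2) tau0)).
    have -> : 2 * tau * (2^-1 * (tau * e m t ^+ 2) + (2 * tau)^-1) = (tau * e m t) ^+ 2 + 1.
      by field; rewrite gt_eqF.
    by move: h; lra.
  rewrite indicE; case: (_ \in _) => /=.
    by rewrite mul1r mulr1.
  by rewrite mul0r mulr0 addr0 mulr_ge0// mulr_ge0 ?sqr_ge0// ltW.
rewrite DE CE -(intI D mD).
have -> : (\int[P]_t (\1_D t)%:E = \int[P]_t (\1_C t * e m t)%:E)%E.
  apply: (eq_trans _ (eq_trans shiftC _)).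
    by apply: eq_integral => t _; congr (_%:E); rewrite !indicE;
      congr (nat_of_bool _)%:R; apply/idP/idP; rewrite !inE.
  by apply: eq_integral => t _; rewrite EFinM.
rewrite -(intI C mC).
have c0 : (0 <= (2^-1 * (tau * expR (l2norm mu ^+ 2 / s ^+ 2)))%:E)%E.
  by rewrite lee_fin mulr_ge0// mulr_ge0 ?expR_ge0// ltW.
have c1 : (0 <= ((2 * tau)^-1)%:E)%E by rewrite lee_fin invr_ge0 mulr_ge0// ltW.
have me2 : measurable_fun setT (fun t => (e (fun i => 2 * m i) t)%:E).
  exact/measurable_EFinP.
rewrite -[X in (X + _)%E]mule1 -e1 -(ge0_integralZl P measurableT me2); last 2 first.
- by move=> t _; rewrite lee_fin.
- exact: c0.
rewrite -(ge0_integralZl P measurableT mI); last 2 first.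
- by move=> t _; exact: I0.
- exact: c1.
rewrite -ge0_integralD//; last 4 first.
- by move=> t _; rewrite mule_ge0// lee_fin.
- exact: measurable_funeM.
- by move=> t _; rewrite mule_ge0.
- exact: measurable_funeM.
apply: ge0_le_integralT => t; first by rewrite lee_fin mulr_ge0.
by rewrite -!EFinM -EFinD lee_fin; exact: pw.
Qed.

End cameron_martin.

(** * Risk lower bound from separated hypotheses *)

Section fano_risk.
Context {R : realType} {n p : nat}.

Let measurable_err (Mhat : @estimator R n p) (x : 'M[R]_(n, p)) (M : 'cV[R]_p) :
  measurable_fun setT (fun y : 'cV[R]_n => l2norm (Mhat (x, y) - M)).
Proof.
suff mM : measurable_fun setT (fun y : 'cV[R]_n => (Mhat (x, y) - M)%R : 'cV[R]_p).
  exact: (measurableT_comp measurable_l2norm mM).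
apply: measurable_fun_mxP => i j.
rewrite (_ : (fun y => _) = fun y => Mhat (x, y) i j - M i j); last first.
  by apply/funext => y; rewrite !mxE.
apply: measurable_funB => //; apply: (measurableT_comp (measurable_entry i j)).
exact: (measurable_fun_pair2 x (measurable_funPT Mhat)).
Qed.

(* The balls B_i around the hypotheses are disjoint, so the success probabilities
   under pure noise sum to at most 1. With tau = k^(-3/4) the success probabilities
   under the hypotheses then average to at most k^(-1/4) <= 7/8. *)
Lemma fano_risk (x : 'M[R]_(n, p)) (sigma : R) (Mhat : @estimator R n p) k
    (M : 'I_k -> 'cV[R]_p) (rho : R) :
  sigma / Num.sqrt n%:R != 0 -> (2 <= k)%N -> 0 < rho ->
  (forall i j, i != j -> 2 * rho <= l2norm (M i - M j)) ->
  (forall i, expR (l2norm (x *m M i) ^+ 2 / (sigma / Num.sqrt n%:R) ^+ 2) <=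
    Num.sqrt k%:R) ->
  exists i, ((rho ^+ 2 / 8)%:E <= cond_risk sigma Mhat (M i) x)%E.
Proof.
move=> s0 k2 rho0 Msep Mexp.
set s := sigma / Num.sqrt n%:R in s0 Mexp.
pose P := noise_law n sigma.
pose B i : set 'cV[R]_n := [set y | l2norm (Mhat (x, y) - M i) < rho].
have mB i : measurable (B i).
  rewrite (_ : B i = (fun y => l2norm (Mhat (x, y) - M i)) @^-1` `]-oo, rho[); last first.
    by apply/seteqP; split => y; rewrite /B/= in_itv.
  by rewrite -[X in measurable X]setTI; exact: measurable_err.
pose A i : set 'cV[R]_n := [set z | B i (x *m M i + z)].
have mA i : measurable (A i).
  by rewrite -[A i]setTI; exact: (measurable_addl_mx (x *m M i)).
have tB : trivIset setT B.
  move=> i j _ _ [y [yi yj]]; apply/eqP; apply: contraT => ij.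
  have := Msep i j ij; rewrite leNgt.
  by rewrite (l2normB_lt_neq yi yj).
have fB i : P (B i) \is a fin_num by exact: fin_num_measure.
have fA i : P (A i) \is a fin_num by exact: fin_num_measure.
have sB : \sum_i fine (P (B i)) <= 1.
  rewrite -lee_fin -sumEFin; under eq_bigr do rewrite fineK//.
  have mU : measurable (\big[setU/set0]_(i < k) B i) by exact: bigsetU_measurable.
  rewrite -(measure_semi_additive_ord P mB tB mU).
  by have := probability_le1 P mU.
pose q : R := Num.sqrt (Num.sqrt k%:R).
have k0 : 0 < k%:R :> R by rewrite ltr0n; exact: leq_trans k2.
have q0 : 0 < q by rewrite !sqrtr_gt0.
have q2 : q ^+ 2 = Num.sqrt k%:R by rewrite sqr_sqrtr// sqrtr_ge0.
have q4 : q ^+ 4 = k%:R by rewrite (exprM q 2 2) q2 sqr_sqrtr// ltW.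
(* (8/7)^4 = 4096/2401 < 2 <= k = q^4. *)
have q87 : 8 / 7 <= q.
  rewrite leNgt; apply/negP => q8.
  have : q ^+ 4 < (8 / 7) ^+ 4 by rewrite ltrXn2r// ?nnegrE ltW.
  have : (2 : R) <= k%:R by rewrite ler_nat.
  rewrite q4 => h1 h2; have := le_lt_trans h1 h2; lra.
(* Balances the two terms of the summed bound: k tau q^2 / 2 and 1 / (2 tau) both equal q^3 / 2. *)
pose tau := (q ^+ 3)^-1.
have tau0 : 0 < tau by rewrite invr_gt0 exprn_gt0.
have Ai i : fine (P (A i)) <= 2^-1 * (tau * q ^+ 2) + (2 * tau)^-1 * fine (P (B i)).
  have := gauss_mx_shift_le (x *m M i) s0 tau0 (mB i).
  rewrite -[X in (X <= _)%E -> _]/(P (A i)) -[X in (_ + _ * X)%E]/(P (B i)).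
  rewrite -(fineK (fA i)) -(fineK (fB i)) -EFinM -EFinD lee_fin => h.
  apply: (le_trans h); rewrite lerD2r ler_wpM2l ?invr_ge0// ler_wpM2l ?(ltW tau0)// q2.
  exact: Mexp.
have sA : \sum_i fine (P (A i)) <= 7 / 8 * k%:R.
  apply: (@le_trans _ _ (k%:R * (2^-1 * (tau * q ^+ 2)) + (2 * tau)^-1 * 1)).
    apply: (le_trans (ler_sum _ (fun i _ => Ai i))).
    rewrite big_split/= sumr_const card_ord -[X in X + _ <= _]mulr_natl lerD2l -mulr_sumr.
    by apply: ler_wpM2l => //; rewrite invr_ge0 mulr_ge0// ltW.
  have -> : k%:R * (2^-1 * (tau * q ^+ 2)) + (2 * tau)^-1 * 1 = q ^+ 3.
    by rewrite -q4 /tau; field; rewrite gt_eqF.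
  rewrite -q4 (_ : 7 / 8 * q ^+ 4 = (7 / 8 * q) * q ^+ 3); last by ring.
  rewrite -[leLHS]mul1r ler_pM2r ?exprn_gt0//.
  by move: q87; lra.
have [i Pi] : exists i, fine (P (A i)) <= 7 / 8.
  apply: contrapT => /forallNP no.
  have : 7 / 8 * k%:R < \sum_i fine (P (A i)); last by rewrite ltNge sA.
  rewrite mulrC -[X in X%:R]card_ord -sum1_card natr_sum mulr_suml.
  have i0 : 'I_k by exact: Ordinal (leq_trans (isT : (0 < 2)%N) k2).
  apply: ltr_sum => [|i _]; first by apply/hasP; exists i0 => //; rewrite mem_index_enum.
  by rewrite mul1r ltNge; apply/negP; exact: no.
exists i; rewrite /cond_risk -/P.
(* Outside [A i] the loss is at least rho^2, and this happens with probability at least 1/8. *)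
apply: (@le_trans _ _ (\int[P]_z ((rho ^+ 2)%:E * (\1_(~` A i) z)%:E)%E)%E); last first.
  apply: ge0_le_integralT => z.
    by rewrite -EFinM lee_fin mulr_ge0// sqr_ge0.
  rewrite -EFinM lee_fin indicE; case: (boolP (z \in ~` A i)) => [|_]; last first.
    by rewrite mulr0 sqr_ge0.
  rewrite inE /A /B /= mulr1 => /negP; rewrite -leNgt => h.
  by rewrite lerXn2r ?nnegrE ?l2norm_ge0// ltW.
have mI : measurable_fun setT (fun z : 'cV[R]_n => (\1_(~` A i) z : R)%:E).
  by apply/measurable_EFinP; apply: measurable_indic; exact: measurableC.
rewrite (ge0_integralZl P measurableT mI) ?lee_fin ?sqr_ge0//.
have mAC : measurable (~` A i) by exact: measurableC.
have -> : (\int[P]_z (\1_(~` A i) z)%:E = (1 - fine (P (A i)))%:E)%E.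
  apply: (eq_trans (integral_indic P measurableT mAC)).
  apply: (eq_trans (congr1 P (setIT _))).
  by rewrite probability_setC// EFinB fineK.
rewrite -EFinM lee_fin ler_wpM2l ?sqr_ge0//; lra.
Qed.

End fano_risk.

(** * Separated families from lower bounds on nets *)

Section packing.
Context {R : realType} {p : nat}.
Implicit Types (K : set 'cV[R]_p).

(** Greedy choice: a separated set with fewer than k points is not a net, so some point of K is far
    from all of it and can be added. Stated through a lower bound on all finite nets, it also covers
    the case where there are none. *)
Lemma separated_fset K (eps : R) k : 0 < eps ->
  (forall S : {fset 'cV[R]_p}, [set` S] `<=` K ->
     (forall x, K x -> exists2 y, y \in S & l2norm (x - y) < eps) -> (k <= #|` S|)%N) ->
  exists2 S : {fset 'cV[R]_p}, [set` S] `<=` K /\ (#|` S| = k)%N &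
    forall x y, x \in S -> y \in S -> x != y -> eps <= l2norm (x - y).
Proof.
move=> eps0; elim: k => [_|k IH cov].
  exists fset0; last by move=> x y; rewrite in_fset0.
  by split; [move=> x /=; rewrite in_fset0|rewrite cardfs0].
have [S [SK Sk] Ssep] : exists2 S : {fset 'cV[R]_p}, [set` S] `<=` K /\ (#|` S| = k)%N &
    forall x y, x \in S -> y \in S -> x != y -> eps <= l2norm (x - y).
  by apply: IH => S SK Sc; exact: ltnW (cov S SK Sc).
have [x Kx xS] : exists2 x, K x & forall y, y \in S -> eps <= l2norm (x - y).
  apply: contrapT => nx.
  suff /(cov S SK) : forall x, K x -> exists2 y, y \in S & l2norm (x - y) < eps.
    by rewrite Sk ltnn.
  move=> x Kx; apply: contrapT => ny; apply: nx; exists x => // y yS.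
  by rewrite leNgt; apply/negP => xy; apply: ny; exists y.
have xNS : x \notin S.
  apply/negP => /xS; rewrite subrr /l2norm big1 ?sqrtr0; last by move=> i _; rewrite mxE expr0n.
  by rewrite leNgt eps0.
exists (x |` S)%fset.
  split; last by rewrite cardfsU1 xNS Sk.
  by move=> y /=; rewrite in_fset1U => /orP[/eqP->//|]; exact: SK.
move=> y z; rewrite !in_fset1U => /orP[/eqP->|yS] /orP[/eqP->|zS] yz.
- by rewrite eqxx in yz.
- exact: xS.
- by rewrite -l2normN opprB; exact: xS.
- exact: Ssep.
Qed.

Lemma separated_family K (eps : R) k : 0 < eps ->
  (forall S : {fset 'cV[R]_p}, [set` S] `<=` K ->
     (forall x, K x -> exists2 y, y \in S & l2norm (x - y) < eps) -> (k <= #|` S|)%N) ->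
  exists2 v : 'I_k -> 'cV[R]_p, (forall i, K (v i)) &
    forall i j, i != j -> eps <= l2norm (v i - v j).
Proof.
move=> eps0 /(separated_fset eps0)[S [SK Sk] Ssep].
have lts (i : 'I_k) : (i < size (enum_fset S))%N by rewrite Sk.
exists (fun i => nth 0 (enum_fset S) i) => [i|i j ij]; first by apply: SK; exact: mem_nth.
apply: Ssep; try exact: mem_nth.
by rewrite nth_uniq.
Qed.

End packing.

(** * Minimax risk, covering numbers and the conclusion *)

Section minimax.
Context {R : realType} {n p : nat}.
Implicit Types (x : 'M[R]_(n, p)) (K T : set 'cV[R]_p).

Lemma minimax_risk_ge0 (sigma : R) T x : T !=set0 -> (0 <= minimax_risk sigma T x)%E.
Proof.
move=> [M TM]; apply: le_ereal_inf_tmp => _ [Mhat _ <-].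
apply: le_ereal_sup_tmp; exists (cond_risk sigma Mhat M x); first by exists M.
by apply: integral_ge0 => z _; rewrite lee_fin sqr_ge0.
Qed.

Lemma minimax_risk_ge K T x (sigma c eps : R) k (v : 'I_k -> 'cV[R]_p) :
  (0 < n)%N -> 0 < sigma -> 0 < c -> 0 < eps -> (0 < k)%N ->
  (forall y, K y -> l2norm (x *m y) <= c) ->
  (forall r y, 0 <= r -> K y -> T (r *: y)) ->
  (forall i, K (v i)) -> (forall i j, i != j -> eps <= l2norm (v i - v j)) ->
  ((64^-1 * sigma ^+ 2 / c ^+ 2 * eps ^+ 2 * ln k%:R / n%:R)%:E <= minimax_risk sigma T x)%E.
Proof.
move=> n0 s0 c0 e0 k0 xK KT Kv vsep.
(* A single hypothesis gives the bound 0, as ln 1 = 0. *)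
have [k1|k2] := leqP k 1.
  have -> : k = 1%N by apply/eqP; rewrite eqn_leq k1.
  rewrite ln1 mulr0 mul0r; apply: minimax_risk_ge0; exists (0 *: v (Ordinal k0)).
  exact: KT.
have k1 : 1 < k%:R :> R by rewrite ltr1n.
have kp : 0 < k%:R :> R by rewrite ltr0n.
have L0 : 0 < ln (k%:R : R) by rewrite ln_gt0.
have n0' : 0 < n%:R :> R by rewrite ltr0n.
have c20 : c ^+ 2 != 0 by rewrite expf_neq0 ?gt_eqF.
have q0 : 0 < sigma ^+ 2 * ln k%:R / (2 * n%:R * c ^+ 2).
  by rewrite divr_gt0 ?mulr_gt0 ?exprn_gt0.
(* Makes r^2 c^2 / (sigma^2 / n) = ln k / 2, whose exponential sqrt k is the largest value that
   [fano_risk] admits. *)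
pose r := Num.sqrt (sigma ^+ 2 * ln k%:R / (2 * n%:R * c ^+ 2)).
have r0 : 0 < r by rewrite sqrtr_gt0.
have r2 : r ^+ 2 = sigma ^+ 2 * ln k%:R / (2 * n%:R * c ^+ 2) by rewrite sqr_sqrtr// ltW.
have sn : sigma / Num.sqrt n%:R != 0.
  by rewrite mulf_neq0 ?gt_eqF// invr_gt0 sqrtr_gt0.
apply: le_ereal_inf_tmp => _ [Mhat _ <-].
have [|||i Hi] := @fano_risk R n p x sigma Mhat k (fun i => r *: v i) (r * eps / 2) sn k2.
- by rewrite divr_gt0// mulr_gt0.
- move=> i j ij; rewrite -scalerBr l2normZ gtr0_norm//.
  by have := ler_wpM2l (ltW r0) (vsep i j ij); lra.
- move=> i; have -> : Num.sqrt k%:R = expR (ln k%:R / 2) :> R.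
    rewrite -[k%:R in LHS](@lnK R) ?posrE//.
    rewrite (_ : ln k%:R = ln k%:R / 2 + ln k%:R / 2) ?expRD; last by lra.
    by rewrite -expr2 sqrtr_sqr gtr0_norm ?expR_gt0//; congr expR; lra.
  rewrite ler_expR expr_div_n /= -(scalemxAr r x (v i)) l2normZ gtr0_norm// exprMn r2.
  rewrite [Num.sqrt n%:R ^+ 2]sqr_sqrtr ?ler0n//.
  have le_c : l2norm (x *m v i) ^+ 2 <= c ^+ 2 by rewrite ler_pXn2r ?nnegrE ?l2norm_ge0 ?xK// ltW.
  rewrite ler_pdivrMr ?divr_gt0 ?exprn_gt0//.
  apply: le_trans (ler_wpM2l (ltW q0) le_c) _.
  by rewrite le_eqVlt; apply/orP; left; apply/eqP; field; rewrite ?gt_eqF.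
apply: le_ereal_sup_tmp; exists (cond_risk sigma Mhat (r *: v i) x).
  by exists (r *: v i) => //; apply: KT => //; exact: ltW.
apply: le_trans Hi; rewrite lee_fin expr_div_n exprMn r2 le_eqVlt; apply/orP; left; apply/eqP.
by field; rewrite ?gt_eqF.
Qed.

End minimax.

Section sudakov_minimax.
Context {R : realType} {n p : nat}.
Implicit Types (x : 'M[R]_(n, p)) (K T : set 'cV[R]_p).

Lemma sudakov_le_minimax_risk K T x (sigma c : R) :
  (0 < n)%N -> 0 <= sigma -> 0 < c -> K 0 ->
  (forall y, K y -> l2norm (x *m y) <= c) ->
  (forall r y, 0 <= r -> K y -> T (r *: y)) ->
  ((64^-1 * sigma ^+ 2 / c ^+ 2)%:E * (sudakov K * ((Num.sqrt n%:R)^-1)%:E) ^+ 2 <=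
   minimax_risk sigma T x)%E.
Proof.
move=> n0 s0 c0 K0 xK KT.
have risk0 : (0 <= minimax_risk sigma T x)%E.
  by apply: minimax_risk_ge0; exists (0 *: 0); exact: KT.
move: s0; rewrite le_eqVlt => /orP[/eqP s0|s0].
  (* Without noise the left-hand side is 0, by 0 * oo = 0 even if the Sudakov term is infinite. *)
  have -> : 64^-1 * sigma ^+ 2 / c ^+ 2 = 0 by rewrite -s0 expr0n mulr0 mul0r.
  by rewrite mul0e.
have n0' : 0 < n%:R :> R by rewrite ltr0n.
set C := 64^-1 * sigma ^+ 2 / c ^+ 2.
have C0 : 0 < C by rewrite divr_gt0 ?mulr_gt0 ?exprn_gt0 ?invr_gt0.
have C0' : C != 0 by rewrite gt_eqF.
have packing_le eps k : 0 < eps -> (0 < k)%N ->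
    (forall S : {fset 'cV[R]_p}, [set` S] `<=` K ->
     (forall y, K y -> exists2 z, z \in S & l2norm (y - z) < eps) -> (k <= #|` S|)%N) ->
    ((C * eps ^+ 2 * ln k%:R / n%:R)%:E <= minimax_risk sigma T x)%E.
  move=> e0 k0 /(separated_family e0)[v Kv vsep].
  exact: (minimax_risk_ge n0 s0 c0 e0 k0 xK KT Kv vsep).
case: (minimax_risk sigma T x) risk0 packing_le => [a|_ _|//]; last by rewrite leey.
rewrite lee_fin => a0 packing_le; clearbody C.
suff : (sudakov K <= (Num.sqrt (a * n%:R / C))%:E)%E.
  have sud0 : (0 <= sudakov K)%E.
    pose N := covering_number K 1.
    apply: le_ereal_sup_tmp; exists (1%:E * sqrte (lne N))%E.
      by exists 1 => //=; exact: ltr01.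
    by rewrite mul1e sqrte_ge0.
  case: (sudakov K) sud0 => [s|//|//]; rewrite !lee_fin => sud0 sle.
  rewrite -expr2 exprMn exprVn sqr_sqrtr ?ler0n//.
  have : s ^+ 2 <= a * n%:R / C.
    rewrite -[leRHS]sqr_sqrtr; last by rewrite divr_ge0 ?mulr_ge0 ?ler0n ?(ltW C0).
    by rewrite ler_pXn2r ?nnegrE ?sqrtr_ge0.
  by rewrite ler_pdivlMr// mulrA ler_pdivrMr// mulrC.
apply: ge_ereal_sup => _ [eps /= e0 <-].
have e20 : 0 < eps ^+ 2 by rewrite exprn_gt0.
(* The sizes of finite nets. The least one bounds the covering number from above and all nets from
   below, so the packing bound applies to it. *)
pose P k := `[< exists S : {fset 'cV[R]_p}, [/\ [set` S] `<=` K,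
  forall y, K y -> exists2 z, z \in S & l2norm (y - z) < eps & #|` S| = k] >].
have [/ex_minnP[k /asboolP[S [SK Scov Sk]] kmin]|nP] := pselect (exists k, P k).
  have k0 : (0 < k)%N.
    have [y yS _] := Scov _ K0.
    by rewrite -Sk cardfs_gt0; apply/fset0Pn; exists y.
  have k1 : 1 <= k%:R :> R by rewrite ler1n.
  have kp : 0 < k%:R :> R by rewrite ltr0n.
  have lk0 : 0 <= ln (k%:R : R) by rewrite ln_ge0.
  have Nk : (covering_number K eps <= k%:R%:E)%E.
    by apply: ereal_inf_lbound; exists S => //; rewrite Sk.
  have N0 : (0 <= covering_number K eps)%E.
    by apply: le_ereal_inf_tmp => _ [S' _ <-]; rewrite lee_fin ler0n.
  have lNk : (lne (covering_number K eps) <= (ln k%:R)%:E)%E.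
    by rewrite -lne_EFin// lee_lne// in_itv/= ?leey ?N0 ?lee_fin ?ler0n.
  apply: (@le_trans _ _ (eps%:E * sqrte (ln k%:R)%:E)%E).
    by rewrite lee_pmul2l ?lte_fin// lee_sqrt.
  rewrite /= -EFinM lee_fin.
  have : C * eps ^+ 2 * ln k%:R / n%:R <= a.
    rewrite -lee_fin; apply: packing_le => // S' S'K S'cov.
    by apply: kmin; apply/asboolP; exists S'.
  rewrite ler_pdivrMr// => le_a.
  rewrite -(@ler_pXn2r _ 2)// ?nnegrE ?sqrtr_ge0 ?mulr_ge0 ?sqrtr_ge0 ?(ltW e0)//.
  rewrite exprMn !sqr_sqrtr ?divr_ge0 ?mulr_ge0 ?ler0n ?(ltW C0)//.
  by rewrite ler_pdivlMr// mulrC mulrA.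
exfalso.
(* Without a finite net, separated families of every size exist; a size above exp B would force a
   risk larger than its value a. *)
pose B := a * n%:R / (C * eps ^+ 2).
set k := (Num.truncn (expR B)).+1.
have : C * eps ^+ 2 * ln k%:R / n%:R <= a.
  rewrite -lee_fin; apply: packing_le => // S SK Scov.
  by exfalso; apply: nP; exists #|` S|; apply/asboolP; exists S.
rewrite ler_pdivrMr// => le_a.
have : ln (k%:R : R) <= B by rewrite ler_pdivlMr ?mulr_gt0// mulrC.
rewrite -ler_expR lnK ?posrE ?ltr0n// => /le_lt_trans /(_ (truncnS_gt _)).
by rewrite ltxx.
Qed.

End sudakov_minimax.

Lemma gaussian_width_ge0 (R : realType) (p : nat) (K : set 'cV[R]_p) : K 0 ->
  (0 <= gaussian_width K)%E.
Proof.
move=> K0; apply: integral_ge0 => g _; apply: le_ereal_sup_tmp.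
exists (inner g 0)%:E; first by exists 0.
by rewrite /inner big1// => i _; rewrite mxE mulr0.
Qed.

(** The bound by 1/c forces n > 0, and an infinite width would make the left-hand side infinite. *)
Lemma width_bound_split (R : realType) (n : nat) (W : \bar R) (c delta : R) :
  (0 <= W)%E -> 0 < c -> 0 < delta ->
  (maxe (4%:E * (W + delta%:E) ^+ 2 * (c ^- 2)%:E) (c^-1)%:E <= n%:R%:E)%E ->
  exists2 w, W = w%:E & [/\ (0 < n)%N, 0 <= w & 2 * (w + delta) <= c * Num.sqrt n%:R].
Proof.
move=> W0 c0 d0; rewrite ge_max => /andP[Wn cn].
have n0 : (0 < n)%N.
  by rewrite -(@ltr0n R); apply: lt_le_trans (_ : c^-1 <= _); rewrite ?invr_gt0// -lee_fin.
have c2 : 0 < c ^- 2 by rewrite invr_gt0 exprn_gt0.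
case: W W0 Wn => [w||//].
  rewrite !lee_fin => w0; rewrite -expr2 ler_pdivrMr ?exprn_gt0// => Wn.
  exists w => //; split=> //.
  rewrite -(@ler_pXn2r _ 2)// ?nnegrE ?mulr_ge0 ?addr_ge0 ?sqrtr_ge0 ?(ltW c0) ?(ltW d0)//.
  by rewrite !exprMn sqr_sqrtr ?ler0n// [leRHS]mulrC; apply: le_trans Wn; rewrite -natrX.
move=> _; rewrite addye// (_ : (+oo ^+ 2)%E = +oo%E); last exact: mulyy.
rewrite gt0_muley ?lte_fin// gt0_mulye ?lte_fin//.
Qed.

Theorem theorem3 (R : realType) :
  exists c0 : R, 0 < c0 /\
  forall (n p : nat) (A : set 'cV[R]_p) (M : 'cV[R]_p) (sigma c delta : R),
    atom_set A -> 0 <= sigma -> 0 < c < 1 -> 0 < delta ->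
    (maxe (4%:E * (gaussian_width (l2ball `&` tangent_cone A M) + delta%:E) ^+ 2
             * (c ^- 2)%:E)
          (c^-1)%:E <= n%:R%:E)%E ->
    prob_ge (design_law n p)
      [set x : 'M[R]_(n, p) |
        ((c0 * sigma ^+ 2 / (1 + c) ^+ 2)%:E
           * (sudakov (l2ball `&` tangent_cone A M)
                * ((Num.sqrt n%:R)^-1)%:E) ^+ 2
         <= minimax_risk sigma (tangent_cone A M) x)%E]
      (1 - 2 * expR (- (delta ^+ 2 / 2))).
Proof.
exists 64^-1; split; first by rewrite invr_gt0 ltr0n.
move=> n p A M sigma c delta _ s0 /andP[c0 _] d0.
set K := l2ball `&` _ => hn.
have K0 : K 0.
  split; first by rewrite /l2ball /= /l2norm big1 ?sqrtr0// => i _; rewrite mxE expr0n.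
  by exists 0, 0; rewrite /= ?addr0 ?scaler0.
have [w Kw [n0 w0 hw]] := width_bound_split (gaussian_width_ge0 K0) c0 d0 hn.
have KB : K `<=` l2ball by move=> x [].
have [E [mE EK PE]] := good_event K0 KB Kw n0 w0 c0 d0 hw.
exists E; split => // x /EK xK.
apply: (sudakov_le_minimax_risk n0 s0 _ K0 xK); first by rewrite addr_gt0.
(* K lies in the tangent cone, which is stable under nonnegative scaling, so the rescaled packing
   points are admissible parameters. *)
move=> r _ r0 [_ [t [h hA [t0 ->]]]].
by exists (r * t), h => //; rewrite mulr_ge0// scalerA.
Qed.
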